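(* Assume that $\lambda\in\mathbb R$ is not an eigenvalue of the problem $L_{\Delta_p}u=\lambda|u|^{p-2}u$ in $\Omega$, $u=0$ in $\mathbb R^N\setminus\Omega$. Let $\Phi_\lambda(u)=I_p(u)-\lambda J_p(u)$, $u\in X_0^p(\Omega)$, and $\mathscr I^\lambda=\{u\in\mathcal M_p:\mathscr I_p(u)\le\lambda\}$. (i) If $\lambda<\lambda_1$, then $C^l(\Phi_\lambda,0)\cong\delta_{l0}\,\mathbb Z_2$ for all $l\ge0$, where $\delta$ denotes the Kronecker delta. (ii) If $\lambda>\lambda_1$, then $C^l(\Phi_\lambda,0)\cong\widetilde H^{l-1}(\mathscr I^\lambda)$ for all $l\ge0$; in particular, $C^0(\Phi_\lambda,0)=0$. (iii) If $\lambda_k<\lambda<\lambda_{k+1}$ for some $k\ge1$, then $C^k(\Phi_\lambda,0)\ne0$. In particular, $C^l(\Phi_\lambda,0)$ is nontrivial for some $l$.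
   Context: Setting: $N\ge1$ is an integer, $p\in(1,\infty)$, $\Omega\subset\mathbb R^N$ is a bounded domain, functions are real-valued, and $C_{N,p}>0$, $\rho_N(p)\in\mathbb R$ are fixed constants depending only on $N,p$ (the normalizing constants of the logarithmic $p$-Laplacian $L_{\Delta_p}$). $|\cdot|_p$ is the norm of $L^p(\mathbb R^N)$. Put $$[u]_p^p=C_{N,p}\iint_{|x-y|<1}\frac{|u(x)-u(y)|^p}{|x-y|^N}\,dx\,dy,$$ $$X_0^p(\Omega)=\{u\in L^p(\mathbb R^N):u=0\text{ in }\mathbb R^N\setminus\Omega,\ [u]_p<\infty\},$$ with norm $\|u\|=[u]_p$ (equivalent to $(|u|_p^p+[u]_p^p)^{1/p}$); this is a uniformly convex Banach space compactly embedded in $L^p(\Omega)$. For $u,v\in X_0^p(\Omega)$ let $$\begin{aligned}\mathscr E_{L,p}(u,v)=&\ \tfrac{C_{N,p}}2\iint_{|x-y|<1}\frac{|u(x)-u(y)|^{p-2}(u(x)-u(y))(v(x)-v(y))}{|x-y|^N}\,dy\,dx\\&+\tfrac{C_{N,p}}2\iint_{|x-y|\ge1}\frac{1}{|x-y|^N}\big[|u(x)-u(y)|^{p-2}(u(x)-u(y))(v(x)-v(y))\\&\qquad-|u(x)|^{p-2}u(x)v(x)-|u(y)|^{p-2}u(y)v(y)\big]\,dy\,dx+\rho_N(p)\int_{\mathbb R^N}|u|^{p-2}uv\,dx.\end{aligned}$$ Eigenvalues: $\lambda\in\mathbb R$ is an eigenvalue if there is $u\in X_0^p(\Omega)\setminus\{0\}$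 with $\mathscr E_{L,p}(u,v)=\lambda\int_\Omega|u|^{p-2}uv\,dx$ for all $v\in X_0^p(\Omega)$. Put $I_p(u)=\frac1p\mathscr E_{L,p}(u,u)$, $J_p(u)=\frac1p\int_\Omega|u|^p\,dx$, $\mathcal M_p=\{u\in X_0^p(\Omega):J_p(u)=1\}$ and $\mathscr I_p=I_p|_{\mathcal M_p}$. Cohomology: $H^*$ is Alexander–Spanier cohomology with $\mathbb Z_2$ coefficients and $\widetilde H^*$ is reduced cohomology. When $\lambda$ is not an eigenvalue, $0$ is the only critical point of $\Phi_\lambda$, and the critical groups of $\Phi_\lambda$ at $0$ are $C^l(\Phi_\lambda,0)=H^l(\Phi_\lambda^0,\Phi_\lambda^0\setminus\{0\})$, $l\ge0$, where $\Phi_\lambda^0=\{u\in X_0^p(\Omega):\Phi_\lambda(u)\le0\}$. Cohomological index (Fadell–Rabinowitz): for a symmetric subset $A$ of $W\setminus\{0\}$, $W$ a Banach space, let $\overline A=A/\mathbb Z_2$ be the quotient identifying $u$ and $-u$, $f:\overline A\to\mathbb{RP}^\infty$ its classifying map, and $f^*:H^*(\mathbb{RP}^\infty)\to H^*(\overline A)$ the induced homomorphism. Then $i(\emptyset)=0$ and $i(A)=\sup\{m\ge1:f^*(\omega^{m-1})\ne0\}$ for $A\ne\emptyset$, where $\omega\in H^1(\mathbb{RP}^\infty)$ is the generator of $H^*(\mathbb{RP}^\infty)=\mathbb Z_2[\omega]$. Minimax eigenvalues: for $k\ge1$, $\lambda_k=\inf\{\sup_{u\in M}\mathscr I_p(u):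 M\subset\mathcal M_p\text{ symmetric},\ i(M)\ge k\}$. These form a nondecreasing sequence of eigenvalues tending to $\infty$, and $\lambda_1=\inf_{\mathcal M_p}\mathscr I_p$. *)

(* Defs.v *)
From HB Require Import structures.
From mathcomp Require Import all_boot all_order all_algebra generic_quotient.
From mathcomp Require Import ring_quotient mxpoly.
From mathcomp Require Import all_classical all_reals all_analysis.
From mathcomp Require Import measurable_realfun.

Set Implicit Arguments.
Unset Strict Implicit.
Unset Printing Implicit Defensive.

Import Order.TTheory GRing.Theory Num.Theory.
Import numFieldNormedType.Exports.

Local Open Scope classical_set_scope.
Local Open Scope ring_scope.
Local Open Scope quotient_scope.

Section Subquotient.
Variables (V : zmodType) (Z B : zmodClosed V).

Definition subgroup : Type := {x : V | x \in Z}.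
HB.instance Definition _ := SubType.on subgroup.
HB.instance Definition _ := Choice.on subgroup.
HB.instance Definition _ := [SubChoice_isSubZmodule of subgroup by <:].

Definition subgroup_cap : {pred subgroup} := [pred x | \val x \in B].

Fact subgroup_cap_zmod_closed : zmod_closed subgroup_cap.
Proof.
split=> [|x y]; rewrite !inE ?raddf0 ?rpred0//.
by move=> xB yB; rewrite raddfB rpredB.
Qed.
HB.instance Definition _ :=
  GRing.isZmodClosed.Build _ subgroup_cap subgroup_cap_zmod_closed.

(* [Z / (Z :&: B)]; in the uses below [B] is contained in [Z] *)
Definition subquotient : zmodType := Quotient.quot subgroup_cap.

Definition subquotient_class (x : V) (Zx : x \in Z) : subquotient :=
  \pi_subquotient (Sub x Zx : subgroup).

Definition subquotient_repr (c : subquotient) : V :=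
  \val (repr c : subgroup).

Lemma subquotient_reprP c : subquotient_repr c \in Z.
Proof. exact: valP. Qed.

End Subquotient.

Definition null_subgroup (V : zmodType) : {pred V} := pred1 0.
Fact null_subgroup_zmod_closed V : zmod_closed (@null_subgroup V).
Proof. by split=> [|x y /eqP-> /eqP->]; rewrite inE ?subrr. Qed.
HB.instance Definition _ V := GRing.isZmodClosed.Build _ (@null_subgroup V)
  (@null_subgroup_zmod_closed V).

Definition isomorphic (G H : zmodType) : Prop :=
  exists f : {additive G -> H}, bijective f.

Section Cochains.
Variable X : topologicalType.

Definition cochain (q : nat) : zmodType := (('I_q.+1 -> X) -> 'F_2).

(* no signs: the coefficients are [Z_2] *)
Definition codiff q (phi : cochain q) : cochain q.+1 :=
  fun s => \sum_(i < q.+2) phi (s \o lift i).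

(* [phi] restricts to [0] in the cochains of the subspace [A] modulo the
   locally zero ones *)
Definition locally_zero (A : set X) q (phi : cochain q) : Prop :=
  forall x, A x -> exists2 U, nbhs x U &
    forall s : 'I_q.+1 -> X, (forall i, A (s i) /\ U (s i)) -> phi s = 0.

Lemma codiffB q (phi psi : cochain q) :
  codiff (phi - psi) = codiff phi - codiff psi.
Proof. by apply/funext => s; exact: sumrB. Qed.

Lemma codiff0 q : codiff (0 : cochain q) = 0.
Proof. by rewrite -(subrr 0) codiffB subrr. Qed.

Lemma locally_zero0 A q : locally_zero A (0 : cochain q).
Proof. by move=> x Ax; exists setT => //; exact: filterT. Qed.

Lemma locally_zeroB A q (phi psi : cochain q) :
  locally_zero A phi -> locally_zero A psi -> locally_zero A (phi - psi).
Proof.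
move=> phi0 psi0 x Ax; have [U xU U0] := phi0 x Ax; have [V xV V0] := psi0 x Ax.
exists (U `&` V) => [|s sUV]; first exact: filterI.
rewrite [LHS](_ : _ = phi s - psi s)// U0 ?V0 ?subrr// => i;
  by have [? []] := sUV i.
Qed.

(* [delta phi] vanishes in the cochains of [X] and [phi] in those of [A] *)
Definition cocycle (A : set X) q : {pred cochain q} :=
  mem [set phi : cochain q | locally_zero A phi /\ locally_zero setT (codiff phi)].

Arguments cocycle : clear implicits.

Definition coboundary (A : set X) q : {pred cochain q} :=
  match q return {pred cochain q} with
  | 0 => mem [set phi : cochain 0 | locally_zero setT phi]
  | q'.+1 => mem [set phi : cochain q'.+1 | exists2 psi : cochain q',
      locally_zero A psi & locally_zero setT (phi - codiff psi)]
  end.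

Arguments coboundary : clear implicits.

(* degree [0] coboundaries of the augmented complex: the constants *)
Definition reduced_coboundary q : {pred cochain q} :=
  match q return {pred cochain q} with
  | 0 => mem [set phi : cochain 0 | exists c : 'F_2, locally_zero setT (phi - cst c)]
  | q'.+1 => coboundary set0 q'.+1
  end.

Arguments reduced_coboundary : clear implicits.

Fact cocycle_zmod_closed A q : zmod_closed (cocycle A q).
Proof.
split=> [|phi psi].
  by rewrite inE/= codiff0; split; exact: locally_zero0.
move=> /set_mem[phi0 dphi0] /set_mem[psi0 dpsi0]; rewrite inE/=.
by rewrite codiffB; split; exact: locally_zeroB.
Qed.
HB.instance Definition _ A q :=
  GRing.isZmodClosed.Build _ (cocycle A q) (@cocycle_zmod_closed A q).

Fact coboundary_zmod_closed A q : zmod_closed (coboundary A q).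
Proof.
case: q => [|q]; split=> [|phi psi].
- by rewrite inE; exact: locally_zero0.
- by move=> /set_mem ? /set_mem ?; rewrite inE; exact: locally_zeroB.
- by rewrite inE/=; exists 0; rewrite ?codiff0 ?subrr; exact: locally_zero0.
- move=> /set_mem[a a0 pa] /set_mem[b b0 pb]; rewrite inE/=.
  exists (a - b); first exact: locally_zeroB.
  have -> : phi - psi - codiff (a - b) = phi - codiff a - (psi - codiff b).
    by rewrite codiffB !opprB addrACA [RHS]addrACA; congr (_ + _); rewrite addrC.
  exact: locally_zeroB.
Qed.
HB.instance Definition _ A q :=
  GRing.isZmodClosed.Build _ (coboundary A q) (@coboundary_zmod_closed A q).

Fact reduced_coboundary_zmod_closed q : zmod_closed (reduced_coboundary q).
Proof.
case: q => [|q]; last exact: coboundary_zmod_closed.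
split=> [|phi psi].
  by rewrite inE/=; exists 0; rewrite subrr; exact: locally_zero0.
move=> /set_mem[a pa] /set_mem[b pb]; rewrite inE/=; exists (a - b).
have -> : phi - psi - cst (a - b) = phi - cst a - (psi - cst b) :> cochain 0.
  by rewrite [cst _](_ : _ = cst a - cst b)// !opprB addrACA [RHS]addrACA;
    congr (_ + _); rewrite addrC.
exact: locally_zeroB.
Qed.
HB.instance Definition _ q :=
  GRing.isZmodClosed.Build _ (reduced_coboundary q)
    (@reduced_coboundary_zmod_closed q).

(* the kernel of the augmentation [Z_2 -> C^0(X)], which is
   [H^(-1)] of the augmented complex *)
Definition augmentation_kernel : {pred 'F_2} :=
  mem [set c : 'F_2 | locally_zero setT (cst c : cochain 0)].

Fact augmentation_kernel_zmod_closed : zmod_closed augmentation_kernel.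
Proof.
split=> [|a b]; first by rewrite inE; exact: locally_zero0.
by move=> /set_mem pa /set_mem pb; rewrite inE; exact: locally_zeroB.
Qed.
HB.instance Definition _ := GRing.isZmodClosed.Build _ augmentation_kernel
  augmentation_kernel_zmod_closed.

End Cochains.
Arguments cocycle {X} A q.
Arguments coboundary {X} A q.
Arguments reduced_coboundary X q : clear implicits.

Definition cohomology_pair (X : topologicalType) (A : set X) q : zmodType :=
  subquotient (cocycle A q) (coboundary A q).

Definition cohomology (X : topologicalType) q : zmodType :=
  cohomology_pair (set0 : set X) q.

Definition reduced_cohomology (X : topologicalType) (q : int) : zmodType :=
  match q with
  | Posz q => subquotient (cocycle (set0 : set X) q) (reduced_coboundary X q)
  | Negz 0 => subquotient (augmentation_kernel X) (@null_subgroup 'F_2)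
  | Negz _.+1 => 'rV['F_2]_0
  end.

Section Pullback.
Variables (X Y : topologicalType) (f : X -> Y).

Definition cochain_pullback q (phi : cochain Y q) : cochain X q :=
  fun s => phi (f \o s).

Hypothesis cf : continuous f.

Lemma locally_zero_pullback q (phi : cochain Y q) :
  locally_zero setT phi -> locally_zero setT (cochain_pullback phi).
Proof.
move=> phi0 x _; have [U fxU U0] := phi0 (f x) I.
exists (f @^-1` U); first exact: cf.
by move=> s sU; apply: U0 => i; have [] := sU i.
Qed.

Lemma cocycle_pullback q (phi : cochain Y q) :
  phi \in cocycle set0 q -> cochain_pullback phi \in cocycle set0 q.
Proof.
by move=> /set_mem[_ dphi]; rewrite inE; split=> //; exact: locally_zero_pullback dphi.
Qed.

Definition pullback q (c : cohomology Y q) : cohomology X q :=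
  subquotient_class _ (cocycle_pullback (subquotient_reprP c)).

End Pullback.

Section CupProduct.
Variable X : topologicalType.

(* [inord k : 'I_(p + q).+1] is the vertex [k] of a [p + q]-simplex *)
Definition cup_cochain p q (phi : cochain X p) (psi : cochain X q) :
    cochain X (p + q) :=
  fun s => phi (fun i => s (inord i)) * psi (fun j => s (inord (p + j))).

Lemma codiff_cup p q (phi : cochain X p) (psi : cochain X q)
    (s : 'I_(p + q).+2 -> X) :
  codiff (cup_cochain phi psi) s =
  codiff phi (fun i => s (inord i)) * psi (fun j => s (inord (p.+1 + j))) +
  phi (fun i => s (inord i)) * codiff psi (fun j => s (inord (p + j))).
Proof.
pose t k := s (inord k).
pose Phi i := phi (fun j => t (bump i j)).
pose Psi i := psi (fun j => t (p + bump i j)%N).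
have liftE (i : 'I_(p + q).+2) k : (k <= p + q)%N ->
    (s \o lift i) (inord k) = t (bump i k).
  move=> kpq; rewrite /t /=; congr s; apply/val_inj => /=.
  by rewrite inordK// inordK// ltnS (leq_trans (leq_add (leq_b1 _) (leqnn _))).
have dphiE : codiff phi (fun i => s (inord i)) = \sum_(0 <= i < p.+2) Phi i.
  by rewrite big_mkord.
have dpsiE : codiff psi (fun j => s (inord (p + j))) =
    \sum_(0 <= i < q.+2) Psi i.
  by rewrite big_mkord.
have Phi_last : Phi p.+1 = phi (fun i => s (inord i)).
  congr phi; apply/funext => j.
  by rewrite /t /bump; case: ltnP => // /(leq_trans (ltn_ord j)); rewrite ltnn.
have Psi_0 : Psi 0%N = psi (fun j => s (inord (p.+1 + j))).
  by congr psi; apply/funext => j; rewrite /t /bump add1n addnS.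
rewrite dphiE dpsiE big_nat_recr//= mulrDl Phi_last.
rewrite [\sum_(0 <= i < q.+2) _]big_nat_recl//= mulrDr Psi_0.
have F2 (x : 'F_2) : x + x = 0 by apply: addrr_pchar2; exact: pchar_Fp.
rewrite addrA -[X in _ = X + _]addrA F2 addr0.
pose Cup i := phi (fun j => t (bump i j)) * psi (fun j => t (bump i (p + j))).
transitivity (\sum_(0 <= i < (p + q).+2) Cup i).
  rewrite big_mkord; apply: eq_bigr => i _; congr (phi _ * psi _).
    apply/funext => j; rewrite liftE// (leq_trans _ (leq_addr _ _))//.
    by rewrite -ltnS ltn_ord.
  apply/funext => j; rewrite liftE// leq_add2l.
  by rewrite -ltnS ltn_ord.
have pqE : ((p + q).+2 - p.+1)%N = q.+1 by rewrite subSS -addnS addKn.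
have pq : (p.+1 <= (p + q).+2)%N by rewrite ltnS (leq_trans (leq_addr q _)).
rewrite (big_cat_nat (leq0n p.+1) pq)/=; congr (_ + _).
  rewrite mulr_suml; apply: eq_big_nat => i /andP[_ ip].
  congr (_ * psi _); apply/funext => j.
  have ipj : (i <= p + j)%N by apply: leq_trans (leq_addr j p); rewrite -ltnS.
  by rewrite /t /bump ipj add1n addSn.
rewrite -{1}[p.+1]add0n big_addn pqE mulr_sumr.
apply: eq_big_nat => i _; congr (phi _ * psi _); apply/funext => j.
  have jip : (j < i + p.+1)%N by apply: leq_trans (ltn_ord j) (leq_addl _ _).
  by rewrite /t /bump leqNgt jip.
rewrite /t /bump; congr (s (inord _)).
have -> : (i + p.+1 <= p + j)%N = (i.+1 <= j)%N.
  by rewrite addnS -addSn [(i.+1 + p)%N]addnC leq_add2l.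
by rewrite addnCA.
Qed.

Lemma cocycle_cup p q (phi : cochain X p) (psi : cochain X q) :
  phi \in cocycle set0 p -> psi \in cocycle set0 q ->
  cup_cochain phi psi \in cocycle set0 (p + q).
Proof.
move=> /set_mem[_ dphi0] /set_mem[_ dpsi0]; rewrite inE; split=> // x _.
have [U xU U0] := dphi0 x I; have [V xV V0] := dpsi0 x I.
exists (U `&` V) => [|s sUV]; first exact: filterI.
rewrite codiff_cup U0 ?V0 ?mulr0 ?mul0r ?addr0// => i; split=> //.
- by have [_ []] := sUV (inord (p + i)).
- by have [_ []] := sUV (inord i).
Qed.

Definition cup p q (a : cohomology X p) (b : cohomology X q) :
    cohomology X (p + q) :=
  subquotient_class _ (cocycle_cup (subquotient_reprP a) (subquotient_reprP b)).

Lemma cocycle_one : (cst 1 : cochain X 0) \in cocycle set0 0.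
Proof.
rewrite inE; split=> // x _; exists setT; first exact: filterT.
move=> s _; rewrite /codiff !big_ord_recl big_ord0 addr0/=.
by apply: addrr_pchar2; exact: pchar_Fp.
Qed.

Definition cohomology_one : cohomology X 0 := subquotient_class _ cocycle_one.

Fixpoint cup_power (w : cohomology X 1) m : cohomology X m :=
  match m with
  | 0 => cohomology_one
  | m'.+1 => cup w (cup_power w m')
  end.

(* [H^*(X) = Z_2[w]] as graded rings *)
Definition polynomial_generator (w : cohomology X 1) : Prop :=
  forall q (x : cohomology X q), exists! b : bool, x = cup_power w q *+ b.

End CupProduct.

Section AntipodalQuotient.
Variables (W : PreTopologicalZmodule.type) (A : set W).

Definition antipodal (x y : A) : bool :=
  `[< \val x = \val y \/ \val x = - \val y >].

Fact antipodal_equiv : equiv_class_of antipodal.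
Proof.
split=> [x|x y|y x z]; first by apply/asboolP; left.
  by apply/asbool_equiv_eq; split=> -[->|->]; rewrite ?opprK; auto.
by move=> /asboolP xy /asboolP yz; apply/asboolP; case: xy => ->; case: yz => ->;
  rewrite ?opprK; auto.
Qed.
Canonical antipodal_equivRel := EquivRelPack antipodal_equiv.
Canonical antipodal_encModRel := defaultEncModRel antipodal.

Definition antipodal_quotient : topologicalType :=
  quotient_topology {eq_quot antipodal}.

Definition antipodal_pi (x : A) : antipodal_quotient := \pi_{eq_quot antipodal} x.

End AntipodalQuotient.

Section InfiniteProjectiveSpace.
Variable R : realType.

(* finitely supported sequences [p`_0, p`_1, ...], with the direct limit
   topology of the spaces [R^n] *)
Definition Rinfty : Type := {poly R}.
HB.instance Definition _ := GRing.Zmodule.on Rinfty.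

Definition Rinfty_open (U : set Rinfty) : Prop :=
  forall n, open [set v : 'rV[R]_n | U (rVpoly v)].

Fact Rinfty_openT : Rinfty_open setT.
Proof. by move=> n; exact: openT. Qed.

Fact Rinfty_openI : setI_closed Rinfty_open.
Proof. by move=> U V oU oV n; exact: openI. Qed.

Fact Rinfty_open_bigU (I : Type) (f : I -> set Rinfty) :
  (forall i, Rinfty_open (f i)) -> Rinfty_open (\bigcup_i f i).
Proof. by move=> of_ n; apply: bigcup_open => i _; exact: of_. Qed.

HB.instance Definition _ := isOpenTopological.Build Rinfty
  Rinfty_openT Rinfty_openI Rinfty_open_bigU.

Definition Sinfty : set Rinfty :=
  [set x | \sum_(i < size (x : {poly R})) (x : {poly R})`_i ^+ 2 = 1].

Arguments Sinfty : clear implicits.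

Definition RPinfty : topologicalType := antipodal_quotient Sinfty.

End InfiniteProjectiveSpace.
Arguments Sinfty R : clear implicits.

Section Index.
Variables (R : realType) (W : PreTopologicalZmodule.type) (A : set W).

(* [f] pulls back the double covering [Sinfty -> RPinfty] to [A -> A / Z_2];
   such maps are unique up to homotopy *)
Definition classifying_map (f : antipodal_quotient A -> RPinfty R) : Prop :=
  exists F : A -> Sinfty R,
    [/\ continuous F,
        forall x y, \val x = - \val y -> \val (F x) = - \val (F y) &
        forall x, f (antipodal_pi x) = antipodal_pi (F x)].

Definition cohomological_index : \bar R :=
  if `[< A = set0 >] then 0%E else
  ereal_sup [set m%:R%:E | m in [set m : nat | (0 < m)%N /\
    exists (f : antipodal_quotient A -> RPinfty R) (cf : continuous f)
           (w : cohomology (RPinfty R) 1),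
      [/\ classifying_map f, polynomial_generator w &
          pullback cf (cup_power w m.-1) <> 0]]].

End Index.

Section LebesgueMeasure.
Variable R : realType.

Definition euclidean (N : nat) : measurableType _ :=
  N.-tuple (measurableTypeR R).

Definition cons_point n (z : measurableTypeR R * euclidean n) : euclidean n.+1 :=
  [tuple of z.1 :: z.2].

Lemma measurable_cons_point n : measurable_fun setT (@cons_point n).
Proof. exact: measurable_cons. Qed.

Lemma measurable_uncons_point n :
  measurable_fun setT (fun x : euclidean n.+1 => (thead x, [tuple of behead x])).
Proof.
apply: measurable_fun_pair; last exact: measurable_behead.
exact: measurable_tnth.
Qed.

Section Step.
Variables (n : nat) (m : {sigma_finite_measure set (euclidean n) -> \bar R}).

Definition lebesgue_step : set (euclidean n.+1) -> \bar R :=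
  pushforward (lebesgue_measure \x m)%E (@cons_point n).

HB.instance Definition _ := Measure.copy lebesgue_step
  (measure_function_pushforward__canonical__measure_function_Measure
    (lebesgue_measure \x m)%E (@measurable_cons_point n)).

Fact lebesgue_step_sigma_finite : sigma_finite setT lebesgue_step.
Proof.
have /sigma_finiteP[F [FT ndF Ffin]] := sigma_finiteT (@lebesgue_measure R).
have /sigma_finiteP[G [GT ndG Gfin]] := sigma_finiteT m.
pose h (x : euclidean n.+1) := (thead x, [tuple of behead x] : euclidean n).
have hK : h \o @cons_point n = id.
  by apply/funext => -[a t]/=; congr pair; apply/val_inj.
exists (fun i => h @^-1` (F i `*` G i)).
  rewrite -preimage_bigcup [X in _ @^-1` X](_ : _ = setT) ?preimage_setT//.
  rewrite -subTset => -[a t] _.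
  have [i _ Fia] : (\bigcup_i F i) a by rewrite -FT.
  have [j _ Gjt] : (\bigcup_i G i) t by rewrite -GT.
  exists (maxn i j) => //; split=> /=.
    by move: a Fia; exact/subsetPset/ndF/leq_maxl.
  by move: t Gjt; exact/subsetPset/ndG/leq_maxr.
move=> i; have [mFi Fioo] := Ffin i; have [mGi Gioo] := Gfin i; split.
  rewrite -[X in measurable X]setTI; apply: measurable_uncons_point => //.
  exact: measurableX.
rewrite /lebesgue_step /pushforward -comp_preimage hK preimage_id.
by rewrite product_measure1E// lte_mul_pinfty// ge0_fin_numE.
Qed.
HB.instance Definition _ := Measure_isSigmaFinite.Build _ _ _ lebesgue_step
  lebesgue_step_sigma_finite.
End Step.

Fixpoint lebesgueN n : {sigma_finite_measure set (euclidean n) -> \bar R} :=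
  match n with
  | 0 => (\d_([tuple] : euclidean 0))%R
  | n'.+1 => lebesgue_step (lebesgueN n')
  end.

End LebesgueMeasure.

Section Space.
Context {R : realType} {N : nat}.
Variables (p : R) (hp : 1 < p) (Omega : set 'rV[R]_N) (C rho : R).

Local Notation E := (euclidean R N).
Local Notation mu := (lebesgueN R N).

Definition coordinates (x : E) : 'rV[R]_N := \row_i tnth x i.

Definition euclidean_dist (x y : E) : R :=
  Num.sqrt (\sum_(i < N) (tnth x i - tnth y i) ^+ 2).

Definition bounded_domain : Prop :=
  [/\ open Omega, connected Omega, Omega !=set0 & bounded_set Omega].

Definition near_pairs : set (E * E) := [set z | euclidean_dist z.1 z.2 < 1].
Definition far_pairs : set (E * E) := [set z | 1 <= euclidean_dist z.1 z.2].

(* the [p]-th power of the norm; the integrand is [0] on the null set where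
   [x = y], by the convention [0^-1 = 0] *)
Definition gagliardo (u : E -> R) : \bar R :=
  (C%:E * \int[mu \x mu]_(z in near_pairs)
    (`|u z.1 - u z.2| `^ p / euclidean_dist z.1 z.2 ^+ N)%:E)%E.

Fact exponent_ge1 : (1 <= p%:E)%E. Proof. exact: ltW. Qed.
Local Notation p1 := exponent_ge1.

Definition X0_fun : {pred LfunType mu p1} :=
  mem [set u : LfunType mu p1 |
    {ae mu, forall x, ~ Omega (coordinates x) -> u x = 0} /\
    (gagliardo u < +oo)%E].

Lemma measurable_euclidean_dist : measurable_fun setT (fun z : E * E => euclidean_dist z.1 z.2).
Proof.
have msqrt : measurable_fun [set: R] (@Num.sqrt R).
  apply: continuous_measurable_fun.
  exact: sqrt_continuous.
apply: (measurableT_comp msqrt).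
apply: measurable_sum => i; apply: measurable_funX; apply: measurable_funB.
  exact: (measurableT_comp (measurable_tnth i) measurable_fst).
exact: (measurableT_comp (measurable_tnth i) measurable_snd).
Qed.

Lemma measurable_near_pairs : measurable near_pairs.
Proof.
rewrite -[X in measurable X]setTI.
have := measurable_euclidean_dist measurableT (measurable_itv `]-oo, 1[).
by congr measurable; apply/seteqP; split=> z /=; rewrite in_itv.
Qed.

Let kernel (u : E -> R) (z : E * E) : \bar R :=
  (`|u z.1 - u z.2| `^ p / euclidean_dist z.1 z.2 ^+ N)%:E.

Let measurable_kernel u : measurable_fun setT u ->
  measurable_fun near_pairs (kernel u).
Proof.
move=> mu_; apply: measurable_funTS; apply/measurable_EFinP.
apply: measurable_funM; last first.
  rewrite (_ : (fun _ => _) = (fun z => (euclidean_dist z.1 z.2 ^+ N) `^ (- 1))).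
    apply: (measurableT_comp (measurable_powR (- 1))).
    by apply: measurable_funX; exact: measurable_euclidean_dist.
  by apply/funext => z; rewrite powR_inv1// exprn_ge0// sqrtr_ge0.
apply: (@measurableT_comp _ _ _ _ _ _ (@powR R ^~ p)) => //.
apply: measurableT_comp => //; apply: measurable_funB.
  exact: (measurableT_comp mu_ measurable_fst).
exact: (measurableT_comp mu_ measurable_snd).
Qed.

Let kernel_ge0 u z : (0 <= kernel u z)%E.
Proof. by rewrite lee_fin divr_ge0 ?powR_ge0 ?exprn_ge0 ?sqrtr_ge0. Qed.

Let le_powRB (a b : R) : `|a - b| `^ p <= 2 `^ p * (`|a| `^ p + `|b| `^ p).
Proof.
have p0 : 0 <= p by rewrite ltW// (lt_trans _ hp).
wlog ab : a b / `|a| <= `|b|.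
  move=> H; case: (leP `|a| `|b|) => [|/ltW] /H//.
  by rewrite distrC [X in _ * X]addrC.
apply: (@le_trans _ _ ((2 * `|b|) `^ p)).
  apply: ge0_ler_powR; rewrite ?nnegrE ?mulr_ge0//.
  by rewrite (le_trans (ler_normB _ _))// mulr_natl mulr2n lerD2r.
by rewrite powRM// ler_wpM2l ?powR_ge0// lerDr powR_ge0.
Qed.

Let kernelB u v z :
  (kernel (u \- v)%R z <= (2 `^ p)%:E * (kernel u z + kernel v z))%E.
Proof.
rewrite /kernel -EFinD -EFinM lee_fin -mulrDl mulrA ler_wpM2r//.
  by rewrite invr_ge0 exprn_ge0 ?sqrtr_ge0.
rewrite (_ : (u \- v) z.1 - (u \- v) z.2 = (u z.1 - u z.2) - (v z.1 - v z.2)).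
  exact: le_powRB.
by rewrite /= !opprB addrACA [RHS]addrACA; congr (_ + _); rewrite addrC.
Qed.

Lemma gagliardoB u v : measurable_fun setT u -> measurable_fun setT v ->
  (gagliardo u < +oo -> gagliardo v < +oo -> gagliardo (u \- v)%R < +oo)%E.
Proof.
move=> mu_ mv.
have gE w : gagliardo w =
    (C%:E * \int[mu \x mu]_(z in near_pairs) kernel w z)%E by [].
rewrite !gE.
have I0 w : (0 <= \int[mu \x mu]_(z in near_pairs) kernel w z)%E.
  by apply: integral_ge0.
have [C0|C0] := leP C 0.
  move=> _ _; apply: (@le_lt_trans _ _ 0%E) => //.
  exact: mule_le0_ge0.
have fin w : (C%:E * \int[mu \x mu]_(z in near_pairs) kernel w z < +oo ->
    \int[mu \x mu]_(z in near_pairs) kernel w z < +oo)%E.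
  by rewrite !ltey; apply: contra_neq => ->; rewrite gt0_muley// lte_fin.
move=> Iu Iv; have {}Iu := fin u Iu; have {}Iv := fin v Iv.
apply: lte_mul_pinfty; [exact: ltW|by []|].
have mk w : measurable_fun setT w -> measurable_fun near_pairs (kernel w).
  exact: measurable_kernel.
have mD := measurable_near_pairs.
have IuvE : (\int[mu \x mu]_(z in near_pairs) (kernel u z + kernel v z) =
    \int[mu \x mu]_(z in near_pairs) kernel u z +
    \int[mu \x mu]_(z in near_pairs) kernel v z)%E.
  by apply: ge0_integralD => //; exact: mk.
have muv : measurable_fun near_pairs (fun z => (kernel u z + kernel v z)%E).
  by apply: emeasurable_funD; exact: mk.
apply: (@le_lt_trans _ _ (\int[mu \x mu]_(z in near_pairs)
    ((2 `^ p)%:E * (kernel u z + kernel v z)))%E).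
  apply: ge0_le_integral => //.
  - by apply: mk; exact: measurable_funB.
  - exact: measurable_funeM.
rewrite ge0_integralZl//; last by move=> z _; rewrite adde_ge0.
rewrite IuvE; apply: lte_mul_pinfty; [exact: powR_ge0|by []|].
exact: (lte_add_pinfty Iu Iv).
Qed.

Definition null_fun : {pred LfunType mu p1} :=
  mem [set u : LfunType mu p1 | {ae mu, forall x, u x = 0}].

Fact X0_fun_zmod_closed : zmod_closed X0_fun.
Proof.
split=> [|u v].
  rewrite inE; split; first exact: aeW.
  rewrite /gagliardo integral0_eq ?mule0// => z _.
  by rewrite subrr normr0 powR0 ?mul0r// gt_eqF// (lt_trans _ hp).
move=> /set_mem[u0 gu] /set_mem[v0 gv]; rewrite inE; split.
  apply: filterS2 u0 v0 => x ux vx Ox.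
  by rewrite [LHS](_ : _ = u x - v x)// ux// vx// subrr.
have mu_ : measurable_fun setT u by [].
have mv : measurable_fun setT v by [].
exact: (gagliardoB mu_ mv gu gv).
Qed.
HB.instance Definition _ := GRing.isZmodClosed.Build _ X0_fun X0_fun_zmod_closed.

Fact null_fun_zmod_closed : zmod_closed null_fun.
Proof.
split=> [|u v].
  by rewrite inE; apply: aeW.
move=> /set_mem u0 /set_mem v0; rewrite inE/=.
apply: filterS2 u0 v0 => x ux vx.
by rewrite [LHS](_ : _ = u x - v x)// ux vx subrr.
Qed.
HB.instance Definition _ :=
  GRing.isZmodClosed.Build _ null_fun null_fun_zmod_closed.

Definition X0 : Type := subquotient X0_fun null_fun.
HB.instance Definition _ := GRing.Zmodule.on X0.

(* a representative of the class; nothing below depends on its choice *)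
Definition X0_val (u : X0) : E -> R :=
  (subquotient_repr (u : subquotient _ _) : LfunType mu p1).

Definition X0_norm (u : X0) : R := fine (gagliardo (X0_val u)) `^ p^-1.

HB.instance Definition _ := isPointed.Build X0 0.

(* the open balls of a norm form a base of its topology; taking them as a
   subbase generates the same topology without the triangle inequality *)
HB.instance Definition _ := isSubBaseTopological.Build X0 setT
  (fun i : (X0 * R)%type => [set v | X0_norm (v - i.1) < i.2]).

End Space.
Arguments near_pairs {R N}.
Arguments far_pairs {R N}.

Section Eigenvalues.
Context {R : realType} {N : nat} {p : R}.
Variables (hp : 1 < p) (Omega : set 'rV[R]_N) (C rho : R).

Local Notation E := (euclidean R N).
Local Notation mu := (lebesgueN R N).
Local Notation W := (X0 hp Omega C).

Definition Omega_points : set E := [set x | Omega (coordinates x)].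

(* [|a|^(p-2) a], which is [0] at [a = 0] also when [p < 2] *)
Definition signed_power (a : R) : R := `|a| `^ (p - 2) * a.

Definition energy (u v : W) : R :=
  let U := X0_val u in let V := X0_val v in
  C / 2 * \int[(mu \x mu)%E]_(z in near_pairs)
    (signed_power (U z.1 - U z.2) * (V z.1 - V z.2) / euclidean_dist z.1 z.2 ^+ N) +
  C / 2 * \int[(mu \x mu)%E]_(z in far_pairs)
    ((euclidean_dist z.1 z.2 ^+ N)^-1 *
     (signed_power (U z.1 - U z.2) * (V z.1 - V z.2)
      - signed_power (U z.1) * V z.1 - signed_power (U z.2) * V z.2)) +
  rho * \int[mu]_x (signed_power (U x) * V x).

Definition eigenvalue_of_problem (lambda : R) : Prop :=
  exists2 u : W, u <> 0 & forall v : W, energy u v =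
    lambda * \int[mu]_(x in Omega_points) (signed_power (X0_val u x) * X0_val v x).

Definition I_functional (u : W) : R := p^-1 * energy u u.

Definition J_functional (u : W) : R :=
  p^-1 * \int[mu]_(x in Omega_points) (`|X0_val u x| `^ p).

Definition constraint_manifold : set W := [set u | J_functional u = 1].

Definition minimax_eigenvalue (k : nat) : \bar R :=
  ereal_inf [set ereal_sup [set (I_functional u)%:E | u in M] | M in
    [set M : set W | [/\ M `<=` constraint_manifold,
      forall u, M u -> M (- u) & (k%:R%:E <= cohomological_index R M)%E]]].

Definition Phi (lambda : R) (u : W) : R :=
  I_functional u - lambda * J_functional u.

Definition Phi_sublevel (lambda : R) : set W := [set u | Phi lambda u <= 0].

Definition I_sublevel (lambda : R) : set W :=
  [set u | constraint_manifold u /\ I_functional u <= lambda].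

Definition critical_group (lambda : R) (l : nat) : zmodType :=
  @cohomology_pair (Phi_sublevel lambda) [set u | \val u <> 0] l.

End Eigenvalues.
Arguments constraint_manifold {R N p} hp Omega C _.
Arguments Phi_sublevel {R N p} hp Omega C rho lambda _.
Arguments I_sublevel {R N p} hp Omega C rho lambda _.

(* Main.v *)
From Pilot Require Import Defs.
From mathcomp Require Import all_boot all_order all_algebra.
From mathcomp Require Import all_classical all_reals all_analysis.
From HB Require Import structures.
From mathcomp Require Import generic_quotient ring_quotient mxpoly.
From mathcomp Require Import measurable_realfun  ring lra zify.

Set Implicit Arguments.
Unset Strict Implicit.
Unset Printing Implicit Defensive.

Import Order.TTheory GRing.Theory Num.Theory.
Import numFieldNormedType.Exports.

Local Open Scope classical_set_scope.
Local Open Scope ring_scope.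

(** * Cochains as functions of lists *)

(** Both functionals are even and homogeneous of degree p, so the set where [Phi] is nonpositive is
    a symmetric cone. It contracts radially to 0 and is therefore acyclic. Away from 0, multiplying
    u by J_p(u)^(-1/p) deforms it onto the sublevel set S = [I_sublevel]. If S is nonempty, the
    connecting map of the pair identifies C^l with the reduced H^(l-1)(S) ([relative_cohomology],
    [critical_groupE]). If S is empty, the cone is the point 0 and C^l is the cohomology of a point
    ([critical_group_empty]). A nonempty S has index at least 1 and competes in the infimum defining
    lambda_1, so S is empty below lambda_1; above lambda_1 a competitor of index at least 1 lies
    inside S.

    For (iii), let w be the degree 1 class of the double cover of S/Z_2 by S. From lambda_k <
    lambda, a symmetric subset of S of index at least k shows that w^(k-1) is nonzero on S/Z_2; from
    lambda < lambda_(k+1), the index of S is at most k, so w^k = 0. The transfer (Gysin) sequence of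
    the cover then presents w^(k-1) as the transfer of a class of degree k-1 on S. That class is
    nonzero even in reduced cohomology, because the transfer kills constants ([gysin_injective],
    [critical_group_neq0]). The last assertion follows in the same way from the last nonzero power
    of w, once w is known to be nilpotent.

    Nilpotency is where analysis enters ([finite_rank_box]). On a sublevel set the L^p norm is fixed
    and the seminorm [u]_p is bounded. The kernel |x-y|^(-N) gives every dyadic scale the same
    weight: a function whose averages vanish on the dyadic cubes of n successive scales satisfies n
    |u|_p^p <= const [u]_p^p ([zero_average_energy]). For large n this is impossible on the sublevel
    set, so finitely many dyadic averages, which are odd and continuous, have no common zero there.
    They give an odd map to the infinite sphere, hence a classifying map, and they force w^m = 0
    where m is their number ([dc_nilpotent]).

    The topological tools are built on mod 2 cochains written as functions of lists: homotopy
    invariance over an arbitrary space ([homotopy_invariance]), cup products, the two exactness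
    statements of the Gysin sequence, contractibility of the infinite sphere, which with Gysin gives
    H^*(RP^infinity) = Z_2[w] ([RPinfty_class_generates]), and the translation of the index into
    nonvanishing powers of w ([cohomological_index_ge], [cohomological_index_geP]). *)

Section ListCochains.
Variable X : Type.
Implicit Types (phi psi : seq X -> bool) (l m : seq X).

Definition slice (x : X) phi : seq X -> bool := fun l => phi (x :: l).

(** The mod 2 sum over the faces: the face without the head, then the faces that keep it. Since
    [cobd phi [:: x]] is [phi [::]], the empty list plays the role of degree -1 and the complex is
    the augmented one. *)
Fixpoint cobd_rec l phi : bool :=
  if l is x :: m then phi m (+) cobd_rec m (slice x phi) else false.

Definition cobd phi l := cobd_rec l phi.

Arguments cobd : simpl never.

Definition cadd phi psi : seq X -> bool := fun l => phi l (+) psi l.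

Lemma cobd_cons phi x l : cobd phi (x :: l) = phi l (+) cobd (slice x phi) l.
Proof. by []. Qed.

Lemma cobdD phi psi l : cobd (cadd phi psi) l = cobd phi l (+) cobd psi l.
Proof.
elim: l phi psi => //= x l IH phi psi; rewrite !cobd_cons.
by rewrite [slice x _](_ : _ = cadd (slice x phi) (slice x psi))// IH addbACA.
Qed.

Lemma slice_cobd x phi : slice x (cobd phi) = cadd phi (cobd (slice x phi)).
Proof. by []. Qed.

Lemma cobdK phi l : cobd (cobd phi) l = false.
Proof.
elim: l phi => //= x l IH phi.
by rewrite cobd_cons slice_cobd cobdD IH addbF addbb.
Qed.

End ListCochains.
Arguments cobd {X} phi l : simpl never.

Section Local.
Variable X : eqType.
Implicit Types (phi psi : seq X -> bool) (l m : seq X).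

(* the cochains agree on the faces of [l] *)
Lemma eq_cobd phi psi l :
  (forall m, {subset m <= l} -> (size m).+1 = size l -> phi m = psi m) ->
  cobd phi l = cobd psi l.
Proof.
elim: l phi psi => //= x l IH phi psi H; rewrite !cobd_cons; congr (_ (+) _).
  by apply: H => // y yl; rewrite inE yl orbT.
apply: IH => m ml sm; apply: H; last by rewrite /= sm.
by move=> y; rewrite !inE => /orP[->//|/ml ->]; rewrite orbT.
Qed.

Lemma cobd_eq0 phi l :
  (forall m, {subset m <= l} -> (size m).+1 = size l -> phi m = false) ->
  cobd phi l = false.
Proof.
move=> H; rewrite (eq_cobd (psi := fun=> false))//.
by elim: l {H} => //= x l; rewrite cobd_cons.
Qed.

End Local.

(** * Prism operators and their homotopy identities *)

Section Pull.
Variables (X Y : Type).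
Implicit Types (phi : seq Y -> bool) (l : seq X).

Definition pull (f : X -> Y) phi : seq X -> bool := fun l => phi (map f l).

Lemma cobd_pull f phi l : cobd (pull f phi) l = cobd phi (map f l).
Proof.
elim: l phi => //= x l IH phi; rewrite !cobd_cons; congr (_ (+) _).
by rewrite -IH.
Qed.

Variables (a b c : X -> Y).

(** The prism operator: on x_0, ..., x_n it sums [phi] over the lists a x_0, ..., a x_i, b x_i, ...,
    b x_n. *)
Fixpoint prism_rec (a b : X -> Y) l phi : bool :=
  if l is x :: m
  then phi (a x :: b x :: map b m) (+) prism_rec a b m (slice (a x) phi)
  else false.
Definition prism (a b : X -> Y) phi l := prism_rec a b l phi.

Arguments prism : simpl never.

Lemma prism_cons (f g : X -> Y) phi x l : prism f g phi (x :: l) =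
  phi (f x :: g x :: map g l) (+) prism f g (slice (f x) phi) l.
Proof. by []. Qed.

Lemma prismD (f g : X -> Y) phi psi l :
  prism f g (cadd phi psi) l = prism f g phi l (+) prism f g psi l.
Proof.
elim: l phi psi => //= x l IH phi psi; rewrite !prism_cons.
by rewrite [slice _ _](_ : _ = cadd (slice (f x) phi) (slice (f x) psi))//
  IH addbACA.
Qed.

Lemma prism_homotopy (f g : X -> Y) phi l :
  cobd (prism f g phi) l (+) prism f g (cobd phi) l =
  pull f phi l (+) pull g phi l.
Proof.
elim: l phi => [|x l IH] phi; first by rewrite /pull /= addbb.
rewrite cobd_cons prism_cons.
rewrite [slice x _](_ : _ = cadd (pull g (slice (g x) (slice (f x) phi)))
  (prism f g (slice (f x) phi)))//.
rewrite slice_cobd cobdD prismD cobd_pull !cobd_cons.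
have := IH (slice (f x) phi).
rewrite /pull {2 3 5}/slice /=.
move: (prism f g phi l) (cobd _ l) (cobd _ (map g l)) (prism _ _ _ l) => A B D E.
rewrite [slice _ _ _]/slice.
by move: (phi _) (phi _) (phi (f x :: map g l)); do 3!case; move: A B D E; do 4!case.
Qed.

(** A homotopy of homotopies: the sum over i <= j of [phi] on a x_0, ..., a x_i, b x_i, ..., b x_j,
    c x_j, ..., c x_n. It compares going from a to c directly with going through b, that is, a layer
    with its subdivision. *)
Fixpoint prism2_rec l phi : bool :=
  if l is x :: m
  then prism b c (slice (a x) phi) l (+) prism2_rec m (slice (a x) phi)
  else false.
Definition prism2 phi l := prism2_rec l phi.

Arguments prism2 : simpl never.

Lemma prism2_cons phi x l : prism2 phi (x :: l) =
  prism b c (slice (a x) phi) (x :: l) (+) prism2 (slice (a x) phi) l.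
Proof. by []. Qed.

Lemma prism2D phi psi l :
  prism2 (cadd phi psi) l = prism2 phi l (+) prism2 psi l.
Proof.
elim: l phi psi => //= x l IH phi psi; rewrite !prism2_cons.
rewrite [slice _ _](_ : _ = cadd (slice (a x) phi) (slice (a x) psi))//.
by rewrite prismD IH addbACA.
Qed.

Lemma prism2_homotopy phi l :
  cobd (prism2 phi) l (+) prism2 (cobd phi) l =
  prism a b phi l (+) prism b c phi l (+) prism a c phi l.
Proof.
elim: l phi => [|x l IH] phi //.
set psi := slice (a x) phi.
rewrite cobd_cons prism2_cons slice_cobd !prismD prism2D.
rewrite [slice x (prism2 _)](_ : _ = cadd (slice x (prism b c psi)) (prism2 psi))//.
rewrite cobdD (prism_cons a b) (prism_cons a c) -/psi.
have E := cobd_cons (prism b c psi) x l.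
have := IH psi; have := prism_homotopy b c psi (x :: l); move: E.
rewrite /pull /= -/(psi (b x :: map b l)) -/(psi (c x :: map c l)).
rewrite [phi _](_ : _ = psi (b x :: map b l))//.
rewrite [phi (a x :: c _ :: _)](_ : _ = psi (c x :: map c l))//.
move: (cobd (prism b c psi) (x :: l)) (cobd (slice x _) l) (cobd (prism2 _) l).
move: (prism b c (cobd psi) (x :: l)) (prism b c psi l) (prism2 phi l) (prism2 _ l).
move: (psi _) (psi _) (prism a b psi l) (prism a c psi l) (prism b c phi _).
by do 5!case; do 4!case; do 3!case.
Qed.

End Pull.
Arguments prism {X Y} a b phi l : simpl never.
Arguments prism2 {X Y} a b c phi l : simpl never.

Notation "\xor_ ( i < n ) F" := (\big[addb/false]_(i < n) F)
  (at level 36, F at level 36, i, n at level 50, format "\xor_ ( i  <  n )  F").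

Lemma xor_telescope (a : nat -> bool) n :
  \xor_(i < n) (a i (+) a i.+1) = a 0%N (+) a n.
Proof.
elim: n => [|n IH]; first by rewrite big_ord0 addbb.
by rewrite big_ord_recr/= IH -addbA (addbA (a n)) addbb.
Qed.

Lemma xor_double (a : nat -> bool) n :
  \xor_(i < n.*2) a i = \xor_(i < n) (a i.*2 (+) a i.*2.+1).
Proof.
elim: n => [|n IH]; first by rewrite !big_ord0.
by rewrite doubleS !big_ord_recr/= IH -addbA.
Qed.

Lemma cobd_xor (X : Type) n (F : nat -> seq X -> bool) l :
  cobd (fun m => \xor_(i < n) F i m) l = \xor_(i < n) cobd (F i) l.
Proof.
elim: n => [|n IH].
  rewrite big_ord0; under [fun m => _]eq_fun do rewrite big_ord0.
  by elim: l => //= x l; rewrite cobd_cons.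
rewrite big_ord_recr/= -IH -(cobdD (fun m => \xor_(i < n) F i m)).
by congr (cobd _ l); apply/funext => m; rewrite big_ord_recr.
Qed.

Section Locality.
Variables (X Y : eqType).

Lemma prism_eq0 (a b : X -> Y) phi l :
  (forall m, size m = (size l).+1 ->
    (forall y, y \in m -> exists2 x, x \in l & y = a x \/ y = b x) ->
    phi m = false) -> prism a b phi l = false.
Proof.
elim: l phi => //= x l IH phi H; rewrite prism_cons H/=.
- apply: IH => m sm ml; apply: H; rewrite /= ?sm// => y.
  rewrite inE => /orP[/eqP->|/ml[z zl yz]].
    by exists x; rewrite ?mem_head//; left.
  by exists z; rewrite // inE zl orbT.
- by rewrite size_map.
- move=> y; rewrite !inE => /or3P[/eqP->|/eqP->|/mapP[z zl ->]].
  + by exists x; rewrite ?mem_head//; left.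
  + by exists x; rewrite ?mem_head//; right.
  + by exists z; rewrite ?inE ?zl ?orbT//; right.
Qed.

Lemma prism2_eq0 (a b c : X -> Y) phi l :
  (forall m, size m = (size l).+2 ->
    (forall y, y \in m -> exists2 x, x \in l & [\/ y = a x, y = b x | y = c x]) ->
    phi m = false) -> prism2 a b c phi l = false.
Proof.
elim: l phi => //= x l IH phi H; rewrite prism2_cons prism_eq0/=.
- apply: IH => m sm ml; apply: H; rewrite /= ?sm// => y.
  rewrite inE => /orP[/eqP->|/ml[z zl yz]].
    by exists x; rewrite ?mem_head//; constructor 1.
  by exists z; rewrite // inE zl orbT.
- move=> m sm ml; apply: H; rewrite /= ?sm// => y.
  rewrite inE => /orP[/eqP->|/ml[z zl [->|->]]].
  + by exists x; rewrite ?mem_head//; constructor 1.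
  + by exists z => //; constructor 2.
  + by exists z => //; constructor 3.
Qed.

End Locality.

Section LocallyZero.
Variable X : topologicalType.

(** Here [q] counts vertices, so a cochain of degree q is tested by [lzero A q.+1]. *)
Definition lzero (A : set X) q (psi : seq X -> bool) : Prop :=
  forall x, A x -> exists2 U, nbhs x U &
    forall l, size l = q -> (forall y, y \in l -> A y /\ U y) -> psi l = false.

Lemma lzeroD A q phi psi :
  lzero A q phi -> lzero A q psi -> lzero A q (cadd phi psi).
Proof.
move=> h k x Ax; have [U xU hU] := h x Ax; have [V xV kV] := k x Ax.
exists (U `&` V); first exact: filterI.
by move=> l sl lUV; rewrite /cadd hU ?kV// => y /lUV[? []].
Qed.

Lemma lzero_ext A q phi psi : (forall l, size l = q -> phi l = psi l) ->
  lzero A q phi -> lzero A q psi.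
Proof.
move=> e h x Ax; have [U xU hU] := h x Ax; exists U => // l sl lU.
by rewrite -e// hU.
Qed.

Lemma lzero_cobd A q phi : lzero A q phi -> lzero A q.+1 (cobd phi).
Proof.
move=> h x Ax; have [U xU hU] := h x Ax; exists U => // l sl lU.
by apply: cobd_eq0 => m ml; rewrite sl => -[sm]; apply: hU => // y /ml /lU.
Qed.

Lemma lzero_subset A B q phi : B `<=` A -> lzero A q phi -> lzero B q phi.
Proof.
move=> BA h x Bx; have [U xU hU] := h x (BA _ Bx); exists U => // l sl lU.
by apply: hU => // y /lU [/BA].
Qed.

End LocallyZero.

Lemma lzero_pull (X Y : topologicalType) (f : X -> Y) q phi : continuous f ->
  lzero setT q phi -> lzero setT q (pull f phi).
Proof.
move=> cf h x _; have [U xU hU] := h (f x) I.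
exists (f @^-1` U); first exact: cf.
move=> l sl lU; apply: hU; rewrite ?size_map// => _ /mapP[y yl ->].
by split=> //; have [] := lU y yl.
Qed.

(** * Homotopy invariance of Alexander-Spanier cohomology *)

Section Homotopy.
Variables (R : realType) (X Y : topologicalType) (H : X -> R -> Y).
Hypothesis cH : forall (x : X) (t : R), 0 <= t <= 1 ->
  (fun z : X * R => H z.1 z.2) @ (x, t) --> H x t.
Variables (q : nat) (phi : seq Y -> bool).
Hypothesis phi_cocycle : lzero setT q.+1 (cobd phi).

Let f n i x : Y := H x (i%:R / 2 ^+ n).

Let in_layer n i (t : R) : Prop := i%:R / 2 ^+ n <= t <= i.+1%:R / 2 ^+ n.

(** The cocycle identity holds exactly, not just locally, on all simplices with vertices in the
    image of [l] times one layer of width 2^(-n). This is what makes the prism identities exact on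
    [l]. *)
Let good n (l : seq X) : Prop := forall i, (i < 2 ^ n)%N -> forall m, size m = q.+1 ->
  (forall y, y \in m -> exists x t, [/\ x \in l, in_layer n i t & y = H x t]) ->
  cobd phi m = false.

Let exp2_gt0 n : 0 < 2 ^+ n :> R. Proof. by rewrite exprn_gt0. Qed.

Let layerS n i t : in_layer n.+1 i t -> in_layer n i./2 t.
Proof.
rewrite /in_layer !ler_pdivrMr// !ler_pdivlMr// exprS => /andP[h1 h2].
have := odd_double_half i; rewrite -muln2 => iE.
have e1 : i%:R = (odd i)%:R + (i./2)%:R * 2 :> R by rewrite -{1}iE natrD natrM.
have i0 : (0 <= (odd i)%:R :> R) && ((odd i)%:R <= 1 :> R).
  by rewrite ler0n lern1 leq_b1.
move: h1 h2 i0; rewrite -!natr1 e1 => h1 h2 /andP[b0 b1].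
by apply/andP; split; lra.
Qed.

Let goodS n l : good n l -> good n.+1 l.
Proof.
move=> g i ilt m sm ml; apply: (g i./2) => //.
  by move: ilt; rewrite expnS; lia.
move=> y /ml[x [t [xl h ->]]]; exists x, t; split=> //; exact: layerS.
Qed.

Let good_le n k l : (n <= k)%N -> good n l -> good k l.
Proof.
elim: k => [|k IH]; first by rewrite leqn0 => /eqP->.
by rewrite leq_eqVlt => /orP[/eqP->//|nk g]; apply/goodS/IH.
Qed.

Let good_subset n l m : {subset m <= l} -> good n l -> good n m.
Proof.
move=> ml g i ilt k sk kl; apply: (g i) => // y /kl[x [t [xm h ->]]].
by exists x, t; split=> //; apply: ml.
Qed.

(** [eta n] stacks the prisms of the 2^n layers; [theta n] is the primitive of its difference with
    the stack of the halved layers. *)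
Let eta n l := \xor_(i < 2 ^ n) prism (f n i) (f n i.+1) phi l.
Let theta n l := \xor_(i < 2 ^ n)
  prism2 (f n.+1 i.*2) (f n.+1 i.*2.+1) (f n.+1 i.*2.+2) phi l.

Let f_double n i : f n.+1 i.*2 = f n i.
Proof.
apply/funext => x; rewrite /f exprS -muln2 natrM.
by congr (H x _); have := exp2_gt0 n => h; field; rewrite gt_eqF.
Qed.

Let in_layerl n i : in_layer n i (i%:R / 2 ^+ n).
Proof. by rewrite /in_layer lexx ler_pM2r ?invr_gt0// ler_nat leqnSn. Qed.
Let in_layerr n i : in_layer n i (i.+1%:R / 2 ^+ n).
Proof. by rewrite /in_layer lexx ler_pM2r ?invr_gt0// ler_nat leqnSn. Qed.

Let cobd_eta n l : size l = q -> good n l ->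
  cobd (eta n) l = pull (H^~ 0) phi l (+) pull (H^~ 1) phi l.
Proof.
move=> sl g; rewrite (cobd_xor _ (fun i => prism (f n i) (f n i.+1) phi)).
transitivity (\xor_(i < 2 ^ n) (pull (f n i) phi l (+) pull (f n i.+1) phi l)).
  apply: eq_bigr => i _; rewrite -prism_homotopy.
  rewrite [X in _ (+) X]prism_eq0 ?addbF// => m sm ml.
  apply: (g i) => //; first by rewrite sm sl.
  move=> y /ml[x xl [->|->]]; [exists x, (i%:R / 2 ^+ n)|exists x, (i.+1%:R / 2 ^+ n)];
    by split.
rewrite (xor_telescope (fun i => pull (f n i) phi l)); rewrite /=.
have -> : f n 0 = H^~ 0 by apply/funext => x; rewrite /f mul0r.
have -> // : f n (2 ^ n) = H^~ 1.
by apply/funext => x; rewrite /f natrX divff// gt_eqF.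
Qed.

Let cobd_theta n l : (size l).+1 = q -> good n l ->
  cobd (theta n) l = eta n l (+) eta n.+1 l.
Proof.
move=> sl g; rewrite (cobd_xor _ (fun i => prism2 (f n.+1 i.*2) (f n.+1 i.*2.+1)
  (f n.+1 i.*2.+2) phi)).
rewrite /eta expnS mul2n (xor_double (fun i => prism (f n.+1 i) (f n.+1 i.+1) phi l)).
rewrite -big_split/=.
apply: eq_bigr => i _.
rewrite -(f_double n i) -(f_double n i.+1) doubleS addbC -prism2_homotopy.
rewrite [X in _ (+) X]prism2_eq0 ?addbF// => m sm ml.
apply: (g i) => //; first by rewrite sm sl.
have E1 : in_layer n i (i.*2.+1%:R / 2 ^+ n.+1).
  have := layerS (in_layerl n.+1 i.*2.+1).
  by rewrite /= uphalf_double.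
have E0 : in_layer n i (i.*2%:R / 2 ^+ n.+1).
  by have := layerS (in_layerl n.+1 i.*2); rewrite doubleK.
have E2 : in_layer n i (i.*2.+2%:R / 2 ^+ n.+1).
  by have := layerS (in_layerr n.+1 i.*2.+1); rewrite /= uphalf_double.
move=> y /ml[x xl [->|->|->]]; exists x;
  [exists (i.*2%:R / 2 ^+ n.+1)|exists (i.*2.+1%:R / 2 ^+ n.+1)|
   exists (i.*2.+2%:R / 2 ^+ n.+1)]; by split.
Qed.

(** As [X] is arbitrary, no single subdivision need be fine enough for all small simplices, so each
    list takes the coarsest one good for it. The default 0 concerns lists that are good for no
    subdivision, about which nothing is claimed. *)
Let level l : nat :=
  if pselect (exists n, `[< good n l >]) is left e then ex_minn e else 0%N.

Let levelP N l : good N l -> good (level l) l /\ (level l <= N)%N.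
Proof.
move=> g; rewrite /level; case: pselect => [e|[]]; last first.
  by exists N; apply/asboolP.
by case: ex_minnP => n /asboolP gn le; split=> //; apply/le/asboolP.
Qed.

Let btheta j l := (level l <= j)%N && theta j l.

Let level_le l m N : good N l -> {subset m <= l} -> (level m <= level l)%N.
Proof.
move=> /levelP[g _] ml; have [] := levelP (good_subset ml g) => _; exact.
Qed.

(* On lists which are small enough for the subdivision [N], this is the prism
   operator of the subdivision [N] up to a coboundary: the correction by the
   [theta j] telescopes on the faces. *)
Let homotopy l := eta (level l) l (+) \xor_(j < level l) cobd (btheta j) l.

Let homotopyE N l : (size l).+1 = q -> good N l ->
  homotopy l = eta N l (+) cobd (fun m => \xor_(j < N) btheta j m) l.
Proof.
move=> sl g; have [gl lN] := levelP g; rewrite (cobd_xor _ btheta) /homotopy.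
have S (F : nat -> bool) : \xor_(j < N) F j = \xor_(j < level l) F j (+)
    \xor_(j < N - level l) F (level l + j)%N.
  have : \xor_(j < level l + (N - level l)) F j = \xor_(j < level l) F j (+)
    \xor_(j < N - level l) F (level l + j)%N by rewrite big_split_ord.
  by rewrite subnKC.
rewrite (S (fun j => cobd (btheta j) l)).
have -> : \xor_(j < N - level l) cobd (btheta (level l + j)) l =
    eta (level l) l (+) eta N l.
  have := xor_telescope (fun j => eta (level l + j) l) (N - level l).
  rewrite addn0 subnKC// => <-; apply: eq_bigr => j _.
  rewrite addnS -cobd_theta//; last by apply: good_le gl; rewrite leq_addr.
  (* A face has level at most [level l], so on the faces of [l] the truncation in [btheta] is
     invisible. *)
  apply: eq_cobd => m ml _.
  by rewrite /btheta (leq_trans (level_le g ml)) ?leq_addr.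
by case: (eta _ l) (\big[_/_]_(_ < _) _) (eta _ l); do 2!case.
Qed.

(** Tube lemma: by compactness of [0,1], one neighbourhood of [x] and one width of layers serve all
    times. *)
Let locally_good (x : X) : exists2 V : set X, nbhs x V & exists n, forall l,
  (forall y, y \in l -> V y) -> good n l.
Proof.
have /compact_near_coveringP cpt := @segment_compact R 0 1.
pose P (i : set X * R) (t : R) := forall m, size m = q.+1 ->
  (forall y, y \in m -> exists x s, [/\ i.1 x, `|s - t| < i.2 & y = H x s]) ->
  cobd phi m = false.
(* The parameter that becomes small is a pair: a neighbourhood of [x] and a positive width. *)
have := cpt _ (filter_prod (powerset_filter_from (nbhs x)) (0:R)^'+) P _.
case=> [t|[W E] /= [xW E0] WE].
  rewrite /= in_itv/= => t01.
  have [U yU hU] := phi_cocycle (I : [set: Y] (H x t)).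
  have [[V J] /= [xV /nbhs_ballP[e /= e0 tJ]] VJ] := cH t01 yU.
  (* One half of [e] is for the distance of the layer's base time to [t], the other half for its
     width. *)
  exists (ball t (e / 2), [set i : set X * R | i.1 `<=` V /\ i.2 < e / 2]).
    split=> /=; first by apply: nbhsx_ballx; rewrite divr_gt0.
    exists ([set V' | V' `<=` V], [set r | r < e / 2]); last by move=> [].
    by split=> /=; [exact: small_set_sub|apply: nbhs_right_lt; rewrite divr_gt0].
  move=> [s [V' r]] /= [ts [V'V re]] m sm mi; apply: hU => // y ym; split=> //.
  have [z [u [iz us ->]]] := mi y ym.
  apply: (VJ (z, u)); split=> /=; first exact: V'V.
  apply: tJ; rewrite /ball/= in ts *.
  rewrite (_ : t - u = (t - s) - (u - s)); last by ring.
  by rewrite (le_lt_trans (ler_normB _ _))//; move: ts us re => /=; lra.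
have [V [WV xV]] := @filter_ex _ _ _ _ (filterI xW (near_small_set (nbhs_pfilter x))).
have [e /= e0 eE] := E0.
exists V => //.
have [n ne] : exists n, 1 / 2 ^+ n < e / 2 :> R.
  exists (Num.truncn (2 / e)).+1.
  rewrite ltr_pdivrMr// mulrC -ltr_pdivrMr ?divr_gt0// div1r invf_div.
  rewrite (lt_le_trans (truncnS_gt _))// -natrX ler_nat ltnW// ltn_expl//.
exists n => l lV i ilt m sm ml.
have i0 : 0 <= i%:R / 2 ^+ n :> R by rewrite divr_ge0// ltW.
apply: (WE (V, e / 2)) (i%:R / 2 ^+ n) _ _ sm _ => //=.
- split=> //; apply: eE => /=; rewrite ?divr_gt0// sub0r normrN gtr0_norm ?divr_gt0//.
  by move: e0; lra.
- rewrite in_itv/= i0/= ler_pdivrMr// mul1r -natrX ler_nat ltnW//.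
- move=> y /ml[z [t [zl /andP[t1 t2] ->]]]; exists z, t; split=> //; first exact: lV.
  rewrite ger0_norm ?subr_ge0// (le_lt_trans _ ne)// lerBlDl -mulrDl.
  by rewrite natr1.
Qed.

(** Near each point [homotopy] is the stack of prisms of one fixed subdivision plus a coboundary, so
    its own coboundary telescopes to the two ends of the homotopy. *)
Theorem homotopy_invariance : exists eta, lzero setT q
  (cadd (cobd eta) (cadd (pull (H^~ 0) phi) (pull (H^~ 1) phi))).
Proof.
exists homotopy => x _; have [V xV [N gV]] := locally_good x.
exists V => // l sl lV; have gl : good N l by apply: gV => y /lV[].
rewrite /cadd.
rewrite (@eq_cobd _ _ (cadd (eta N) (cobd (fun m => \xor_(j < N) btheta j m)))).
  by rewrite cobdD cobdK addbF cobd_eta// addbb.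
by move=> m ml sm; apply: homotopyE; [rewrite sm|exact: good_subset gl].
Qed.

End Homotopy.

(** * Subquotients, and the dictionary between list cochains and cochains on ordinals *)

Section SubquotientTheory.
Variables (V : zmodType) (Z B : zmodClosed V).

Lemma subquotient_class_eq x y (Zx : x \in Z) (Zy : y \in Z) :
  subquotient_class B Zx = subquotient_class B Zy <-> x - y \in B.
Proof.
rewrite /subquotient_class; split=> [/eqP|xyB].
  by rewrite -Quotient.idealrBE inE/=.
by apply/eqP; rewrite -Quotient.idealrBE inE/=.
Qed.

Lemma subquotient_reprK (c : subquotient Z B) :
  subquotient_class B (subquotient_reprP c) = c.
Proof.
rewrite /subquotient_class /subquotient_repr -[RHS]reprK.
by congr (\pi_ _ _)%qT; apply/val_inj; rewrite SubK.
Qed.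

Lemma subquotient_repr_class x (Zx : x \in Z) :
  subquotient_repr (subquotient_class B Zx) - x \in B.
Proof.
by apply/(subquotient_class_eq (subquotient_reprP _) Zx); rewrite subquotient_reprK.
Qed.

Lemma subquotient_classB x y (Zx : x \in Z) (Zy : y \in Z) (Zxy : x - y \in Z) :
  subquotient_class B Zx - subquotient_class B Zy = subquotient_class B Zxy.
Proof.
rewrite /subquotient_class; have := Quotient.pi_add (@subgroup_cap V Z B)
  (Sub x Zx) (- Sub y Zy); rewrite Quotient.pi_opp => E; apply: etrans (esym E) _.
by congr (\pi_ _ _)%qT; apply/val_inj; rewrite raddfB !SubK.
Qed.

Lemma subquotient_class0 x (Zx : x \in Z) :
  subquotient_class B Zx = 0 <-> x \in B.
Proof.
rewrite -[0](subrr (subquotient_class B Zx)).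
rewrite (subquotient_classB _ _ (rpredB Zx Zx)) subquotient_class_eq.
by rewrite subrr subr0.
Qed.

End SubquotientTheory.

Lemma isomorphic_of_bij (G H : zmodType) (f : G -> H) :
  {morph f : x y / x - y} -> injective f -> (forall y, exists x, f x = y) ->
  isomorphic G H.
Proof.
move=> fB finj /choice[g fg].
pose F := GRing.isZmodMorphism.Build G H f fB.
pose f' : {additive G -> H} := HB.pack f F.
by exists f'; exists g => // x; apply: finj; rewrite fg.
Qed.

Lemma isomorphic_sym (G H : zmodType) : isomorphic G H -> isomorphic H G.
Proof.
move=> [f [g fK gK]]; apply: (@isomorphic_of_bij H G g).
- by move=> x y; apply: (can_inj fK); rewrite raddfB !gK.
- exact: (can_inj gK).
- by move=> x; exists (f x).
Qed.

Lemma isomorphic_subquotient (V V' : zmodType) (Z B : zmodClosed V)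
    (Z' B' : zmodClosed V') (F : V -> V') :
  {morph F : x y / x - y} -> (forall x, x \in Z -> F x \in Z') ->
  (forall x, x \in Z -> F x \in B' <-> x \in B) ->
  (forall y, y \in Z' -> exists2 x, x \in Z & y - F x \in B') ->
  isomorphic (subquotient Z B) (subquotient Z' B').
Proof.
move=> FB FZ FBt Fs.
pose g (c : subquotient Z B) := subquotient_class B' (FZ _ (subquotient_reprP c)).
have gE x (Zx : x \in Z) : g (subquotient_class B Zx) = subquotient_class B' (FZ _ Zx).
  apply/subquotient_class_eq; rewrite -FB; apply/FBt.
    by rewrite rpredB// subquotient_reprP.
  exact: subquotient_repr_class.
apply: (@isomorphic_of_bij _ _ g).
- move=> c d; rewrite -(subquotient_reprK c) -(subquotient_reprK d).
  rewrite (subquotient_classB _ _ _ (rpredB (subquotient_reprP _) (subquotient_reprP _))).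
  rewrite !gE (subquotient_classB _ _ _ (rpredB (FZ _ (subquotient_reprP _)) (FZ _ (subquotient_reprP _)))).
  by apply/subquotient_class_eq; rewrite FB subrr rpred0.
- move=> c d /subquotient_class_eq; rewrite -FB => /FBt.
  rewrite rpredB ?subquotient_reprP// => /(_ isT) cd.
  rewrite -(subquotient_reprK c) -(subquotient_reprK d).
  exact/subquotient_class_eq.
- move=> d; have [x Zx dx] := Fs _ (subquotient_reprP d).
  exists (subquotient_class B Zx); rewrite gE -(subquotient_reprK d).
  by apply/subquotient_class_eq; rewrite -opprB rpredN.
Qed.

Section Bridge.
Variable X : topologicalType.
Implicit Types (psi : seq X -> bool).

Definition of_list q psi : cochain X q := fun s => (psi (map s (enum 'I_q.+1)))%:R.
Arguments of_list : clear implicits.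

(** Zero on the empty list, as the unaugmented complex has nothing in degree -1. The default of
    [nth] is never reached on lists of length [q.+1]. *)
Definition to_list q (phi : cochain X q) : seq X -> bool :=
  fun l => if l is x :: _ then phi (fun i => nth x l i) != 0 else false.

Lemma F2_boolK (x : 'F_2) : (x != 0)%:R = x.
Proof. by case: x => -[|[|//]] i; apply/val_inj. Qed.

Lemma F2_boolE (b : bool) : (b%:R != 0 :> 'F_2) = b.
Proof. by case: b. Qed.

Lemma F2_addb (a b : bool) : (a (+) b)%:R = a%:R + b%:R :> 'F_2.
Proof. by case: a; case: b; apply/val_inj. Qed.

Lemma F2_oppr (x : 'F_2) : - x = x.
Proof. by case: x => -[|[|//]] i; apply/val_inj. Qed.

Lemma to_listK q (phi : cochain X q) : of_list q (to_list phi) = phi.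
Proof.
apply/funext => s; rewrite /of_list /to_list; case E : map => [|x l].
  by have := size_enum_ord q.+1; rewrite -(size_map s) E.
rewrite F2_boolK -E; congr phi; apply/funext => i.
by rewrite (nth_map i) ?size_enum_ord// nth_ord_enum.
Qed.

Lemma of_listK q psi l : size l = q.+1 -> to_list (of_list q psi) l = psi l.
Proof.
case: l => // x l sl; rewrite /to_list /of_list F2_boolE; congr psi.
rewrite -[in LHS]sl; apply: (@eq_from_nth _ x); rewrite size_map size_enum_ord//.
move=> i il; rewrite (nth_map (Ordinal il)) ?size_enum_ord//.
by rewrite nth_enum_ord.
Qed.

Lemma of_listD q phi psi :
  of_list q (cadd phi psi) = of_list q phi + of_list q psi.
Proof. by apply/funext => s; rewrite /of_list /cadd F2_addb. Qed.

Lemma cochainB q (phi psi : cochain X q) : phi - psi = phi + psi.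
Proof.
by apply/funext => s; rewrite [LHS](_ : _ = phi s - psi s)// F2_oppr.
Qed.

Lemma of_listB q phi psi :
  of_list q phi - of_list q psi = of_list q (cadd phi psi).
Proof. by rewrite cochainB of_listD. Qed.

Lemma eq_of_list q phi psi : (forall l, size l = q.+1 -> phi l = psi l) ->
  of_list q phi = of_list q psi.
Proof.
move=> e; apply/funext => s; rewrite /of_list e//.
by rewrite size_map size_enum_ord.
Qed.

Lemma cobd_enum n psi (s : 'I_n.+1 -> X) :
  cobd psi (map s (enum 'I_n.+1)) =
  \big[addb/false]_(i < n.+1) psi (map (s \o lift i) (enum 'I_n)).
Proof.
elim: n psi s => [|n IH] psi s.
  rewrite big_ord_recl big_ord0 addbF enum_ordSl/= cobd_cons.
  by case: (enum 'I_0) (size_enum_ord 0) => //=; rewrite addbF.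
rewrite enum_ordSl/= cobd_cons -map_comp IH [RHS]big_ord_recl; congr (_ (+) _).
apply: eq_bigr => i _; rewrite /slice [enum 'I_n.+1]enum_ordSl /= -!map_comp.
congr (psi (_ :: _)); first by congr s; apply/val_inj.
by apply: eq_map => j; congr s; apply/val_inj => /=; rewrite /bump !add1n ltnS addnS.
Qed.

Lemma codiff_of_list q psi : codiff (of_list q psi) = of_list q.+1 (cobd psi).
Proof.
apply/funext => s; rewrite /codiff /of_list cobd_enum.
by rewrite (big_morph (fun b : bool => b%:R : 'F_2) F2_addb (erefl _)).
Qed.

Lemma locally_zero_of_list (A : set X) q psi :
  locally_zero A (of_list q psi) <-> lzero A q.+1 psi.
Proof.
split=> h x Ax; have [U xU hU] := h x Ax; exists U => //.
  move=> l sl lU; rewrite -(of_listK psi sl) /to_list.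
  case: l sl lU => // y l sl lU; rewrite hU ?eqxx// => i.
  by apply: lU; rewrite mem_nth// sl ltn_ord.
move=> s sU; rewrite /of_list hU//; first by rewrite size_map size_enum_ord.
by move=> y /mapP[i _ ->]; split; have [] := sU i.
Qed.

Definition is_cocycle (A : set X) q psi :=
  lzero A q.+1 psi /\ lzero setT q.+2 (cobd psi).

(** The first conjunct removes the augmentation: in degree 0 only locally zero cochains are
    coboundaries. [is_reduced_coboundary] lets [eta [::]] be any constant instead. *)
Definition is_coboundary (A : set X) q psi := exists eta : seq X -> bool,
  [/\ q = 0%N -> eta [::] = false, lzero A q eta &
      lzero setT q.+1 (cadd psi (cobd eta))].

Definition is_reduced_coboundary q psi := exists eta : seq X -> bool,
  lzero setT q.+1 (cadd psi (cobd eta)).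

Lemma cocycle_of_list A q psi : of_list q psi \in cocycle A q <-> is_cocycle A q psi.
Proof.
split=> [/set_mem[/locally_zero_of_list h1]|[h1 h2]].
  by rewrite codiff_of_list => /locally_zero_of_list.
rewrite inE; split; first exact/locally_zero_of_list.
by rewrite codiff_of_list; exact/locally_zero_of_list.
Qed.

Lemma coboundary_of_list A q psi :
  of_list q psi \in coboundary A q <-> is_coboundary A q psi.
Proof.
split.
  case: q => [/set_mem /locally_zero_of_list h|q /set_mem[eta h1 h2]].
    exists (fun=> false); split=> //; first by move=> x _; exists setT => //; exact: filterT.
    by apply: lzero_ext h => -[//|x [|//]] _; rewrite /cadd cobd_cons addbF.
  rewrite -(to_listK eta) in h1 h2; exists (to_list eta); split=> //.
    exact/locally_zero_of_list.
  by move: h2; rewrite codiff_of_list of_listB => /locally_zero_of_list.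
move=> [eta [e0 h1 h2]]; case: q e0 h1 h2 => [|q] e0 h1 h2; rewrite inE.
  apply/locally_zero_of_list; apply: lzero_ext h2 => -[//|x [|//]] _.
  by rewrite /cadd cobd_cons e0// addbF.
exists (of_list q eta); first exact/locally_zero_of_list.
by rewrite codiff_of_list of_listB; exact/locally_zero_of_list.
Qed.

Lemma reduced_coboundary_of_list q psi :
  of_list q psi \in reduced_coboundary X q <-> is_reduced_coboundary q psi.
Proof.
case: q => [|q]; last first.
  split=> [/coboundary_of_list[eta [_ _ h]]|[eta h]]; first by exists eta.
  by apply/coboundary_of_list; exists eta; split=> // x.
have cstE (c : bool) : cst c%:R = of_list 0 (cobd (fun=> c)).
  apply/funext => s; rewrite /of_list.
  case: map (size_map s (enum 'I_1)) => [|x [|y l]]; rewrite size_enum_ord//.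
  by rewrite cobd_cons addbF.
split=> [/set_mem[c]|[eta h]].
  rewrite -(F2_boolK c) cstE of_listB => /locally_zero_of_list h.
  by exists (fun=> c != 0).
rewrite inE; exists (eta [::])%:R; rewrite cstE of_listB.
apply/locally_zero_of_list; apply: lzero_ext h => -[|x [|//]]//.
Qed.

Definition class_of_list A q psi (h : is_cocycle A q psi) : cohomology_pair A q :=
  subquotient_class _ (proj2 (cocycle_of_list A q psi) h).

Lemma class_of_list_surj A q (c : cohomology_pair A q) :
  exists psi (h : is_cocycle A q psi), c = class_of_list h.
Proof.
exists (to_list (subquotient_repr c)).
have h : is_cocycle A q (to_list (subquotient_repr c)).
  apply/cocycle_of_list; rewrite to_listK; exact: subquotient_reprP.
exists h; rewrite -[LHS]subquotient_reprK; apply/subquotient_class_eq.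
by rewrite to_listK subrr rpred0.
Qed.

Lemma class_of_list_eq A q phi psi (h : is_cocycle A q phi) (k : is_cocycle A q psi) :
  class_of_list h = class_of_list k <-> is_coboundary A q (cadd phi psi).
Proof. by rewrite subquotient_class_eq of_listB coboundary_of_list. Qed.

Lemma class_of_list_eq0 A q phi (h : is_cocycle A q phi) :
  class_of_list h = 0 <-> is_coboundary A q phi.
Proof. by rewrite subquotient_class0 coboundary_of_list. Qed.

Lemma class_of_list_eq_repr A q phi (h : is_cocycle A q phi) (c : cohomology_pair A q) :
  c = class_of_list h <-> is_coboundary A q (cadd (to_list (subquotient_repr c)) phi).
Proof.
rewrite -{1}[c]subquotient_reprK subquotient_class_eq.
by rewrite -(to_listK (subquotient_repr c)) of_listB coboundary_of_list to_listK.
Qed.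

End Bridge.
Arguments of_list {X} q psi s.

(** * Cup products with cochains of degree 0 and 1 *)

Section Cup.
Variable X : Type.
Implicit Types (theta psi : seq X -> bool) (l : seq X).

(** The front-face/back-face products with a cochain of degree 0 here and of degree 1 in [cup1]; the
    two factors share a vertex. *)
Definition cup0 (alpha : X -> bool) psi : seq X -> bool :=
  fun l => if l is x :: _ then alpha x && psi l else false.

Definition cup1 theta psi : seq X -> bool :=
  fun l => if l is x :: ((y :: _) as m) then theta [:: x; y] && psi m else false.

Fixpoint cup1_power theta m : seq X -> bool :=
  if m is m'.+1 then cup1 theta (cup1_power theta m') else fun=> true.

Lemma cobd_andb (b : bool) psi l :
  cobd (fun m => b && psi m) l = b && cobd psi l.
Proof.
elim: l psi => [|x l IH] psi; first by rewrite andbF.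
by rewrite !cobd_cons [slice x _](_ : _ = fun m => b && slice x psi m)// IH andb_addr.
Qed.

(** The Leibniz rule: the first factor on the right is the coboundary of [alpha] on the first edge.
    [cobd_cup1] is the same rule one degree higher. *)
Lemma cobd_cup0 alpha psi x y l :
  cobd (cup0 alpha psi) (x :: y :: l) =
  ((alpha x (+) alpha y) && psi (y :: l)) (+)
  cup0 alpha (cobd psi) (x :: y :: l).
Proof.
rewrite cobd_cons [slice x _](_ : _ = fun m => alpha x && slice x psi m)//.
rewrite cobd_andb /= (cobd_cons psi).
by case: (alpha x); case: (alpha y); case: (psi _); case: (cobd _ _).
Qed.

Lemma cobd_cup1 theta psi x y z l :
  cobd (cup1 theta psi) (x :: y :: z :: l) =
  (cobd theta [:: x; y; z] && psi (z :: l)) (+)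
  cup1 theta (cobd psi) (x :: y :: z :: l).
Proof.
rewrite !(cobd_cons (cup1 _ _)) [in LHS]cobd_cons.
rewrite [slice y _](_ : _ = fun m => theta [:: x; y] && slice y psi m)//.
rewrite cobd_andb /= (cobd_cons psi) /slice.
rewrite !cobd_cons /= /slice [cobd _ [::]](_ : _ = false)// addbF.
move: (theta [:: y; z]) (theta [:: x; z]) (theta [:: x; y]) (cobd _ _).
by move: (psi (y :: l)) (psi (z :: l)); do 6!case.
Qed.

End Cup.

Section CupLocal.
Variable X : topologicalType.
Implicit Types (theta psi : seq X -> bool).

Lemma cobdD_fun (phi psi : seq X -> bool) : cobd (cadd phi psi) = cadd (cobd phi) (cobd psi).
Proof. by apply/funext => l; rewrite cobdD. Qed.

Lemma lzero0 (A : set X) q : lzero A q (fun=> false).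
Proof. by move=> x _; exists setT => //; exact: filterT. Qed.

Lemma cobd0 (l : seq X) : cobd (fun=> false) l = false.
Proof. by elim: l => //= x l; rewrite cobd_cons. Qed.

Lemma lzero_set0 q psi : lzero (@set0 X) q psi. Proof. by []. Qed.

Lemma is_cocycle_set0 q psi : is_cocycle set0 q psi <-> lzero setT q.+2 (cobd psi).
Proof. by split=> [[]|h]; [|split]. Qed.

Lemma is_coboundary_set0 q psi : is_coboundary set0 q psi <->
  exists2 eta, (q = 0%N -> eta [::] = false) & lzero setT q.+1 (cadd psi (cobd eta)).
Proof.
by split=> [[eta [? _ ?]]|[eta ? ?]]; [exists eta|exists eta; split].
Qed.

Lemma is_coboundaryD (A : set X) q phi psi :
  is_coboundary A q phi -> is_coboundary A q psi -> is_coboundary A q (cadd phi psi).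
Proof.
move=> [eta [e0 e1 e2]] [xi [x0 x1 x2]]; exists (cadd eta xi); split.
- by move=> q0; rewrite /cadd e0// x0.
- exact: lzeroD.
- apply: lzero_ext (lzeroD e2 x2) => l _; rewrite cobdD_fun /cadd.
  by rewrite addbACA.
Qed.

Lemma is_coboundary_cadd (A : set X) q phi psi :
  is_coboundary A q (cadd phi psi) -> is_coboundary A q phi <-> is_coboundary A q psi.
Proof.
move=> h; split=> k; have [eta [? ? e]] := is_coboundaryD h k; exists eta; split=> //;
  by apply: lzero_ext e => l _; rewrite /cadd; case: (phi l); case: (psi l).
Qed.

Lemma is_coboundary_lzero (A : set X) q psi :
  lzero setT q.+1 psi -> is_coboundary A q psi.
Proof.
move=> h; exists (fun=> false); split=> //; first exact: lzero0.
by apply: lzero_ext h => l _; rewrite /cadd cobd0 addbF.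
Qed.

Lemma is_cocycle_cup1 q theta psi :
  is_cocycle set0 1 theta -> is_cocycle set0 q psi ->
  is_cocycle set0 q.+1 (cup1 theta psi).
Proof.
move=> /is_cocycle_set0 h /is_cocycle_set0 k; apply/is_cocycle_set0 => x _.
have [U xU hU] := h x I; have [V xV kV] := k x I.
exists (U `&` V); first exact: filterI.
move=> [|a[|b[|c l]]]// [sl] lUV; rewrite cobd_cup1/= hU// ?kV ?andbF//.
- by rewrite /= sl.
- by move=> y yl; have [|_ []] := lUV y; rewrite // inE yl orbT.
- move=> y yl; have [|_ []] := lUV y; rewrite //.
  by move: yl; rewrite !inE => /or3P[]->; rewrite ?orbT.
Qed.

(** If theta + theta' = d alpha and psi + psi' = d beta, the difference of the products is d (alpha
    psi + theta' beta), by the Leibniz rule and closedness of theta' and psi. *)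
Lemma is_coboundary_cup1 q theta theta' psi psi' :
  is_cocycle set0 1 theta' -> is_cocycle set0 q psi ->
  is_coboundary set0 1 (cadd theta theta') -> is_coboundary set0 q (cadd psi psi') ->
  is_coboundary set0 q.+1 (cadd (cup1 theta psi) (cup1 theta' psi')).
Proof.
move=> /is_cocycle_set0 h /is_cocycle_set0 k /is_coboundary_set0[alpha _ ha].
move=> /is_coboundary_set0[beta b0 hb]; apply/is_coboundary_set0.
exists (cadd (cup0 (fun x => alpha [:: x]) psi) (cup1 theta' beta)) => // x _.
have [U1 xU1 hU1] := h x I; have [U2 xU2 hU2] := k x I.
have [U3 xU3 hU3] := ha x I; have [U4 xU4 hU4] := hb x I.
exists (U1 `&` U2 `&` (U3 `&` U4)); first by do !apply: filterI.
move=> [|a [|b l]]// [sl] lU.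
have lU' y : y \in [:: a, b & l] -> [/\ U1 y, U2 y, U3 y & U4 y].
  by move=> /lU[_ [[]] ? ? []].
rewrite cobdD_fun /cadd cobd_cup0 /= hU2//; last first.
- by move=> y /lU'[].
- by rewrite /= sl.
rewrite andbF addbF.
have Ea : cadd (cadd theta theta') (cobd alpha) [:: a; b] = false.
  apply: hU3 => // y yl; split=> //.
  have [|] := lU' y => //; move: yl.
  by rewrite !inE => /orP[]->; rewrite ?orbT.
rewrite /cadd !cobd_cons [cobd _ [::]](_ : _ = false)// addbF {1}/slice in Ea.
have Eb : cadd (cadd psi psi') (cobd beta) (b :: l) = false.
  by apply: hU4; rewrite /= ?sl// => y yl; have [|] := lU' y; rewrite // inE yl orbT.
(* When [q] is 0 the cochain [beta] lives on the empty list, where it is false, and both sides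
   vanish. *)
have -> : cobd (cup1 theta' beta) [:: a, b & l] = theta' [:: a; b] && cobd beta (b :: l).
  case: l sl lU lU' Eb => [|c l] sl lU lU' Eb.
    case: q sl b0 {k hb hU2 hU4 lU lU' Eb} => // _ b0.
    rewrite !cobd_cons [cobd _ [::]](_ : _ = false)// [cobd _ [::]](_ : _ = false)//.
    by rewrite b0 ?andbF.
  rewrite cobd_cup1 hU1//= => y yl; split=> //.
  have [|] := lU' y => //; move: yl.
  by rewrite !inE => /or3P[]->; rewrite ?orbT.
move: Ea Eb; rewrite /cadd.
move: (theta _) (theta' _) (alpha [:: a]) (alpha [:: b]) (psi _) (psi' _) (cobd _ _).
by do 4!case; do 3!case.
Qed.

Lemma is_cocycle_true : is_cocycle (@set0 X) 0 (fun=> true).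
Proof.
apply/is_cocycle_set0 => x _; exists setT; first exact: filterT.
by move=> [|a [|b [|]]].
Qed.

Lemma is_cocycle_power m theta : is_cocycle set0 1 theta ->
  is_cocycle set0 m (cup1_power theta m).
Proof. by move=> h; elim: m => [|m IH]; [exact: is_cocycle_true|exact: is_cocycle_cup1]. Qed.

Lemma is_coboundary_power m theta theta' :
  is_cocycle set0 1 theta -> is_cocycle set0 1 theta' ->
  is_coboundary set0 1 (cadd theta theta') ->
  is_coboundary set0 m (cadd (cup1_power theta m) (cup1_power theta' m)).
Proof.
move=> h h' hh; elim: m => [|m IH]; last first.
  by apply: is_coboundary_cup1 => //; exact: is_cocycle_power.
by apply: is_coboundary_lzero; apply: lzero_ext (@lzero0 setT 1).
Qed.

(** Multiplying a coboundary by the cocycle [theta] leaves it a coboundary, so the vanishing of a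
    power persists. *)
Lemma is_coboundary_power_le m n theta : (m <= n)%N -> is_cocycle set0 1 theta ->
  is_coboundary set0 m (cup1_power theta m) ->
  is_coboundary set0 n (cup1_power theta n).
Proof.
move=> mn h; elim: n mn => [|n IH].
  by rewrite leqn0 => /eqP->.
rewrite leq_eqVlt => /orP[/eqP->//|mn] hm.
have /(@is_coboundary_cup1 n theta theta _ (fun=> false)) : is_cocycle set0 1 theta by [].
move=> /(_ (cup1_power theta n)) [].
- exact: is_cocycle_power.
- apply: is_coboundary_lzero; apply: lzero_ext (@lzero0 setT 2) => l _.
  by rewrite /cadd addbb.
- have [eta [? ? e]] := IH mn hm; exists eta; split=> //.
  by apply: lzero_ext e => l _; rewrite /cadd addbF.
move=> eta [? ? e]; exists eta; split=> //; apply: lzero_ext e => l _.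
by rewrite /cadd; congr (_ (+) _); case: l => [|? [|? ?]] //=; rewrite andbF addbF.
Qed.

Lemma cup_of_list q theta psi :
  cup_cochain (of_list 1 theta) (of_list q psi) = of_list (1 + q) (cup1 theta psi).
Proof.
apply/funext => s; rewrite /cup_cochain /of_list.
have -> : map s (enum 'I_(1 + q).+1) =
    s ord0 :: map (fun j : 'I_q.+1 => s (inord (1 + j))) (enum 'I_q.+1).
  rewrite enum_ordSl/= -map_comp; congr (_ :: _); apply: eq_map => j /=.
  by congr s; apply/val_inj; rewrite /= inordK// ltnS.
have -> : map (fun i : 'I_2 => s (inord i)) (enum 'I_2) =
    [:: s ord0; s (inord 1)].
  rewrite enum_ordSl/= -map_comp enum_ordSl/= -map_comp.
  case: (enum 'I_0) (size_enum_ord 0) => //= _; congr [:: s _; s _].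
  by apply/val_inj; rewrite /= inordK.
rewrite [enum 'I_q.+1]enum_ordSl/=.
by case: (theta _); case: (psi _); rewrite /= ?mulr1 ?mulr0 ?mul0r.
Qed.

Lemma cup_class q (a : cohomology X 1) (b : cohomology X q) theta psi
    (h : is_cocycle set0 1 theta) (k : is_cocycle set0 q psi) :
  a = class_of_list h -> b = class_of_list k ->
  cup a b = class_of_list (is_cocycle_cup1 h k).
Proof.
move=> /class_of_list_eq_repr ha /class_of_list_eq_repr kb.
apply/subquotient_class_eq.
rewrite -(to_listK (subquotient_repr a)) -(to_listK (subquotient_repr b)).
rewrite cup_of_list of_listB; apply/coboundary_of_list.
apply: is_coboundary_cup1 => //.
by apply/cocycle_of_list; rewrite to_listK; exact: subquotient_reprP.
Qed.

Lemma cup_power_class (w : cohomology X 1) theta (h : is_cocycle set0 1 theta) m :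
  w = class_of_list h -> cup_power w m = class_of_list (is_cocycle_power m h).
Proof.
move=> wh; elim: m => [|m IH].
  apply/subquotient_class_eq; rewrite (_ : _ - _ = 0) ?rpred0//.
  apply/funext => s; rewrite [LHS](_ : _ = 1 - 1)//.
  exact: subrr.
rewrite /= (cup_class wh IH); apply/class_of_list_eq; apply: is_coboundary_lzero.
by apply: lzero_ext (@lzero0 setT _) => l _; rewrite /cadd addbb.
Qed.

End CupLocal.

Section PullbackClass.
Variables (X Y : topologicalType) (f : X -> Y).
Hypothesis cf : continuous f.

Lemma is_cocycle_pull q psi : is_cocycle set0 q psi -> is_cocycle set0 q (pull f psi).
Proof.
move=> /is_cocycle_set0 h; apply/is_cocycle_set0.
by apply: lzero_ext (lzero_pull cf h) => l _; rewrite cobd_pull.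
Qed.

Lemma is_coboundary_pull q psi :
  is_coboundary set0 q psi -> is_coboundary set0 q (pull f psi).
Proof.
move=> /is_coboundary_set0[eta e0 h]; apply/is_coboundary_set0; exists (pull f eta) => //.
by apply: lzero_ext (lzero_pull cf h) => l _; rewrite /cadd cobd_pull.
Qed.

Lemma pullback_of_list q psi :
  cochain_pullback f (of_list q psi) = of_list q (pull f psi).
Proof. by apply/funext => s; rewrite /cochain_pullback /of_list /pull -map_comp. Qed.

Lemma pullback_class q (c : cohomology Y q) psi (h : is_cocycle set0 q psi) :
  c = class_of_list h -> pullback cf c = class_of_list (is_cocycle_pull h).
Proof.
move=> /class_of_list_eq_repr hc; apply/subquotient_class_eq.
rewrite -(to_listK (subquotient_repr c)) pullback_of_list of_listB.
by apply/coboundary_of_list; exact: is_coboundary_pull hc.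
Qed.

Lemma pull_power theta m l :
  pull f (cup1_power theta m) l = cup1_power (pull f theta) m l.
Proof.
elim: m l => // m IH [|a [|b l]]//=.
by rewrite -[cup1_power _ m (b :: l)]IH.
Qed.

End PullbackClass.

(** * The Gysin sequence of a double cover *)

Lemma addb_eqF (a b : bool) : a (+) b = false -> a = b.
Proof. by case: a; case: b. Qed.

(* [dc_close a b] says that nearby points [a], [b] lie on the same local sheet *)
Record double_cover (T B : topologicalType) := DoubleCover {
  dc_inv : T -> T;
  dc_proj : T -> B;
  dc_section : B -> T;
  dc_close : T -> T -> bool;
  dc_inv_continuous : continuous dc_inv;
  dc_proj_continuous : continuous dc_proj;
  dc_proj_open : forall (a : T) (U : set T), nbhs a U -> nbhs (dc_proj a) (dc_proj @` U);
  dc_sectionK : forall x, dc_proj (dc_section x) = x;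
  dc_fiber : forall a b, dc_proj a = dc_proj b -> b = a \/ b = dc_inv a;
  dc_proj_inv : forall a, dc_proj (dc_inv a) = dc_proj a;
  dc_invK : involutive dc_inv;
  dc_closeP : forall a : T, exists2 V : set T, nbhs a V & forall b b', V b -> V b' ->
    [/\ dc_close b b', ~~ dc_close (dc_inv b) b', ~~ dc_close b (dc_inv b') &
        dc_close (dc_inv b) (dc_inv b')] }.

Section DoubleCoverTheory.
Variables (T B : topologicalType) (D : double_cover T B).
Local Notation nu := (dc_inv D).
Local Notation pi := (dc_proj D).
Local Notation s := (dc_section D).
Local Notation r := (dc_close D).

(** The first Stiefel-Whitney class of the cover: an edge gets 1 when the chosen lifts of its ends
    lie on different local sheets. *)
Definition dc_cocycle : seq B -> bool :=
  fun l => if l is [:: x; y] then ~~ r (s x) (s y) else false.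

Definition dc_sign (b : T) : bool := b != s (pi b).

Let theta := dc_cocycle.
Let eps := dc_sign.

Lemma dc_inv_neq b : nu b != b.
Proof.
have [V bV /(_ b b (nbhs_singleton bV) (nbhs_singleton bV))[rb nrb _ _]] := dc_closeP D b.
by apply/eqP => e; rewrite e rb in nrb.
Qed.

Lemma dc_section_proj b : s (pi b) = if eps b then nu b else b.
Proof.
rewrite /eps /dc_sign; case: eqVneq => [<-//|].
by have /dc_fiber[->|->] := esym (dc_sectionK D (pi b)); rewrite ?eqxx.
Qed.

Lemma dc_sign_inv b : eps (nu b) = ~~ eps b.
Proof.
rewrite /eps [LHS]/dc_sign dc_proj_inv dc_section_proj -/eps.
by case: (eps b); rewrite /= ?eqxx// dc_inv_neq.
Qed.

Definition dc_lift (a : T) (y : B) : T := if r a (s y) then s y else nu (s y).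

(* [la] is a local section on [V] with values in [U] *)
Lemma dc_chart (a : T) (U : set T) : nbhs a U -> exists (V : set B) (la : B -> T), [/\ nbhs (pi a) V,
  forall y, V y -> U (la y) /\ pi (la y) = y,
  forall y z, V y -> V z -> theta [:: y; z] = eps (la y) (+) eps (la z) &
  forall y z, V y -> V z -> dc_lift (s y) z = if eps (la y) then nu (la z) else la z].
Proof.
move=> aU; have [V aV VP] := dc_closeP D a.
pose P y b := (U `&` V) b /\ pi b = y.
have : forall y, exists b, (pi @` (U `&` V)) y -> P y b.
  move=> y; have [[b Ub <-]|n] := pselect ((pi @` (U `&` V)) y); first by exists b.
  by exists a => /n.
move=> /choice[la laP].
exists (pi @` (U `&` V)), la; split=> [|y|y z|y z].
- by apply: dc_proj_open; exact: filterI.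
- by move=> /laP[[]].
- move=> /laP[[_ Vy] ey] /laP[[_ Vz] ez].
  rewrite /theta /dc_cocycle -ey -ez !dc_section_proj ey ez.
  have [r1 /negbTE r2 /negbTE r3 r4] := VP _ _ Vy Vz.
  by case: (eps (la y)); case: (eps (la z)); rewrite ?r1 ?r2 ?r3 ?r4.
- move=> /laP[[_ Vy] ey] /laP[[_ Vz] ez].
  rewrite /dc_lift -ey -ez !dc_section_proj ey ez.
  have [r1 /negbTE r2 /negbTE r3 r4] := VP _ _ Vy Vz.
  by case: (eps (la y)); case: (eps (la z)); rewrite ?r1 ?r2 ?r3 ?r4 ?dc_invK.
Qed.

(** The class of the cover dies upstairs: [dc_sign] is a primitive of its pull-back near each
    point. *)
Lemma dc_cocycle_proj (a : T) : exists2 V : set T, nbhs a V & forall b b', V b -> V b' ->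
  theta [:: pi b; pi b'] = eps b (+) eps b'.
Proof.
have [V aV VP] := dc_closeP D a; exists V => // b b' Vb Vb'.
rewrite /theta /dc_cocycle !dc_section_proj.
have [r1 /negbTE r2 /negbTE r3 r4] := VP _ _ Vb Vb'.
by case: (eps b); case: (eps b'); rewrite ?r1 ?r2 ?r3 ?r4.
Qed.

Lemma is_cocycle_dc : is_cocycle set0 1 theta.
Proof.
apply/is_cocycle_set0 => x _; rewrite -(dc_sectionK D x).
have [V [la [xV _ th _]]] := dc_chart (@filterT _ (nbhs (s x)) _).
exists V => // -[|a [|b [|c [|//]]]]// _ lV.
have [[_ Va] [_ Vb] [_ Vc]] : [/\ setT a /\ V a, setT b /\ V b & setT c /\ V c].
  by split; apply: lV; rewrite !inE eqxx ?orbT.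
rewrite !cobd_cons [cobd _ [::]](_ : _ = false)// addbF /slice !th//.
by case: (eps _); case: (eps _); case: (eps _).
Qed.

(** The transfer homomorphism, summing over the two lifts of a small simplex. A lift is fixed by its
    first vertex; the choice there is immaterial because both lifts are taken. *)
Definition transfer (eta : seq T -> bool) : seq B -> bool := fun l =>
  if l is x :: _ then
    let m := map (dc_lift (s x)) l in eta m (+) eta (map nu m)
  else false.

(** Only one of the two lifts, the one through the chosen lift of the first vertex. It fails to
    commute with [cobd], because dropping the first vertex may switch lifts, and the defect is
    [theta] times the transfer. *)
Let lifted (eta : seq T -> bool) : seq B -> bool := fun l =>
  if l is x :: _ then eta (map (dc_lift (s x)) l) else eta [::].

Lemma transfer_chart V la eta l :
  (forall y z, V y -> V z -> dc_lift (s y) z = if eps (la y) then nu (la z) else la z) ->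
  (forall y, y \in l -> V y) ->
  transfer eta l = eta (map la l) (+) eta (map (nu \o la) l).
Proof.
move=> lV; case: l => [|x l] xV; first by rewrite /= addbb.
rewrite /transfer -map_comp.
have Vx := xV _ (mem_head _ _).
case e : (eps (la x)).
  rewrite addbC; congr (eta _ (+) eta _); apply/eq_in_map => y /xV Vy /=.
    by rewrite lV// e dc_invK.
  by rewrite lV// e.
congr (eta _ (+) eta _); apply/eq_in_map => y /xV Vy /=; by rewrite lV// e.
Qed.

Lemma lifted_chart V la eta l :
  (forall y z, V y -> V z -> dc_lift (s y) z = if eps (la y) then nu (la z) else la z) ->
  (forall y, y \in l -> V y) ->
  lifted eta l = eta (map la l) (+) cup0 (eps \o la) (transfer eta) l.
Proof.
move=> lV; case: l => [|x l] xV; first by rewrite addbF.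
rewrite /cup0 (transfer_chart _ lV)//.
have Vx := xV _ (mem_head _ _); rewrite /lifted.
rewrite (_ : map _ _ = map (if eps (la x) then nu \o la else la) (x :: l)).
  by rewrite [(eps \o la) x]/=; case: (eps _) => /=;
    [rewrite addbA addbb|rewrite addbF].
by apply/eq_in_map => y /xV Vy; rewrite lV//; case: (eps _).
Qed.

Lemma cobd_transfer_chart V la eta l :
  (forall y z, V y -> V z -> dc_lift (s y) z = if eps (la y) then nu (la z) else la z) ->
  (forall y, y \in l -> V y) ->
  cobd (transfer eta) l = cobd eta (map la l) (+) cobd eta (map (nu \o la) l).
Proof.
move=> lV xV; rewrite -!cobd_pull -cobdD.
by apply: eq_cobd => m ml _; apply: transfer_chart lV _ => y /ml /xV.
Qed.

(** Exactness of the Gysin sequence at the source of multiplication by w. If theta xi = d psi, then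
    upstairs eps times the pull-back of xi, plus the pull-back of psi, is closed. Its transfer is
    xi, since [dc_sign] takes opposite values on the two points of a fibre. A primitive of this
    cocycle transfers to a primitive of [xi]; even a reduced primitive will do, because [transfer
    eta [::]] is false. *)
Lemma gysin_injective q xi : is_cocycle set0 q xi ->
  is_coboundary set0 q.+1 (cup1 theta xi) ->
  exists2 x : seq T -> bool, lzero setT q.+2 (cobd x) &
    is_reduced_coboundary q x -> is_coboundary set0 q xi.
Proof.
move=> /is_cocycle_set0 dxi /is_coboundary_set0[psi _ psiP].
exists (cadd (cup0 eps (pull pi xi)) (pull pi psi)).
  move=> a _; have [V aV VP] := dc_cocycle_proj a.
  have [U aU hU] := lzero_pull (@dc_proj_continuous _ _ D) dxi (I : setT a).
  have [W aW hW] := lzero_pull (@dc_proj_continuous _ _ D) psiP (I : setT a).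
  exists (V `&` (U `&` W)); first by do !apply: filterI.
  move=> [|b [|b' l]]// sl lV.
  have lV' y : y \in [:: b, b' & l] -> [/\ V y, U y & W y] by move=> /lV[_ [? []]].
  have Eu : pull pi (cobd xi) [:: b, b' & l] = false.
    by apply: hU => // y /lV'[].
  have Ew : pull pi (cadd (cup1 theta xi) (cobd psi)) [:: b, b' & l] = false.
    by apply: hW => // y /lV'[].
  rewrite cobdD cobd_pull cobd_cup0.
  have -> : cobd (pull pi xi) = pull pi (cobd xi) by apply/funext => m; rewrite cobd_pull.
  rewrite /cup0 Eu andbF addbF -VP; last first.
  - by have [|] := lV' b'; rewrite // !inE eqxx orbT.
  - by have [|] := lV' b; rewrite // !inE eqxx.
  exact: Ew.
move=> [eta etaP]; apply/is_coboundary_set0; exists (transfer eta) => // x _.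
have [U sU hU] := etaP (s x) I; have [U' sU' hU'] := etaP (nu (s x)) I.
(* The chart has to be small around both points of the fibre, since the transfer evaluates on both
   lifts. *)
have sUU' : nbhs (s x) (U `&` nu @^-1` U').
  by apply: filterI => //; exact: dc_inv_continuous.
have [V [la [xV laP th ll]]] := dc_chart sUU'.
rewrite dc_sectionK in xV; exists V => // -[//|y l] sl lV.
rewrite /cadd (cobd_transfer_chart _ ll); last by move=> z /lV[].
have e1 : cadd (cup0 eps (pull pi xi)) (pull pi psi) (map la (y :: l)) =
    cobd eta (map la (y :: l)).
  apply: addb_eqF; apply: hU; first by rewrite size_map.
  by move=> _ /mapP[z /lV[_ /laP[[? ?] _]] ->].
have e2 : cadd (cup0 eps (pull pi xi)) (pull pi psi) (map (nu \o la) (y :: l)) =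
    cobd eta (map (nu \o la) (y :: l)).
  apply: addb_eqF; apply: hU'; first by rewrite size_map.
  by move=> _ /mapP[z /lV[_ /laP[[? ?] _]] ->].
rewrite -e1 -e2 /cadd /pull.
have -> : map pi (map la (y :: l)) = y :: l.
  by rewrite -map_comp map_id_in// => z /lV[_ /laP[]].
have -> : map pi (map (nu \o la) (y :: l)) = y :: l.
  by rewrite -map_comp map_id_in// => z /lV[_ /laP[]] _ /=; rewrite dc_proj_inv.
rewrite /cup0 /= -/(pull pi xi (la y :: map la l)) /pull /=.
have -> : pi (nu (la y)) :: map pi (map (nu \o la) l) = y :: l.
  have [_ /laP[_ e]] := lV y (mem_head _ _); rewrite dc_proj_inv e -map_comp.
  rewrite map_id_in// => z zl; have [|_ /laP[_]] := lV z; first by rewrite inE zl orbT.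
  by rewrite /= dc_proj_inv.
have -> : pi (la y) :: map pi (map la l) = y :: l.
  have [_ /laP[_ e]] := lV y (mem_head _ _); rewrite e -map_comp.
  rewrite map_id_in// => z zl; have [|_ /laP[_]] := lV z => //.
  by rewrite inE zl orbT.
rewrite dc_sign_inv; move: (eps _) (xi _) (psi _); by do 3!case.
Qed.

(** Exactness at the target of multiplication by w. Over a small simplex [cobd eta] equals [x] on
    both lifts, so the transfer of [eta] is closed; the defect of [lifted eta] then writes [x] as
    theta times this transfer, up to a coboundary. *)
Lemma gysin_surjective q x eta : is_cocycle set0 q.+1 x ->
  lzero setT q.+2 (cadd (pull pi x) (cobd eta)) ->
  is_cocycle set0 q (transfer eta) /\
  is_coboundary set0 q.+1 (cadd x (cup1 theta (transfer eta))).
Proof.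
move=> /is_cocycle_set0 dx etaP.
have chart (y : B) : exists (V : set B) (la : B -> T), [/\ nbhs y V,
    forall l, size l = q.+2 -> (forall z, z \in l -> setT z /\ V z) ->
      cobd eta (map la l) = x l /\ cobd (transfer eta) l = false,
    forall y z, V y -> V z -> theta [:: y; z] = eps (la y) (+) eps (la z) &
    forall y z, V y -> V z -> dc_lift (s y) z = if eps (la y) then nu (la z) else la z].
  have [U sU hU] := etaP (s y) I; have [U' sU' hU'] := etaP (nu (s y)) I.
  have sUU' : nbhs (s y) (U `&` nu @^-1` U').
    by apply: filterI => //; exact: dc_inv_continuous.
  have [V [la [xV laP th ll]]] := dc_chart sUU'; rewrite dc_sectionK in xV.
  exists V, la; split=> // l sl lV.
  have e1 : cobd eta (map la l) = x l.
    apply/esym/addb_eqF; rewrite -(hU (map la l)) ?size_map//.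
      rewrite /cadd /pull -map_comp map_id_in// => z /lV[_ /laP[]]//.
    by move=> _ /mapP[z /lV[_ /laP[[? ?] _]] ->].
  have e2 : cobd eta (map (nu \o la) l) = x l.
    apply/esym/addb_eqF; rewrite -(hU' (map (nu \o la) l)) ?size_map//.
      rewrite /cadd /pull -map_comp map_id_in// => z /lV[_ /laP[]] _ /=.
      by rewrite dc_proj_inv.
    by move=> _ /mapP[z /lV[_ /laP[[? ?] _]] ->].
  split=> //; rewrite (cobd_transfer_chart _ ll) ?e1 ?e2 ?addbb// => z /lV[]//.
split.
  apply/is_cocycle_set0 => y _; have [V [la [yV VP _ _]]] := chart y.
  by exists V => // l sl lV; have [] := VP l sl lV.
apply/is_coboundary_set0; exists (lifted eta) => // y _.
have [V [la [yV VP th ll]]] := chart y; exists V => // -[|a [|b l]]// sl lV.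
have [e1 e2] := VP _ sl lV.
rewrite /cadd (@eq_cobd _ _ (cadd (pull la eta) (cup0 (eps \o la) (transfer eta)))).
  rewrite cobdD cobd_pull e1 cobd_cup0 /cup0 e2 andbF addbF /cup1.
  rewrite th; first by case: (x _); case: (_ && _).
    by have [|] := lV a; rewrite // !inE eqxx.
  by have [|] := lV b; rewrite // !inE eqxx orbT.
by move=> m ml _; apply: lifted_chart ll _ => z /ml /lV[].
Qed.

Section Acyclic.
Hypothesis acyclicT : forall q (x : seq T -> bool), lzero (@setT T) q.+2 (cobd x) -> is_reduced_coboundary q x.

(** Over an acyclic total space, [gysin_injective] makes multiplication by the class injective; the
    base case is that 1 is not zero at the point [b]. *)
Lemma dc_power_neq0 (b : B) q : ~ is_coboundary set0 q (cup1_power theta q).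
Proof.
elim: q => [|q IH].
  move=> /is_coboundary_set0[eta /(_ erefl) e0 h]; have [U bU hU] := h b I.
  have : cadd (cup1_power theta 0) (cobd eta) [:: b] = false.
    by apply: hU => // y; rewrite inE => /eqP->; split=> //; exact: nbhs_singleton.
  by rewrite /cadd cobd_cons e0.
move=> /gysin_injective[|x dx xP]; first exact/is_cocycle_power/is_cocycle_dc.
by apply: IH; apply: xP; exact: acyclicT.
Qed.

(** By [gysin_surjective] a class of positive degree is the class of the cover times a class of one
    degree less. In degree 0 the pull-back to the acyclic total space is the constant [eta [::]]. *)
Lemma dc_power_generates q xi : is_cocycle set0 q xi -> exists b : bool,
  is_coboundary set0 q (cadd xi (fun l => b && cup1_power theta q l)).
Proof.
elim: q xi => [|q IH] xi /[dup] xic /is_cocycle_set0 dxi.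
  have : lzero setT 2 (cobd (pull pi xi)).
    by apply: lzero_ext (lzero_pull (@dc_proj_continuous _ _ D) dxi) => l _; rewrite cobd_pull.
  move=> /acyclicT[eta etaP]; exists (eta [::]).
  apply: is_coboundary_lzero => x _; have [U xU hU] := etaP (s x) I.
  exists setT; first exact: filterT.
  move=> [|y [|//]]// _ _; have [V yV hV] := etaP (s y) I.
  rewrite -(hV [:: s y])//; last first.
    by move=> z; rewrite inE => /eqP->; split=> //; exact: nbhs_singleton.
  by rewrite /cadd cobd_cons addbF /pull /= dc_sectionK andbT.
have /acyclicT[eta etaP] : lzero setT q.+3 (cobd (pull pi xi)).
  by apply: lzero_ext (lzero_pull (@dc_proj_continuous _ _ D) dxi) => l _; rewrite cobd_pull.
have [] := gysin_surjective xic etaP; move: (transfer eta) => zeta tc tb.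
have [b hb] := IH _ tc; exists b.
have c := is_cocycle_dc.
have z : is_coboundary set0 1 (cadd theta theta).
  apply: is_coboundary_lzero; apply: lzero_ext (@lzero0 _ setT 2) => l _.
  by rewrite /cadd addbb.
have [eta' [? ? e]] := is_coboundaryD tb (is_coboundary_cup1 c tc z hb).
exists eta'; split=> //; apply: lzero_ext e => -[|x0 [|x1 l]]// _; rewrite /cadd /=.
by move: (xi _) (r _ _) (zeta _) (cobd _ _) (cup1_power _ _ _); case: b {hb}; do 5!case.
Qed.

End Acyclic.

Section Nilpotent.
Variables (R : realType) (m : nat) (g : 'I_m -> T -> R).
Hypothesis gc : forall i a, g i b @[b --> a] --> g i a.
Hypothesis g_odd : forall i a, g i (nu a) = - g i a.
Hypothesis g_neq0 : forall a, exists i, g i a != 0.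

Let zero_cochain i : seq B -> bool :=
  fun l => if l is [:: x] then g i (s x) < 0 else false.

(** [theta] modified by the coboundary of the sign of [g i] at the chosen lifts. Where [g i] does
    not vanish, its sign tells the two sheets apart, so [theta_ i] is zero near such points. *)
Let theta_ i := cadd theta (cobd (zero_cochain i)).

Let theta_cohomologous i : is_coboundary set0 1 (cadd theta (theta_ i)).
Proof.
apply/is_coboundary_set0; exists (zero_cochain i) => //.
apply: lzero_ext (@lzero0 _ setT 2) => l _; rewrite /theta_ /cadd.
by case: (theta l); case: (cobd _ _).
Qed.

Let theta_cocycle i : is_cocycle set0 1 (theta_ i).
Proof.
have /is_cocycle_set0 h := is_cocycle_dc.
by apply/is_cocycle_set0; apply: lzero_ext h => l _; rewrite cobdD cobdK addbF.
Qed.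

Let theta_lzero i (x : B) : g i (s x) != 0 -> exists2 V : set B, nbhs x V &
  forall y z, V y -> V z -> theta_ i [:: y; z] = false.
Proof.
move=> gx.
have [U sU hU] : exists2 U : set T, nbhs (s x) U & forall b, U b -> (g i b < 0) = (g i (s x) < 0)
    /\ g i b != 0.
  have [lt|ge] := ltP (g i (s x)) 0.
    exists [set b | g i b < 0].
      exact: (cvgr_lt (g i (s x)) (@gc i (s x)) _ lt).
    by move=> b /= lb; rewrite lb lt_eqF.
  have gt : 0 < g i (s x) by rewrite lt_neqAle eq_sym gx.
  exists [set b | 0 < g i b].
    exact: (cvgr_gt (g i (s x)) (@gc i (s x)) _ gt).
  by move=> b /= lb; rewrite ltNge ltW// gt_eqF.
have [V [la [xV laP th _]]] := dc_chart sU; rewrite dc_sectionK in xV.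
exists V => // y z Vy Vz; rewrite /theta_ /cadd th// !cobd_cons /slice /=.
rewrite [cobd _ [::]](_ : _ = false)// addbF.
have sE t : V t -> (g i (s t) < 0) = (g i (s x) < 0) (+) eps (la t).
  move=> /laP[/hU[ht ht0] tE]; rewrite -{1}tE dc_section_proj.
  case: (eps _); last by rewrite ht addbF.
  by rewrite g_odd oppr_lt0 -ht; case: ltgtP ht0.
rewrite (sE y)// (sE z)//; move: (eps _) (eps _) (_ < _); by do 3!case.
Qed.

Let product (l : seq 'I_m) : seq B -> bool :=
  foldr (fun i psi => cup1 (theta_ i) psi) (fun=> true) l.

Let product_cohomologous l : is_cocycle set0 (size l) (product l) /\
  is_coboundary set0 (size l) (cadd (cup1_power theta (size l)) (product l)).
Proof.
elim: l => [|i l [IH1 IH2]] /=.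
  split; first exact: is_cocycle_true.
  by apply: is_coboundary_lzero; apply: lzero_ext (@lzero0 _ setT 1).
split; first exact: is_cocycle_cup1.
by apply: is_coboundary_cup1 => //; exact/is_cocycle_power/is_cocycle_dc.
Qed.

Let product_eq0 (l : seq 'I_m) i n (V : set B) : i \in l ->
  (forall y z, V y -> V z -> theta_ i [:: y; z] = false) ->
  size n = (size l).+1 -> (forall y, y \in n -> V y) -> product l n = false.
Proof.
move=> il VP; elim: l n il => // j l IH [|a [|b n]]//.
rewrite inE => /orP[/eqP<-|il] [sn] nV /=.
  by rewrite VP//; apply: nV; rewrite !inE eqxx ?orbT.
rewrite IH ?andbF//; first by rewrite /= sn.
by move=> y yn; apply: nV; rewrite inE yn orbT.
Qed.

(** The cup-length argument: the m-th power is cohomologous to the product of all the [theta_ i],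
    and near every point some [g i] is nonzero, so that one factor vanishes there. *)
Lemma dc_nilpotent : is_coboundary set0 m (cup1_power theta m).
Proof.
have [_] := product_cohomologous (enum 'I_m); rewrite size_enum_ord => h.
apply/(is_coboundary_cadd h); apply: is_coboundary_lzero => x _.
have [i gi] := g_neq0 (s x); have [V xV VP] := theta_lzero gi.
exists V => // n sn nV; apply: (@product_eq0 _ i _ V) => //.
- by rewrite mem_enum.
- by rewrite size_enum_ord.
- by move=> y /nV[].
Qed.

End Nilpotent.

End DoubleCoverTheory.

(** The two cocycles differ by the coboundary of [e], which records whether [F] takes the chosen
    lift to the chosen lift. In particular the class depends neither on the section nor on the
    closeness relation, so different odd maps to the sphere can be compared without a homotopy
    between them. *)
Lemma dc_cocycle_natural (T B T' B' : topologicalType) (D : double_cover T B)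
    (D' : double_cover T' B') (F : T -> T') (f : B -> B') :
  continuous F -> (forall a, f (dc_proj D a) = dc_proj D' (F a)) ->
  (forall a, F (dc_inv D a) = dc_inv D' (F a)) ->
  is_coboundary set0 1 (cadd (pull f (dc_cocycle D')) (dc_cocycle D)).
Proof.
move=> cF fF Fnu; apply/is_coboundary_set0.
pose e x := dc_sign D' (F (dc_section D x)).
exists (fun l => if l is [:: x] then e x else false) => // x _.
have [V aV VP] := dc_cocycle_proj D' (F (dc_section D x)).
have aU : nbhs (dc_section D x) (F @^-1` V) by exact: cF.
have [U [la [xU laP th _]]] := dc_chart D aU; rewrite dc_sectionK in xU.
exists U => // -[|y [|z [|//]]]// _ lU.
have [|_ Uy] := lU y; first by rewrite !inE eqxx.
have [|_ Uz] := lU z; first by rewrite !inE eqxx orbT.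
have eE t : U t -> e t = dc_sign D' (F (la t)) (+) dc_sign D (la t).
  move=> /laP[_ tE]; rewrite /e -{1}tE dc_section_proj.
  by case: ifP => _; rewrite ?Fnu ?dc_sign_inv ?addbT ?addbF.
have [Vy yE] := laP _ Uy; have [Vz zE] := laP _ Uz.
rewrite /cadd th// /pull !cobd_cons /slice /=.
rewrite [cobd _ [::]](_ : _ = false)// addbF !eE//.
have := VP _ _ Vy Vz; rewrite -!fF yE zE /= => ->.
by do 4!case: (dc_sign _ _).
Qed.

(** * Quotients by the antipodal map *)

Lemma nbhs_set_typeP (X : topologicalType) (A : set X) (a : A) (U : set A) :
  nbhs a U <-> exists2 V : set X, nbhs (\val a) V & (fun b : A => \val b) @^-1` V `<=` U.
Proof.
split=> [[_ /= [[V oV <-] Va VU]]|[V aV VU]].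
  by exists V => //; exact: open_nbhs_nbhs.
apply: (filterS VU).
exact: (@initial_continuous _ _ (@set_val _ A) a V aV).
Qed.

Lemma cvg_set_type (X : topologicalType) (A : set X) (I : Type) (F : set_system I)
    (FF : Filter F) (f : I -> A) (a : A) :
  (fun i => \val (f i)) @ F --> \val a -> f @ F --> a.
Proof.
move=> h U /nbhs_set_typeP[V aV VU].
exact: (@filterS _ F FF _ _ (fun i => VU (f i)) (h V aV)).
Qed.

Lemma val_continuous (X : topologicalType) (A : set X) : continuous (fun a : A => \val a).
Proof. exact: (@initial_continuous _ _ set_val). Qed.

Section AntipodalCover.
Variables (W : PreTopologicalZmodule.type) (A : set W).
Hypothesis copp : continuous (-%R : W -> W).
Hypothesis symA : forall x, A x -> A (- x).

Lemma antipodal_piP (x y : A) : antipodal_pi x = antipodal_pi y <->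
  \val x = \val y \/ \val x = - \val y.
Proof.
split=> [xy|h].
  exact/asboolP/(@eqquotP _ _ {eq_quot antipodal (A := A)}%qT x y).
exact/(@eqquotP _ _ {eq_quot antipodal (A := A)}%qT x y)/asboolP.
Qed.

Definition antipode (a : A) : A := SigSub (mem_set (symA (set_valP a))).

Lemma val_antipode a : \val (antipode a) = - \val a. Proof. by []. Qed.

Lemma antipode_continuous : continuous antipode.
Proof.
move=> a; apply: (cvg_set_type (nbhs_filter a)).
move=> U UW; exact: (@val_continuous _ A a _ (@copp (\val a) U UW)).
Qed.

Lemma antipodal_pi_continuous : continuous (@antipodal_pi W A).
Proof. exact: pi_continuous. Qed.

Lemma antipodal_pi_open (a : A) (U : set A) :
  nbhs a U -> nbhs (antipodal_pi a) (@antipodal_pi W A @` U).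
Proof.
move=> aU; have := aU; rewrite nbhsE => -[V [oV Va] VU].
exists (@antipodal_pi W A @` V); last by move=> _ [x /VU Ux <-]; exists x.
split; last by exists a.
change (open (@antipodal_pi W A @^-1` (@antipodal_pi W A @` V))).
rewrite (_ : _ @^-1` _ = V `|` antipode @^-1` V).
  by apply: openU => //; apply: open_comp => // x _; exact: antipode_continuous.
apply/seteqP; split=> [x [y Vy /antipodal_piP[e|e]]|x [Vx|Vx]].
- by left; rewrite (_ : x = y)//; apply/val_inj.
- by right; rewrite /preimage/= (_ : antipode x = y)//; apply/val_inj; rewrite val_antipode -e.
- by exists x.
- by exists (antipode x) => //; apply/antipodal_piP; right.
Qed.

Variable close : A -> A -> bool.
Hypothesis closeP : forall a : A, exists2 V : set A, nbhs a V & forall b b', V b -> V b' ->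
  [/\ close b b', ~~ close (antipode b) b', ~~ close b (antipode b') &
      close (antipode b) (antipode b')].

Lemma antipode_proj a : antipodal_pi (antipode a) = antipodal_pi a.
Proof. by apply/antipodal_piP; right. Qed.

Lemma antipode_fiber (a b : A) :
  antipodal_pi a = antipodal_pi b -> b = a \/ b = antipode a.
Proof.
move=> /antipodal_piP[e|e]; [left|right]; apply/val_inj => //.
by rewrite val_antipode e opprK.
Qed.

Lemma antipodeK : involutive antipode.
Proof. by move=> a; apply/val_inj; rewrite !val_antipode opprK. Qed.

Definition antipodal_section (x : antipodal_quotient A) : A :=
  (repr (x : {eq_quot antipodal (A := A)}))%qT.

Lemma antipodal_sectionK x : antipodal_pi (antipodal_section x) = x.
Proof. exact: reprK. Qed.

Definition antipodal_cover : double_cover A (antipodal_quotient A) :=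
  DoubleCover antipode_continuous antipodal_pi_continuous antipodal_pi_open
    antipodal_sectionK antipode_fiber antipode_proj antipodeK closeP.

End AntipodalCover.

Lemma continuous_sum (R : realType) (T : topologicalType) n (F : 'I_n -> T -> R) :
  (forall i, continuous (F i)) -> continuous (fun x => \sum_(i < n) F i x).
Proof.
elim: n F => [|n IH] F h.
  under [fun x => _]eq_fun do rewrite big_ord0.
  exact: cst_continuous.
under [fun x => _]eq_fun do rewrite big_ord_recl.
by move=> x; apply: cvgD; [exact: h|exact: (IH (fun i => F (lift ord0 i)))].
Qed.

Lemma continuous_sqrB (R : realType) (T : topologicalType) (f : T -> R) (c : R) :
  continuous f -> continuous (fun x => (f x - c) ^+ 2).
Proof.
move=> cf x; have cB : f y - c @[y --> x] --> f x - c.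
  by apply: cvgB; [exact: cf|exact: cvg_cst].
exact: (continuous_comp cB (@exprn_continuous R 2 _)).
Qed.

Lemma cvg_rV (R : realType) (I : Type) (F : set_system I) (FF : Filter F) n
    (f : I -> 'rV[R]_n) (a : 'rV[R]_n) :
  (forall j, (fun t => f t ord0 j) @ F --> a ord0 j) -> f @ F --> a.
Proof.
move=> h U [P Pn PU].
have : F (fun t => forall j, P ord0 j (f t ord0 j)).
  by apply: filter_forall => j; exact: (h j _ (Pn ord0 j)).
apply: (@filterS _ F FF) => t ht; apply: PU => i j.
by rewrite (ord1 i); exact: ht.
Qed.

(** * The infinite sphere and its antipodal double cover *)

Section RinftyNorm.
Variable R : realType.
Implicit Types x y : {poly R}.

Definition normsq x : R := \sum_(i < size x) x`_i ^+ 2.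

Lemma normsqE n x : (size x <= n)%N -> normsq x = \sum_(i < n) x`_i ^+ 2.
Proof.
move=> xn; rewrite /normsq (big_ord_widen _ (fun i => x`_i ^+ 2) xn).
rewrite [RHS](bigID (fun i : 'I_n => (i < size x)%N))/= [X in _ + X]big1 ?addr0//.
by move=> i; rewrite -leqNgt => /leq_sizeP ->//; rewrite expr0n.
Qed.

Lemma normsq_ge0 x : 0 <= normsq x.
Proof. by apply: sumr_ge0 => i _; rewrite sqr_ge0. Qed.

Lemma normsqN x : normsq (- x) = normsq x.
Proof. by rewrite /normsq size_polyN; apply: eq_bigr => i _; rewrite coefN sqrrN. Qed.

Lemma normsqZ k x : normsq (k *: x) = k ^+ 2 * normsq x.
Proof.
rewrite (@normsqE (size x) (k *: x)) ?size_scale_leq// mulr_sumr.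
by apply: eq_bigr => i _; rewrite coefZ exprMn.
Qed.

Lemma normsqD x y : normsq (x + y) <= 2 * normsq x + 2 * normsq y.
Proof.
set n := maxn (size x) (size y).
rewrite (@normsqE n (x + y)) ?size_polyD// (@normsqE n x) ?leq_maxl//.
rewrite (@normsqE n y) ?leq_maxr// !mulr_sumr -big_split/=.
apply: ler_sum => i _; rewrite coefD.
by have := sqr_ge0 (x`_i - y`_i); rewrite !expr2; lra.
Qed.

Lemma normsq_eq0 x : (normsq x == 0) = (x == 0).
Proof.
apply/idP/eqP => [|->]; last by rewrite /normsq size_poly0 big_ord0.
rewrite /normsq psumr_eq0; last by move=> i _; rewrite sqr_ge0.
move=> /allP h; apply/polyP => i; rewrite coef0.
have [xi|xi] := leqP (size x) i; first by rewrite nth_default.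
by have := h (Ordinal xi) (mem_index_enum _); rewrite sqrf_eq0 => /eqP.
Qed.

Lemma coef_rVpoly_continuous n i : continuous (fun v : 'rV[R]_n => (rVpoly v)`_i).
Proof.
rewrite (_ : (fun v => _) =
    fun v : 'rV[R]_n => if insub i is Some j then v ord0 j else 0); last first.
  by apply/funext => v; rewrite coef_rVpoly.
by case: (insub i : option 'I_n) => [j|]; [exact: coord_continuous|exact: cst_continuous].
Qed.

Lemma Rinfty_continuous (Y : topologicalType) (g : Rinfty R -> Y) :
  (forall n, continuous (fun v : 'rV[R]_n => g (rVpoly v))) -> continuous g.
Proof.
move=> h; apply/continuousP => U oU; change (Rinfty_open (g @^-1` U)) => n.
by have /continuousP := h n; apply.
Qed.

Lemma normsqB_continuous (a : Rinfty R) : continuous (fun x : Rinfty R => normsq (x - a)).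
Proof.
apply: Rinfty_continuous => n.
set m := maxn n (size (a : {poly R})).
have sE (w : 'rV[R]_n) : normsq (rVpoly w - a) = \sum_(i < m) ((rVpoly w)`_i - a`_i) ^+ 2.
  rewrite (@normsqE m).
    by apply: eq_bigr => i _; rewrite coefB.
  rewrite (leq_trans (size_polyD _ _))// size_polyN geq_max !leq_max leqnn orbT andbT.
  by rewrite size_poly.
rewrite (_ : (fun v => _) =
    fun w : 'rV[R]_n => \sum_(i < m) ((rVpoly w)`_i - a`_i) ^+ 2); last exact/funext.
apply: continuous_sum => i; apply: continuous_sqrB.
exact: coef_rVpoly_continuous.
Qed.

Lemma SinftyE (x : Rinfty R) : Sinfty R x <-> normsq x = 1.
Proof. by []. Qed.

Lemma Sinfty_sym (x : Rinfty R) : Sinfty R x -> Sinfty R (- x).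
Proof. by rewrite !SinftyE normsqN. Qed.

Lemma Rinfty_opp_continuous : continuous (-%R : Rinfty R -> Rinfty R).
Proof.
apply/continuousP => U oU; change (Rinfty_open (-%R @^-1` U)) => n.
have /continuousP/(_ _ (oU n)) : continuous (fun v : 'rV[R]_n => - v).
  move=> v; apply: (cvg_rV (nbhs_filter v)) => j.
  under eq_fun do rewrite mxE; rewrite mxE.
  by apply: cvgN; exact: coord_continuous.
rewrite [X in open X -> _](_ : _ = [set v | (-%R @^-1` U) (rVpoly v)])//.
by apply/seteqP; split=> v; rewrite /= raddfN.
Qed.

Definition Sinfty_close (a b : Sinfty R) : bool :=
  normsq ((\val a : {poly R}) - \val b) < 1.

(** By [normsqD], two points at squared distance below 1/16 from [a] are at squared distance at most
    1/4 from each other, while their sum stays near 2a, whose squared norm is 4. The threshold 1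
    separates the two cases. *)
Lemma Sinfty_closeP (a : Sinfty R) : exists2 V : set (Sinfty R), nbhs a V &
  forall b b', V b -> V b' ->
  [/\ Sinfty_close b b', ~~ Sinfty_close (antipode Sinfty_sym b) b',
    ~~ Sinfty_close b (antipode Sinfty_sym b') &
    Sinfty_close (antipode Sinfty_sym b) (antipode Sinfty_sym b')].
Proof.
exists [set b : Sinfty R | normsq ((\val b : {poly R}) - \val a) < 16^-1].
  apply/nbhs_set_typeP; exists [set x | normsq (x - \val a : {poly R}) < 16^-1] => //.
  apply: (cvgr_lt _ (@normsqB_continuous (\val a) (\val a))).
  by rewrite subrr (eqP (_ : normsq 0 == 0)) ?normsq_eq0// invr_gt0.
move=> b b' ab ab'; rewrite /Sinfty_close !val_antipode.
move: (\val a : {poly R}) (\val b : {poly R}) (\val b' : {poly R})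
  (set_valP a : normsq _ = 1) (set_valP b : normsq _ = 1) (set_valP b' : normsq _ = 1)
  (ab : normsq ((\val b : {poly R}) - (\val a : {poly R})) < 16^-1)
  (ab' : normsq ((\val b' : {poly R}) - (\val a : {poly R})) < 16^-1) => {ab ab'}.
move=> x y z x1 y1 z1 xy xz.
have yz : normsq (y - z) <= 4^-1.
  have := normsqD (y - x) (- (z - x)); rewrite normsqN opprB addrA subrK => h.
  by move: xy xz h; lra.
have yz' : 1 <= normsq (y + z).
  have := normsqD (y + z) (- ((y - x) + (z - x))); rewrite normsqN.
  have -> : y + z - (y - x + (z - x)) = 2%:R *: x.
    by rewrite scaler_nat mulr2n; ring.
  rewrite normsqZ x1; have := normsqD (y - x) (z - x); move: xy xz; rewrite expr2; lra.
split.
- by move: yz; lra.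
- by rewrite -leNgt -opprD normsqN.
- by rewrite -leNgt opprK.
- by rewrite -opprD normsqN; move: yz; lra.
Qed.

Definition RPinfty_cover : double_cover (Sinfty R) (RPinfty R) :=
  antipodal_cover Rinfty_opp_continuous Sinfty_closeP.

End RinftyNorm.

Lemma cobd_cst (X : Type) (b : bool) (l : seq X) : cobd (fun=> b) l = odd (size l) && b.
Proof.
elim: l => //= x l IH; rewrite cobd_cons [slice x _](_ : _ = fun=> b)// IH.
by case: b {IH}; case: (odd _).
Qed.

(** The two homotopies make [phi] cohomologous to the constant [k], its value on the degenerate
    simplex at [x0]. With an odd number of vertices that constant is the coboundary of a constant;
    with an even number, closedness of [phi] on the degenerate simplex with one more vertex gives
    [k] = 0. *)
Lemma contractible_acyclic (R : realType) (X : topologicalType) (f : X -> X) (x0 : X)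
    (H1 H2 : X -> R -> X) :
  (forall (x : X) (t : R), 0 <= t <= 1 -> (fun z : X * R => H1 z.1 z.2) @ (x, t) --> H1 x t) ->
  (forall (x : X) (t : R), 0 <= t <= 1 -> (fun z : X * R => H2 z.1 z.2) @ (x, t) --> H2 x t) ->
  (forall x, H1 x 0 = x) -> (forall x, H1 x 1 = f x) ->
  (forall x, H2 x 0 = f x) -> (forall x, H2 x 1 = x0) ->
  forall q phi, lzero (@setT X) q.+2 (cobd phi) -> is_reduced_coboundary q phi.
Proof.
move=> c1 c2 e10 e11 e20 e21 q phi dphi.
have [eta1 h1] := homotopy_invariance c1 dphi.
have [eta2 h2] := homotopy_invariance c2 dphi.
pose k := phi (nseq q.+1 x0).
have cst_coboundary : odd q.+1 && k = k.
  case: (boolP (odd q.+1)) => //= oq; apply/esym.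
  have [U xU hU] := dphi x0 I.
  have : cobd phi (nseq q.+2 x0) = false.
    apply: hU; first by rewrite size_nseq.
    by move=> y /nseqP[-> _]; split=> //; exact: nbhs_singleton.
  rewrite (@eq_cobd _ _ (fun=> k)); last first.
    move=> m ml; rewrite size_nseq => -[sm]; congr phi.
    by rewrite -sm; apply/all_pred1P/allP => y /ml /nseqP[->] _; rewrite /= eqxx.
  by rewrite cobd_cst size_nseq -[odd q.+2]/(~~ odd q.+1) oq.
exists (cadd (cadd eta1 eta2) (fun=> k)).
apply: lzero_ext (lzeroD h1 h2) => l sl.
rewrite !cobdD_fun /cadd cobd_cst sl cst_coboundary /pull.
have -> : map (H1^~ 0) l = l by apply: map_id_in => x _; exact: e10.
have -> : map (H1^~ 1) l = map (H2^~ 0) l by apply: eq_map => x; rewrite e11 e20.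
have -> : map (H2^~ 1) l = nseq q.+1 x0.
  by rewrite -sl; elim: (l) => //= x m ->; rewrite e21.
rewrite -/k; case: (cobd eta1 l); case: (cobd eta2 l); case: (phi l);
  by case: (phi (map _ l)); case: (k).
Qed.

Lemma continuous_normrB (R : realType) (T : topologicalType) (f : T -> R) (c : R) :
  continuous f -> continuous (fun x => `|f x - c|).
Proof.
move=> cf x; apply: cvg_norm; apply: cvgB; [exact: cf|exact: cvg_cst].
Qed.

(** * The direct limit topology of R^infinity has boxes as neighbourhoods *)

Section RinftyTopology.
Variable R : realType.

Definition box (a : Rinfty R) (e : nat -> R) : set (Rinfty R) :=
  [set y | forall i, `|(y : {poly R})`_i - (a : {poly R})`_i| < e i].

Let append n (v : 'rV[R]_n) (c : R) : 'rV[R]_n.+1 :=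
  \row_i (if unlift ord_max i is Some j then v ord0 j else c).

Let append_continuous n (v : 'rV[R]_n) (c : R) :
  (fun z : 'rV[R]_n * R => append z.1 z.2) @ (nbhs v, nbhs c) --> append v c.
Proof.
apply: cvg_rV => i; rewrite /append; under eq_fun do rewrite mxE; rewrite mxE.
case: unlift => [j|].
  move=> U vU; exists ([set w : 'rV[R]_n | U (w ord0 j)], setT); last by move=> -[w d] [].
  by split; [exact: (@coord_continuous R 1 n ord0 j v)|exact: filterT].
move=> U cU; exists (setT, U); last by move=> -[w d] [].
by split=> //; exact: filterT.
Qed.

Lemma rVpoly_append n (v : 'rV[R]_n) c : rVpoly (append v c) = rVpoly v + c *: 'X^n.
Proof.
apply/polyP => i; rewrite coefD coefZ coefXn !coef_rVpoly.
case: insubP => [j _ ji|].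
  rewrite mxE -ji; case: unliftP => [k jk|jmax].
    have -> : insub (j : nat) = Some k :> option 'I_n.
      rewrite (_ : (j : nat) = k) ?valK// jk /= /bump leqNgt ltn_ord//.
    by rewrite jk /= /bump leqNgt ltn_ord/= add0n (ltn_eqF (ltn_ord k)) mulr0 addr0.
  rewrite jmax /= eqxx mulr1 insubF ?add0r//.
  by rewrite ltnn.
rewrite ltnS -ltnNge => ni; rewrite insubF ?(gtn_eqF ni) ?mulr0 ?addr0//.
by rewrite ltnNge ltnW.
Qed.

(** Tube lemma: a compact box of R^n inside [U] can be thickened a little in the next coordinate
    without leaving [U]. *)
Let step n (U : set (Rinfty R)) (e : nat -> R) : open U ->
  (forall v : 'rV[R]_n, (forall i : 'I_n, `|v ord0 i| <= e i) -> U (rVpoly v)) ->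
  exists2 d : R, 0 < d & forall (v : 'rV[R]_n) (c : R), (forall i : 'I_n, `|v ord0 i| <= e i) ->
    `|c| <= d -> U (rVpoly v + c *: 'X^n).
Proof.
move=> oU hU.
have cK : compact [set v : 'rV[R]_n | forall i : 'I_n, `[- e i, e i]%classic (v ord0 i)].
  by apply: (@rV_compact _ n (fun i : 'I_n => `[- e i, e i]%classic)) => i; exact: segment_compact.
have /compact_near_coveringP nc := cK.
have := nc _ (nbhs (0 : R)) (fun c v => U (rVpoly v + c *: 'X^n)) _.
case=> [v vK|d /= d0 dU].
  have vU : nbhs (append v 0) [set w | U (rVpoly w)].
    apply: open_nbhs_nbhs; split; first exact: (oU n.+1).
    rewrite /= rVpoly_append scale0r addr0; apply: hU => i.
    by have := vK i; rewrite /= in_itv/= ler_norml.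
  have [[P Q] PQ0 PQ] := append_continuous vU.
  by exists (P, Q) => // -[w c] /PQ /=; rewrite rVpoly_append.
exists (d / 2); first by rewrite divr_gt0.
move=> v c ve cd; apply: (dU c) => /=.
  by rewrite sub0r normrN (le_lt_trans cd)//; move: d0; lra.
by move=> i; rewrite /= in_itv/= -ler_norml.
Qed.

Lemma box_nbhs0 (U : set (Rinfty R)) : open U -> U 0 ->
  exists2 e, (forall i, 0 < e i) & box 0 e `<=` U.
Proof.
move=> oU U0.
pose good n (s : seq R) := [/\ size s = n, forall i, (i < n)%N -> 0 < nth 0 s i &
  forall v : 'rV[R]_n, (forall i : 'I_n, `|v ord0 i| <= nth 0 s i) -> U (rVpoly v)].
have : forall s : seq R, exists d, good (size s) s -> good (size s).+1 (rcons s d).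
  move=> s; have [[_ s0 sU]|n] := pselect (good (size s) s); last by exists 0 => /n.
  have [d d0 dU] := step oU sU; exists d => _; split.
  - by rewrite size_rcons.
  - move=> i; rewrite ltnS leq_eqVlt nth_rcons => /orP[/eqP->|il].
      by rewrite ltnn eqxx.
    by rewrite il; exact: s0.
  - move=> v vs; pose w : 'rV[R]_(size s) := \row_i v ord0 (lift ord_max i).
    have -> : rVpoly v = rVpoly w + v ord0 ord_max *: 'X^(size s).
      rewrite -rVpoly_append; congr rVpoly; apply/rowP => i; rewrite mxE.
      by case: unliftP => [j ->|->]; rewrite ?mxE.
    apply: dU => [i|].
      by have := vs (lift ord_max i); rewrite mxE nth_rcons lift_max ltn_ord.
    by have := vs ord_max; rewrite nth_rcons /= ltnn eqxx.
move=> /choice[g gP].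
(* [S n] lists the first n radii and is a prefix of all later lists, so reading the entry i of
   [S i.+1] defines all radii at once. *)
pose S := fix S n := if n is m.+1 then rcons (S m) (g (S m)) else [::].
have SP n : good n (S n).
  elim: n => [|n IH].
    split=> // v _; rewrite (_ : rVpoly v = 0)//.
    by apply/polyP => i; rewrite coef_rVpoly insubF// coef0.
  by have [sn _ _] := IH; have := gP (S n); rewrite sn; apply.
have Snth n m i : (i < n)%N -> (n <= m)%N -> nth 0 (S m) i = nth 0 (S n) i.
  move=> il; elim: m => [|m IH]; first by rewrite leqn0 => /eqP->.
  rewrite leq_eqVlt => /orP[/eqP<-//|nm].
  have [sm _ _] := SP m.
  by rewrite /= nth_rcons sm (leq_trans il)// IH.
exists (fun i => nth 0 (S i.+1) i) => [i|y yb].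
  by have [_ h _] := SP i.+1; exact: (h i (ltnSn i)).
have [_ _ sU] := SP (size (y : {poly R})).
rewrite -[y](@poly_rV_K _ (size (y : {poly R})) y)//; apply: sU => i.
rewrite mxE (Snth i.+1)//.
by apply: ltW; have := yb i; rewrite coef0 subr0.
Qed.

Lemma translate_open (a : Rinfty R) (U : set (Rinfty R)) : open U -> open [set y | U (a + y)].
Proof.
move=> oU; change (Rinfty_open [set y | U (a + y)]) => n.
pose m := maxn n (size (a : {poly R})).
pose T (v : 'rV[R]_n) : 'rV[R]_m := poly_rV ((a : {poly R}) + rVpoly v).
have cT : continuous T.
  move=> v; apply: (cvg_rV (nbhs_filter v)) => j; rewrite /T.
  under eq_fun do rewrite mxE coefD; rewrite mxE coefD.
  by apply: cvgD; [exact: cvg_cst|exact: coef_rVpoly_continuous].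
have /continuousP/(_ _ (oU m)) := cT.
congr (open _); apply/seteqP; split=> v /=; rewrite poly_rV_K//;
  by rewrite (leq_trans (size_polyD _ _))// geq_max leq_maxr (leq_trans (size_poly _ _))// leq_maxl.
Qed.

(** For a countable limit of locally compact spaces the limit and box topologies agree. Boxes make
    the joint continuity of the vector operations a coordinatewise estimate. *)
Lemma nbhs_boxP (a : Rinfty R) (U : set (Rinfty R)) :
  nbhs a U <-> exists2 e, (forall i, 0 < e i) & box a e `<=` U.
Proof.
rewrite nbhsE; split=> [[V [oV Va] VU]|[e e0 eU]].
  have [||e e0 eV] := @box_nbhs0 [set y | V (a + y)].
  - exact: translate_open.
  - by rewrite /= addr0.
  exists e => // y ya; apply: VU; rewrite -[y](subrKC a); apply: eV => i.
  by rewrite coef0 subr0 coefB; exact: ya.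
exists (box a e) => //; split; last by move=> i; rewrite subrr normr0.
change (Rinfty_open (box a e)) => n; rewrite openE => v vb.
pose m := maxn n (size (a : {poly R})).
have : \forall w \near v, forall i : 'I_m, `|(rVpoly w)`_i - a`_i| < e i.
  apply: (@filter_forall _ _ _ (nbhs v) (nbhs_filter v)) => i.
  exact: (cvgr_lt _ (@continuous_normrB _ _ _ _ (@coef_rVpoly_continuous R n i) v) _ (vb i)).
apply: (@filterS _ (nbhs v) (nbhs_filter v)) => w wb i.
have [im|im] := ltnP i m; first exact: (wb (Ordinal im)).
rewrite !nth_default ?subrr ?normr0//.
  by rewrite (leq_trans _ im)// leq_maxr.
by rewrite (leq_trans (size_poly _ _))// (leq_trans _ im)// leq_maxl.
Qed.

Section RinftyLimits.
Variables (I : Type) (F : set_system I) (FF : Filter F).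
Implicit Types (f g : I -> Rinfty R) (k : I -> R).

Lemma cvgD_Rinfty f g (a b : Rinfty R) :
  f @ F --> a -> g @ F --> b -> (fun i => f i + g i) @ F --> a + b.
Proof.
move=> fa gb U /nbhs_boxP[e e0 eU].
have e2 i : 0 < e i / 2 by rewrite divr_gt0.
have Bf : nbhs a (box a (fun i => e i / 2)) by apply/nbhs_boxP; exists (fun i => e i / 2).
have Bg : nbhs b (box b (fun i => e i / 2)) by apply/nbhs_boxP; exists (fun i => e i / 2).
apply: (@filterS2 _ F FF _ _ _ _ (fa _ Bf) (gb _ Bg)) => i /= fi gi.
apply: eU => j; rewrite !coefD opprD addrACA (le_lt_trans (ler_normD _ _))//.
by have := fi j; have := gi j; move: (e j) => d; lra.
Qed.

Lemma cvgZ_Rinfty k f (c : R) (a : Rinfty R) :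
  k @ F --> c -> f @ F --> a -> (fun i => k i *: (f i : {poly R}) : Rinfty R) @ F --> (c *: (a : {poly R}) : Rinfty R).
Proof.
move=> kc fa U /nbhs_boxP[e e0 eU].
pose M := `|c| + 1; have M0 : 0 < M by rewrite ltr_wpDl.
have e2 i : 0 < e i / (2 * M) by rewrite divr_gt0 ?mulr_gt0.
have Bf : nbhs a (box a (fun i => e i / (2 * M))).
  by apply/nbhs_boxP; exists (fun i => e i / (2 * M)).
(* Only finitely many coefficients of [a] are nonzero, so one condition on [k t] handles all of
   them. *)
have Bk : F (fun t => forall i : 'I_(size (a : {poly R})), `|k t - c| * `|a`_i| < e i / 2).
  apply: filter_forall => i.
  have n0 : 0 < `|a`_i| + 1 by rewrite ltr_wpDl.
  have H := cvgr_dist_lt k c kc _ (divr_gt0 (divr_gt0 (e0 i) (ltr0Sn _ 1)) n0).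
  apply: (@filterS _ F FF _ _ _ (H FF)) => t; rewrite ltr_pdivlMr// distrC => h.
  by apply: le_lt_trans h; rewrite ler_wpM2l// lerDl.
have Bk1 : F (fun t => `|k t - c| < 1).
  by apply: (@filterS _ F FF _ _ _ (@cvgr_dist_lt _ _ _ F FF k c kc _ ltr01)) => t; rewrite distrC.
apply: (@filterS3 _ F FF _ _ _ _ _ (fa _ Bf) Bk Bk1) => t /= ft kt kt1.
apply: eU => j; rewrite !coefZ.
rewrite (_ : _ - _ = k t * ((f t : {poly R})`_j - a`_j) + (k t - c) * a`_j); last by ring.
rewrite (le_lt_trans (ler_normD _ _))// !normrM.
have kM : `|k t| <= M.
  by have := ler_normD (k t - c) c; rewrite subrK /M; lra.
have h1 : `|k t| * `|(f t : {poly R})`_j - a`_j| <= e j / 2.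
  have := ft j; rewrite ltr_pdivlMr ?mulr_gt0// => h.
  have : `|k t| * `|(f t : {poly R})`_j - a`_j| <= M * `|(f t : {poly R})`_j - a`_j|.
    by rewrite ler_wpM2r.
  move: h; lra.
have h2 : `|k t - c| * `|a`_j| < e j / 2.
  have [jl|jl] := ltnP j (size (a : {poly R})); first exact: (kt (Ordinal jl)).
  by rewrite [a`_j]nth_default// normr0 mulr0 divr_gt0.
by move: h1 h2; lra.
Qed.

Lemma cvgMX_Rinfty f (a : Rinfty R) : f @ F --> a ->
  (fun i => 'X * (f i : {poly R}) : Rinfty R) @ F --> ('X * (a : {poly R}) : Rinfty R).
Proof.
move=> fa U /nbhs_boxP[e e0 eU].
have B : nbhs a (box a (fun i => e i.+1)) by apply/nbhs_boxP; exists (fun i => e i.+1).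
apply: (@filterS _ F FF _ _ _ (fa _ B)) => t ft; apply: eU => -[|j].
  by rewrite !coefXM/= subrr normr0.
by rewrite !coefXM /=; exact: ft.
Qed.

End RinftyLimits.

End RinftyTopology.

(** * The infinite sphere and the cohomological index *)

Lemma cvg_val_fst (X Y : topologicalType) (A : set X) (x : A) (y : Y) :
  (fun z : A * Y => \val z.1) @ (x, y) --> \val x.
Proof.
move=> U xU; exists ((fun a : A => \val a) @^-1` U, setT); last by move=> z [].
by split; [exact: (@val_continuous X A x U xU)|exact: filterT].
Qed.

Section SinftyContractible.
Variable R : realType.

Fact Sinfty_one : Sinfty R (1 : {poly R}).
Proof. by rewrite SinftyE /normsq size_poly1 big_ord1 coefC eqxx expr1n. Qed.

Definition unit_vector (y : Rinfty R) : Rinfty R :=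
  (Num.sqrt (normsq y))^-1 *: (y : {poly R}).

(** The default point is taken only at [y] = 0. *)
Definition Sinfty_of (y : Rinfty R) : Sinfty R :=
  if pselect (Sinfty R (unit_vector y)) is left h then SigSub (mem_set h)
  else SigSub (mem_set Sinfty_one).

Lemma val_Sinfty_of (y : Rinfty R) : y != 0 -> \val (Sinfty_of y) = unit_vector y.
Proof.
move=> y0; rewrite /Sinfty_of; case: pselect => // -[].
rewrite SinftyE normsqZ exprVn sqr_sqrtr ?normsq_ge0// mulVf//.
by rewrite normsq_eq0.
Qed.

Lemma Sinfty_of_val (x : Sinfty R) : Sinfty_of (\val x) = x.
Proof.
have x1 : normsq (\val x : {poly R}) = 1 := set_valP x.
apply/val_inj; rewrite val_Sinfty_of /unit_vector ?x1 ?sqrtr1 ?invr1 ?scale1r//.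
by apply/eqP => x0; move: x1 => /eqP; rewrite x0 /normsq size_poly0 big_ord0 eq_sym oner_eq0.
Qed.

Lemma Sinfty_of_opp (y : Rinfty R) : y != 0 ->
  \val (Sinfty_of (- y)) = - \val (Sinfty_of y).
Proof.
by move=> y0; rewrite !val_Sinfty_of ?oppr_eq0// /unit_vector normsqN scalerN.
Qed.

Lemma cvg_Sinfty_of (I : Type) (F : set_system I) (FF : Filter F)
    (f : I -> Rinfty R) (y : Rinfty R) :
  f @ F --> y -> y != 0 -> (forall i, f i != 0) ->
  (fun i => Sinfty_of (f i)) @ F --> Sinfty_of y.
Proof.
move=> fy y0 f0; apply: (cvg_set_type FF).
rewrite val_Sinfty_of//.
rewrite (_ : (fun i => _) = fun i => unit_vector (f i)); last first.
  by apply/funext => i; rewrite val_Sinfty_of.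
apply: (cvgZ_Rinfty FF) => //; apply: cvgV.
  by rewrite sqrtr_eq0 -ltNge lt_neqAle normsq_ge0 eq_sym normsq_eq0 y0.
have nc : continuous (fun x : Rinfty R => normsq x).
  rewrite (_ : (fun x => _) = fun x : Rinfty R => normsq (x - (0 : Rinfty R))).
    exact: normsqB_continuous.
  by apply/funext => x; congr normsq; apply/esym; exact: subr0.
have h := cvg_comp _ _ fy (nc y).
exact: (cvg_comp _ _ h (@sqrt_continuous R (normsq y))).
Qed.

(** The classical contraction of the infinite sphere: slide x to its right shift 'X x, then slide 'X
    x to the vector 1. Neither segment meets 0: the first is x times the nonzero polynomial (1-t) +
    t 'X, and the second has constant coefficient t. *)
Let shift (x : Sinfty R) (t : R) : Rinfty R :=
  ((1 - t) *: (\val x : {poly R}) + t *: ('X * (\val x : {poly R})))%R.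
Let toward_one (x : Sinfty R) (t : R) : Rinfty R :=
  ((1 - t) *: ('X * (\val x : {poly R})) + t *: 1)%R.

Let val_neq0 (x : Sinfty R) : (\val x : {poly R}) != 0.
Proof.
apply/eqP => x0; have : normsq (\val x : {poly R}) = 1 := set_valP x.
by move=> /eqP; rewrite x0 /normsq size_poly0 big_ord0 eq_sym oner_eq0.
Qed.

Let shift_neq0 x t : shift x t != 0.
Proof.
rewrite /shift -mul_polyC -[t *: _]mul_polyC mulrA -mulrDl mulf_neq0//.
apply/eqP => e.
have /polyP/(_ 1%N) := e; have /polyP/(_ 0%N) := e.
rewrite !coefD !coefMX !coefC/= addr0 add0r => /eqP; rewrite subr_eq0 => /eqP <-.
by move/eqP; rewrite oner_eq0.
Qed.

Let toward_one_neq0 x t : toward_one x t != 0.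
Proof.
rewrite /toward_one; have [->|t0] := eqVneq t 0.
  by rewrite subr0 scale1r scale0r addr0 mulf_neq0// polyX_eq0.
apply/eqP => /polyP/(_ 0%N); rewrite coefD !coefZ coefXM coef1 /= mulr0 add0r mulr1 coef0 => /eqP.
exact/negP.
Qed.

Lemma Sinfty_acyclic q phi :
  lzero (@setT (Sinfty R)) q.+2 (cobd phi) -> is_reduced_coboundary q phi.
Proof.
apply: (@contractible_acyclic R (Sinfty R) (fun x => Sinfty_of (shift x 1))
  (Sinfty_of (1 : {poly R})) (fun x t => Sinfty_of (shift x t))
  (fun x t => Sinfty_of (toward_one x t))) => [x t _|x t _|x|//|x|x].
- have F : Filter (nbhs (x, t)) := nbhs_filter (x, t).
  apply: (cvg_Sinfty_of F) => //.
  have vx : (fun z : Sinfty R * R => \val z.1) @ (x, t) --> \val x.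
    exact: cvg_val_fst.
  have vt : (fun z : Sinfty R * R => z.2) @ (x, t) --> t by exact: cvg_snd.
  apply: (cvgD_Rinfty F); apply: (cvgZ_Rinfty F) => //; last exact: (cvgMX_Rinfty F).
  by apply: cvgB => //; exact: cvg_cst.
- have F : Filter (nbhs (x, t)) := nbhs_filter (x, t).
  apply: (cvg_Sinfty_of F) => //.
  have vx : (fun z : Sinfty R * R => \val z.1) @ (x, t) --> \val x.
    exact: cvg_val_fst.
  have vt : (fun z : Sinfty R * R => z.2) @ (x, t) --> t by exact: cvg_snd.
  apply: (cvgD_Rinfty F); apply: (cvgZ_Rinfty F) => //; last exact: cvg_cst.
    by apply: cvgB => //; exact: cvg_cst.
  exact: (cvgMX_Rinfty F).
- by rewrite /shift subr0 scale1r scale0r addr0 Sinfty_of_val.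
- by rewrite /shift /toward_one subrr subr0 !scale0r add0r addr0 !scale1r.
- by rewrite /toward_one subrr scale0r scale1r add0r.
Qed.

Definition RPinfty_class : cohomology (RPinfty R) 1 :=
  class_of_list (is_cocycle_dc (RPinfty_cover R)).

Let b0 : RPinfty R := antipodal_pi (Sinfty_of (1 : {poly R})).

(** The sphere is acyclic, so [dc_power_generates] gives the existence of the coefficient and
    [dc_power_neq0] its uniqueness. *)
Lemma RPinfty_class_generates : polynomial_generator RPinfty_class.
Proof.
move=> q x; have [xi [xic ->]] := class_of_list_surj x.
rewrite (@cup_power_class _ _ _ (is_cocycle_dc (RPinfty_cover R)) q erefl).
set c := class_of_list (is_cocycle_power _ _).
have c0 : c <> 0.
  move=> /class_of_list_eq0.
  exact: (dc_power_neq0 Sinfty_acyclic b0).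
have [b hb] := dc_power_generates (RPinfty_cover R) (@Sinfty_acyclic) xic.
exists b; split=> [|b' xb'].
  case: b hb => hb.
    by rewrite mulr1n; apply/class_of_list_eq.
  rewrite mulr0n; apply/class_of_list_eq0.
  have [eta [? ? e]] := hb; exists eta; split=> //.
  by apply: lzero_ext e => l _; rewrite /cadd addbF.
have : class_of_list xic = c *+ b.
  case: b hb => hb.
    by rewrite mulr1n; apply/class_of_list_eq.
  rewrite mulr0n; apply/class_of_list_eq0.
  have [eta [? ? e]] := hb; exists eta; split=> //.
  by apply: lzero_ext e => l _; rewrite /cadd addbF.
rewrite xb'; case: (b); case: (b') => //; rewrite mulr0n mulr1n => e; exfalso;
  by [exact/c0/esym/e|exact/c0/e].
Qed.

(** In degree 1 the only classes are 0 and the class of the cover, and 0 does not generate. *)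
Lemma RPinfty_class_unique w : polynomial_generator w -> w = RPinfty_class.
Proof.
have cup1E (v : cohomology (RPinfty R) 1) : cup_power v 1 = v.
  have [xi [h e]] := class_of_list_surj v.
  rewrite (cup_power_class 1 e) e; apply/class_of_list_eq.
  apply: is_coboundary_lzero; apply: lzero_ext (@lzero0 _ setT 2) => -[|a [|b [|]]]// _.
  by rewrite /cadd /= andbT addbb.
move=> wg; have [b [wb _]] := wg 1%N RPinfty_class; rewrite cup1E in wb.
case: b wb => [->//|]; rewrite mulr0n => w0.
have [b [_ bu]] := RPinfty_class_generates (0 : cohomology (RPinfty R) 1).
have := bu true; have := bu false; rewrite cup1E w0 !mul0rn => -> // /(_ erefl).
by [].
Qed.

End SinftyContractible.

Section IndexCover.
Variables (R : realType) (W : PreTopologicalZmodule.type) (A : set W).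
Hypothesis copp : continuous (-%R : W -> W).
Hypothesis symA : forall x, A x -> A (- x).

Definition odd_map (F : A -> Sinfty R) : Prop :=
  forall x y, \val x = - \val y -> \val (F x) = - \val (F y).

Variable F : A -> Sinfty R.
Hypothesis cF : continuous F.
Hypothesis oF : odd_map F.

Lemma odd_map_antipode (a : A) : F (antipode symA a) = antipode (@Sinfty_sym R) (F a).
Proof. by apply/val_inj; rewrite val_antipode; apply: oF. Qed.

Lemma odd_map_closeP (a : A) : exists2 V : set A, nbhs a V & forall b b', V b -> V b' ->
  [/\ Sinfty_close (F b) (F b'), ~~ Sinfty_close (F (antipode symA b)) (F b'),
      ~~ Sinfty_close (F b) (F (antipode symA b')) &
      Sinfty_close (F (antipode symA b)) (F (antipode symA b'))].
Proof.
have [V FV VP] := Sinfty_closeP (F a); exists (F @^-1` V); first exact: cF.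
by move=> b b' Vb Vb'; rewrite !odd_map_antipode; exact: VP.
Qed.

(** Nearby sheets are told apart by pulling back the closeness relation of the sphere along [F]. *)
Definition odd_map_cover : double_cover A (antipodal_quotient A) :=
  antipodal_cover copp odd_map_closeP.

Definition classify (x : antipodal_quotient A) : RPinfty R :=
  antipodal_pi (F (antipodal_section x)).

Lemma classify_pi (a : A) : classify (antipodal_pi a) = antipodal_pi (F a).
Proof.
have := antipodal_sectionK (antipodal_pi a) => /antipodal_piP[e|e].
  by rewrite /classify (_ : antipodal_section _ = a)//; exact/val_inj.
by apply/antipodal_piP; right; exact: oF.
Qed.

Lemma classify_continuous : continuous classify.
Proof.
apply/quotient_continuous => a.
rewrite (_ : _ \o _ = @antipodal_pi _ _ \o F); last first.
  by apply/funext => b /=; exact: classify_pi.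
exact: (continuous_comp (@cF a) (@antipodal_pi_continuous _ _ (F a))).
Qed.

Lemma classifying_map_natural (f : antipodal_quotient A -> RPinfty R) :
  (forall a, f (antipodal_pi a) = antipodal_pi (F a)) ->
  is_coboundary set0 1
    (cadd (pull f (dc_cocycle (RPinfty_cover R))) (dc_cocycle odd_map_cover)).
Proof.
move=> fF; apply: (@dc_cocycle_natural _ _ _ _ odd_map_cover (RPinfty_cover R) F f) => //.
exact: odd_map_antipode.
Qed.

(** A classifying map pulls the generator back to the class of the cover of [A], so the vanishing of
    its powers can be tested on [A] itself. *)
Lemma pullback_power (f : antipodal_quotient A -> RPinfty R) (cf : continuous f) m :
  (forall a, f (antipodal_pi a) = antipodal_pi (F a)) ->
  pullback cf (cup_power (RPinfty_class R) m) = 0 <->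
  is_coboundary set0 m (cup1_power (dc_cocycle odd_map_cover) m).
Proof.
move=> fF.
rewrite (pullback_class cf (@cup_power_class _ _ _ (is_cocycle_dc (RPinfty_cover R)) m erefl)).
rewrite class_of_list_eq0.
have e1 : is_coboundary set0 m (cadd (pull f (cup1_power (dc_cocycle (RPinfty_cover R)) m))
   (cup1_power (dc_cocycle odd_map_cover) m)).
  have c := is_cocycle_pull cf (is_cocycle_dc (RPinfty_cover R)).
  have [eta [? ? e]] := is_coboundary_power m c (is_cocycle_dc odd_map_cover)
    (classifying_map_natural fF).
  by exists eta; split=> //; apply: lzero_ext e => l _; rewrite /cadd pull_power.
exact: is_coboundary_cadd.
Qed.

Lemma cohomological_index_ge (k : nat) : A !=set0 ->
  ~ is_coboundary set0 k (cup1_power (dc_cocycle odd_map_cover) k) ->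
  (k.+1%:R%:E <= cohomological_index R A)%E.
Proof.
move=> [a Aa] nk; rewrite /cohomological_index asboolF; last first.
  by move=> A0; move: Aa; rewrite A0.
apply: ereal_sup_ubound; exists k.+1 => //; split=> //.
exists classify, classify_continuous, (RPinfty_class R); split.
- by exists F; split=> //; exact: classify_pi.
- exact: RPinfty_class_generates.
- by move=> /(pullback_power _ _ classify_pi).
Qed.

End IndexCover.

(** If every admissible m were at most k, the supremum would be too; so some power of exponent at
    least k is nonzero on the quotient, and hence so is the k-th power. *)
Lemma cohomological_index_geP (R : realType) (W : PreTopologicalZmodule.type) (A : set W)
    (copp : continuous (-%R : W -> W)) (symA : forall x, A x -> A (- x)) (k : nat) :
  (k.+1%:R%:E <= cohomological_index R A)%E ->
  A !=set0 /\ exists (F : A -> Sinfty R) (cF : continuous F) (oF : odd_map F),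
    ~ is_coboundary set0 k (cup1_power (dc_cocycle (odd_map_cover copp symA cF oF)) k).
Proof.
rewrite /cohomological_index; case: asboolP => A0 h.
  by move: h; rewrite lee_fin lern0.
split; first exact/set0P/eqP.
have [m [m0 [f [cf [w [[F [cF oF fF]] wg w0]]]]] km] : exists2 m, ((0 < m)%N /\
    exists (f : antipodal_quotient A -> RPinfty R) (cf : continuous f)
           (w : cohomology (RPinfty R) 1),
      [/\ classifying_map f, polynomial_generator w &
          pullback cf (cup_power w m.-1) <> 0]) & (k < m)%N.
  apply: contrapT => hn; move: h; apply/negP; rewrite -ltNge.
  apply: (@le_lt_trans _ _ k%:R%:E); last by rewrite lte_fin ltr_nat.
  apply: ge_ereal_sup => _ [m mP <-]; rewrite lee_fin ler_nat leqNgt.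
  by apply/negP => km; apply: hn; exists m.
exists F, cF, oF => hk.
apply: w0; rewrite (RPinfty_class_unique wg).
apply/(pullback_power copp symA cF oF cf m.-1 fF).
apply: is_coboundary_power_le hk; last exact: is_cocycle_dc.
by rewrite -ltnS prednK.
Qed.

(** * Critical groups *)

Lemma isomorphic_trivial (G H : zmodType) :
  (forall x : G, x = 0) -> (forall y : H, y = 0) -> isomorphic G H.
Proof.
move=> G0 H0; apply: (@isomorphic_of_bij G H (fun=> 0)) => [x y|x y _|y].
- by rewrite subrr.
- by rewrite (G0 x) (G0 y).
- by exists 0; rewrite (H0 y).
Qed.

Lemma lzero_val (X : topologicalType) (A : set X) q (psi : seq X -> bool) :
  lzero A q psi <-> lzero setT q (pull (fun a : A => \val a) psi).
Proof.
split=> [h a _|h x Ax].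
  have [U aU hU] := h (\val a) (set_valP a).
  exists ((fun b : A => \val b) @^-1` U); first exact: val_continuous.
  move=> l sl lU; apply: hU; first by rewrite size_map.
  by move=> _ /mapP[b /lU[_ Ub] ->]; split=> //; exact: (set_valP b).
pose a : A := SigSub (mem_set Ax).
have [U /nbhs_set_typeP[V aV VU] hU] := h a I.
exists V => // l sl lV.
have [m ml] : exists m : seq A, map (fun b : A => \val b) m = l.
  elim: l {sl} lV => [|y l IH] lV; first by exists [::].
  have [|m ml] := IH; first by move=> z zl; apply: lV; rewrite inE zl orbT.
  have [Ay _] := lV y (mem_head _ _).
  by exists (SigSub (mem_set Ay) :: m); rewrite /= ml.
rewrite -ml; apply: hU; first by rewrite -sl -ml size_map.
move=> b bm; split=> //; apply: VU => /=.
have [|_ //] := lV (\val b).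
by rewrite -ml; apply/mapP; exists b.
Qed.

Section OnePoint.
Variables (X : topologicalType) (A : set X) (x0 : X).
Hypothesis Xx0 : forall x, x = x0.
Hypothesis A0 : forall x, ~ A x.
Hypothesis acyclicX : forall q (phi : seq X -> bool),
  lzero setT q.+2 (cobd phi) -> is_reduced_coboundary q phi.

(** Evaluation at the point in degree 0; acyclicity in positive degree. *)
Lemma one_point_cohomology l : isomorphic (cohomology_pair A l) 'rV['F_2]_(l == 0%N).
Proof.
have allz q (phi : cochain X q) : locally_zero setT phi <-> phi (fun=> x0) = 0.
  split=> [h|e].
    by have [U xU hU] := h x0 I; apply: hU => i; split=> //; exact: nbhs_singleton.
  move=> x _; exists setT; first exact: filterT.
  by move=> s _; rewrite (_ : s = fun=> x0)//; apply/funext => i; exact: Xx0.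
have A0z q (phi : cochain X q) : locally_zero A phi by move=> x /A0.
case: l => [|l].
  pose f (c : cohomology_pair A 0) : 'rV['F_2]_1 := const_mx ((subquotient_repr c : cochain X 0) (fun=> x0)).
  apply: (@isomorphic_of_bij _ _ f).
  - move=> c d; apply/rowP => i; rewrite !mxE.
    have : subquotient_repr (c - d) - (subquotient_repr c - subquotient_repr d) \in coboundary A 0.
      apply/(subquotient_class_eq _ (subquotient_reprP _)
        (rpredB (subquotient_reprP c) (subquotient_reprP d))).
      rewrite subquotient_reprK -(subquotient_classB _ (subquotient_reprP c) (subquotient_reprP d)).
      by rewrite !subquotient_reprK.
    move=> /set_mem/allz; rewrite [LHS](_ : _ = (subquotient_repr (c - d) : cochain X 0) (fun=> x0) -
      ((subquotient_repr c : cochain X 0) (fun=> x0) - (subquotient_repr d : cochain X 0) (fun=> x0)))//.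
    by move=> /eqP; rewrite subr_eq0 => /eqP.
  - move=> c d /rowP/(_ 0); rewrite !mxE => e.
    rewrite -(subquotient_reprK c) -(subquotient_reprK d); apply/subquotient_class_eq.
    rewrite inE; apply/allz.
    by rewrite [LHS](_ : _ = (subquotient_repr c : cochain X 0) (fun=> x0) -
      (subquotient_repr d : cochain X 0) (fun=> x0))// e subrr.
  - move=> v; pose phi : cochain X 0 := fun=> v 0 0.
    have phic : phi \in cocycle A 0.
      rewrite inE; split=> //; apply/allz.
      by rewrite /codiff !big_ord_recl big_ord0 addr0/=; apply: addrr_pchar2; exact: pchar_Fp.
    exists (subquotient_class _ phic); apply/rowP => i; rewrite mxE.
    have /set_mem/allz := subquotient_repr_class (coboundary A 0) phic.
    rewrite [LHS](_ : _ = (subquotient_repr (subquotient_class (coboundary A 0) phic) : cochain X 0) (fun=> x0)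
       - v 0 0)// => /eqP; rewrite subr_eq0 => /eqP ->.
    by rewrite !ord1.
apply: isomorphic_trivial => [c|v]; last by apply/rowP => -[].
have [psi [h ->]] := class_of_list_surj c; apply/class_of_list_eq0.
have [_ /acyclicX[eta e]] := h.
by exists eta; split=> // x /A0.
Qed.

End OnePoint.

Section RelativeCohomology.
(* [f : Y -> X] and [r] make [Y] a deformation retract of [A], up to the
   values of [r] outside [A]; [X] is acyclic *)
Variables (R : realType) (X Y : topologicalType) (A : set X) (r : X -> Y) (f : Y -> X).
Hypothesis acyclicX : forall q (phi : seq X -> bool),
  lzero setT q.+2 (cobd phi) -> is_reduced_coboundary q phi.
Hypothesis cr : continuous (fun a : A => r (\val a)).
Hypothesis cf : continuous f.
Hypothesis fA : forall i, A (f i).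
Hypothesis fK : forall i, r (f i) = i.
Variable H : A -> R -> A.
Hypothesis cH : forall (x : A) (t : R), 0 <= t <= 1 ->
  (fun z : A * R => H z.1 z.2) @ (x, t) --> H x t.
Hypothesis H0 : forall a, H a 0 = a.
Hypothesis H1 : forall a, \val (H a 1) = f (r (\val a)).
Variable i0 : Y.

(** The connecting homomorphism, computed by extending a cochain from [A] to [X] along [r]. The
    values of [r] off [A] may jump, since cochains are arbitrary functions. *)
Let connecting q (phi : cochain Y q) : cochain X q.+1 := codiff (cochain_pullback r phi).

Let connectingE q (psi : seq Y -> bool) :
  connecting (of_list q psi) = of_list q.+1 (cobd (pull r psi)).
Proof. by rewrite /connecting pullback_of_list codiff_of_list. Qed.

Let lzero_r q psi : lzero setT q psi -> lzero A q (pull r psi).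
Proof.
move=> h; apply/lzero_val; have := lzero_pull cr h.
by apply: lzero_ext => l _; rewrite /pull -map_comp.
Qed.

Let lzero_f q psi : lzero A q psi -> lzero setT q (pull f psi).
Proof.
move=> h i _; have [U fU hU] := h (f i) (fA i); exists (f @^-1` U); first exact: cf.
move=> l sl lU; apply: hU; first by rewrite size_map.
by move=> _ /mapP[j /lU[_ jU] ->]; split=> //; exact: fA.
Qed.

Let cobdK_fun (S : Type) (psi : seq S -> bool) : cobd (cobd psi) = fun=> false.
Proof. by apply/funext => l; rewrite cobdK. Qed.

Let cobd_pull_fun (S S' : Type) (g : S -> S') (psi : seq S' -> bool) :
  cobd (pull g psi) = pull g (cobd psi).
Proof. by apply/funext => l; rewrite cobd_pull. Qed.

(** Injectivity: if the coboundary of the extension of psi is d eta with eta zero on [A], then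
    extension plus eta is closed on the acyclic [X], and its primitive pulled back along [f] is a
    primitive of psi. Surjectivity: a relative cocycle has a primitive zeta on [X], closed on [A],
    where the homotopy replaces it by the pull-back of its restriction along [f]. *)
Lemma relative_cohomology q :
  isomorphic (cohomology_pair A q.+1) (reduced_cohomology Y (Posz q)).
Proof.
apply: isomorphic_sym.
apply: (@isomorphic_subquotient _ _ _ _ _ _ (@connecting q)).
- move=> phi psi; rewrite /connecting -codiffB; congr codiff.
- move=> phi; rewrite -(to_listK phi); move: (to_list phi) => psi.
  rewrite connectingE => /cocycle_of_list/is_cocycle_set0 dpsi.
  apply/cocycle_of_list; split; last by rewrite cobdK_fun; exact: lzero0.
  by rewrite cobd_pull_fun; exact: lzero_r.
- move=> phi; rewrite -(to_listK phi); move: (to_list phi) => psi.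
  rewrite connectingE => _; rewrite coboundary_of_list reduced_coboundary_of_list.
  split=> [[eta [_ etaA e]]|[eta e]].
    rewrite -cobdD_fun in e; have [zeta ez] := acyclicX e.
    exists (pull f zeta).
    have hz := lzero_pull cf ez.
    apply: lzero_ext (lzeroD hz (lzero_f etaA)) => l _.
    rewrite cobd_pull_fun /cadd /pull -map_comp (_ : map (r \o f) l = l).
      by case: (psi l); case: (eta _); case: (cobd _ _).
    by apply: map_id_in => i _ /=; exact: fK.
  exists (cadd (pull r psi) (cobd (pull r eta))); split=> //.
    apply: lzero_ext (lzero_r e) => l _.
    by rewrite cobd_pull_fun.
  by apply: lzero_ext (@lzero0 _ setT _) => l _; rewrite cobdD_fun cobdK_fun /cadd addbF addbb.
- move=> phi; rewrite -(to_listK phi); move: (to_list phi) => chi.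
  move=> /cocycle_of_list[chiA dchi].
  have [zeta ez] := acyclicX dchi.
  have dz : lzero A q.+2 (cobd zeta).
    apply: lzero_ext (lzeroD chiA (lzero_subset (@subsetT _ A) ez)) => l _.
    by rewrite /cadd addbA addbb.
  exists (of_list q (pull f zeta)).
    apply/cocycle_of_list/is_cocycle_set0; rewrite cobd_pull_fun.
    exact: lzero_f.
  rewrite connectingE of_listB; apply/coboundary_of_list.
  have /lzero_val dz0 := dz; rewrite -cobd_pull_fun in dz0.
  have [eta he] := homotopy_invariance cH dz0.
  (* The primitive given by the homotopy lives on the subspace [A]. Composing with any map of sets
     from [X] to [A] that fixes [A] makes it a cochain on [X], and its coboundary is closed whatever
     the values off [A]. *)
  pose toA (x : X) : A := if pselect (A x) is left h then SigSub (mem_set h)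
    else SigSub (mem_set (fA i0)).
  have toAK (a : A) : toA (\val a) = a.
    rewrite /toA; case: pselect => [h|[]]; last exact: (set_valP a).
    exact/val_inj.
  exists (cadd (cadd zeta (pull r (pull f zeta))) (cobd (pull toA eta))); split=> //.
    apply/lzero_val; apply: lzero_ext he => l _.
    rewrite !cobd_pull_fun /cadd /pull -!map_comp.
    have -> : map (toA \o (fun a : A => \val a)) l = l.
      by apply: map_id_in => a _; exact: toAK.
    have -> : map ((fun a : A => \val a) \o H^~ 0) l = map (fun a : A => \val a) l.
      by apply: eq_map => a /=; rewrite H0.
    have -> : map ((fun a : A => \val a) \o H^~ 1) l =
        map (f \o (r \o (fun a : A => \val a))) l.
      by apply: eq_map => a /=; rewrite H1.
    by rewrite addbC.
  apply: lzero_ext ez => l _.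
  rewrite !cobdD_fun cobdK_fun /cadd addbF.
  by case: (chi l); case: (cobd _ _); case: (cobd _ _).
Qed.

(** On the acyclic [X] a closed 0-cochain is the constant [eta [::]]; vanishing on the nonempty [A]
    makes it zero. *)
Lemma relative_cohomology0 (c : cohomology_pair A 0) : c = 0.
Proof.
have [psi [h ->]] := class_of_list_surj c; apply/class_of_list_eq0.
have [psiA /acyclicX[eta e]] := h.
have eta0 : eta [::] = false.
  have [U xU hU] := e (f i0) I; have [V xV hV] := psiA (f i0) (fA i0).
  have x1 (y : X) : y \in [:: f i0] -> y = f i0 by rewrite inE => /eqP.
  have := hU [:: f i0] erefl; rewrite /cadd cobd_cons hV//; last first.
    by move=> y /x1 ->; split; [exact: fA|exact: nbhs_singleton].
  rewrite addbF /= => -> // y /x1 ->; split=> //; exact: nbhs_singleton.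
exists eta; split=> //; move=> x Ax; exists setT; first exact: filterT.
by move=> [|]// _ _.
Qed.

Lemma reduced_cohomologyN1 (c : reduced_cohomology Y (Negz 0)) : c = 0.
Proof.
rewrite -(subquotient_reprK c); apply/subquotient_class0.
have /set_mem h := subquotient_reprP c.
have [U iU hU] := h i0 I; rewrite inE; apply/eqP.
by apply: (hU (fun=> i0)) => j; split=> //; exact: nbhs_singleton.
Qed.

End RelativeCohomology.

Lemma rVpoly_continuous (R : realType) n :
  continuous (fun v : 'rV[R]_n => rVpoly v : Rinfty R).
Proof. by apply/continuousP => U oU; exact: (oU n). Qed.

Lemma cvg_powR (R : realType) (I : Type) (F : set_system I) (FF : Filter F)
    (g s : I -> R) (x y : R) : (forall i, 0 < g i) -> 0 < x ->
  g @ F --> x -> s @ F --> y -> (fun i => g i `^ s i) @ F --> x `^ y.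
Proof.
move=> g0 x0 gx sy.
have h : (fun i => s i * ln (g i)) @ F --> y * ln x.
  apply: cvgM => //; exact: (cvg_comp _ _ gx (continuous_ln x0)).
rewrite (_ : (fun i => _) = fun i => expR (s i * ln (g i))); last first.
  by apply/funext => i; rewrite /powR gt_eqF.
by rewrite [x `^ y]/powR gt_eqF//; exact: (cvg_comp _ _ h (@continuous_expR R _)).
Qed.

(** * Critical groups of an even homogeneous functional, from abstract properties of the space *)

Section CriticalGroups.
Variables (R : realType) (N : nat) (p : R) (hp : 1 < p) (Omega : set 'rV[R]_N) (C rho : R).
Local Notation W := (X0 hp Omega C).
Local Notation Ifun := (I_functional (Omega := Omega) (hp := hp) (C := C) rho).
Local Notation Jfun := (J_functional (Omega := Omega) (hp := hp) (C := C)).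

Hypothesis copp : continuous (-%R : W -> W).
Variable scale : R -> W -> W.
Hypothesis cscale : forall (t : R) (u : W),
  (fun z : W * R => scale z.2 z.1) @ (u, t) --> scale t u.
Hypothesis scale1 : forall u, scale 1 u = u.
Hypothesis scale0 : forall u, scale 0 u = 0.
Hypothesis scaleA : forall a b u, scale a (scale b u) = scale (a * b) u.
Hypothesis scaleN1 : forall u, scale (-1) u = - u.
Hypothesis cJ : continuous (Jfun : W -> R).
Hypothesis J_scale : forall t u, Jfun (scale t u) = `|t| `^ p * Jfun u.
Hypothesis I_scale : forall t u, Ifun (scale t u) = `|t| `^ p * Ifun u.
Hypothesis J_gt0 : forall u : W, u <> 0 -> 0 < Jfun u.
(** This is how compactness enters: it yields odd maps to the sphere and the nilpotency of the class
    of the cover. *)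
Hypothesis finite_rank : forall mu : R, exists m (G : 'I_m -> W -> R),
  [/\ forall i, continuous (G i), forall i u, G i (- u) = - G i u &
      forall u, I_sublevel hp Omega C rho mu u -> exists i, G i u != 0].

Let p_gt0 : 0 < p. Proof. exact: lt_trans hp. Qed.

Lemma J_opp u : Jfun (- u) = Jfun u.
Proof. by rewrite -scaleN1 J_scale normrN1 powR1 mul1r. Qed.

Lemma I_opp u : Ifun (- u) = Ifun u.
Proof. by rewrite -scaleN1 I_scale normrN1 powR1 mul1r. Qed.

Lemma I_sublevel_opp mu u : I_sublevel hp Omega C rho mu u -> I_sublevel hp Omega C rho mu (- u).
Proof. by move=> [u1 u2]; split; rewrite /constraint_manifold/= ?J_opp ?I_opp. Qed.

Lemma Phi_scale mu t u : Phi rho mu (scale t u : W) = `|t| `^ p * Phi rho mu u.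
Proof. by rewrite /Phi I_scale J_scale mulrBr; congr (_ - _); rewrite mulrCA. Qed.

Lemma scale_neq0 t u : t != 0 -> u <> 0 -> scale t u <> 0.
Proof.
move=> t0 u0 tu0; apply: u0.
by rewrite -[u]scale1 -(mulVf t0) -scaleA tu0 -(scale0 0) scaleA mulr0.
Qed.

Lemma sphere_neq0 (u : W) : Jfun u = 1 -> u <> 0.
Proof.
move=> u1 u0; have : Jfun (scale 0 u) = 1 by rewrite scale0 -u0.
by rewrite J_scale normr0 powR0 ?gt_eqF// mul0r => /esym/eqP; rewrite oner_eq0.
Qed.

(** The functionals map the sublevel set oddly into R^m minus the origin; normalize and include in
    the infinite sphere. *)
Lemma odd_map_exists mu : exists F : I_sublevel hp Omega C rho mu -> Sinfty R,
  continuous F /\ odd_map F.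
Proof.
have [m [G [cG oG G0]]] := finite_rank mu.
pose g (u : W) : 'rV[R]_m := \row_i G i u.
pose Gp (u : I_sublevel hp Omega C rho mu) : Rinfty R := rVpoly (g (\val u)).
have Gp0 u : Gp u != 0.
  have [i Gi] := G0 _ (set_valP u); apply/eqP => /polyP/(_ i).
  by rewrite coef_rVpoly_ord mxE coef0 => /eqP; exact/negP.
exists (fun u => Sinfty_of (Gp u)); split=> [u|u v uv].
  apply: (cvg_Sinfty_of (nbhs_filter u)) => //.
  have gu : (fun v : I_sublevel hp Omega C rho mu => g (\val v)) @ u --> g (\val u).
    apply: (cvg_rV (nbhs_filter u)) => i; rewrite mxE.
    rewrite (_ : (fun v => _) = fun v : I_sublevel hp Omega C rho mu => G i (\val v)).
      exact: (continuous_comp (@val_continuous _ _ u) (@cG i _)).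
    by apply/funext => v; rewrite mxE.
  exact: (continuous_comp gu (@rVpoly_continuous R m _)).
rewrite /= -Sinfty_of_opp//; congr (\val (Sinfty_of _)).
rewrite /Gp -[- rVpoly _](raddfN rVpoly); congr rVpoly.
by apply/rowP => i; rewrite !mxE uv oG.
Qed.

(** The sublevel set itself competes in the infimum. *)
Lemma minimax_eigenvalue_le mu k : I_sublevel hp Omega C rho mu !=set0 ->
  (k.+1%:R%:E <= cohomological_index R (I_sublevel hp Omega C rho mu))%E ->
  (minimax_eigenvalue hp Omega C rho k.+1 <= mu%:E)%E.
Proof.
move=> ne ik; apply: (@le_trans _ _
    (ereal_sup [set (Ifun u)%:E | u in I_sublevel hp Omega C rho mu])).
  apply: ereal_inf_lbound; exists (I_sublevel hp Omega C rho mu) => //; split=> //.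
    by move=> u [].
  exact: I_sublevel_opp.
by apply: ge_ereal_sup => _ [u [_ ule] <-]; rewrite lee_fin.
Qed.

Section Level.
Variable lambda : R.
Local Notation X := (Phi_sublevel hp Omega C rho lambda).
Local Notation Il := (I_sublevel hp Omega C rho lambda).

Lemma Phi_sublevel_scale t (u : W) : X u -> X (scale t u).
Proof. by rewrite /Phi_sublevel/= Phi_scale => u0; rewrite mulr_ge0_le0 ?powR_ge0. Qed.

Let Xscale t (u : X) : X := SigSub (mem_set (Phi_sublevel_scale t (set_valP u))).

Lemma zero_in_Phi_sublevel : X 0.
Proof.
by rewrite /Phi_sublevel/= -(scale0 0) Phi_scale normr0 powR0 ?gt_eqF// mul0r.
Qed.

Let Xzero : X := SigSub (mem_set zero_in_Phi_sublevel).

(** Radial contraction of the cone to 0; the second homotopy asked for by [contractible_acyclic] is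
    constant. *)
Lemma Phi_sublevel_acyclic q (phi : seq X -> bool) :
  lzero setT q.+2 (cobd phi) -> is_reduced_coboundary q phi.
Proof.
apply: (@contractible_acyclic R X (fun=> Xzero) Xzero (fun u t => Xscale (1 - t) u)
  (fun _ _ => Xzero)) => [u t _|u t _|u|u|//|//].
- apply: (cvg_set_type (nbhs_filter (u, t))).
  move=> U hU; have [[P Q] [Pu Qt] PQ] := cscale hU.
  exists ((fun v : X => \val v) @^-1` P, (fun s : R => 1 - s) @^-1` Q).
    split; first exact: (@val_continuous _ _ u).
    have h : 1 - s @[s --> t] --> 1 - t by apply: cvgB; [exact: cvg_cst|exact: cvg_id].
    exact: h.
  by move=> [v s] [/= Pv Qs]; exact: (PQ (\val v, 1 - s)).
- exact: cvg_cst.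
- by apply/val_inj; rewrite /= subr0 scale1.
- by apply/val_inj; rewrite /= subrr scale0.
Qed.

Let A : set X := [set u | \val u <> 0].

Lemma I_sublevel_normalize (u : W) : X u -> u <> 0 ->
  Il (scale (Jfun u `^ (- p^-1)) u).
Proof.
move=> Xu /J_gt0 J0.
have e : `|Jfun u `^ (- p^-1)| `^ p * Jfun u = 1.
  rewrite ger0_norm ?powR_ge0// -powRrM mulNr mulVf ?gt_eqF// powRN powRr1 ?ltW//.
  by rewrite mulVf// gt_eqF.
split; first by rewrite /constraint_manifold/= J_scale.
have := Phi_sublevel_scale (Jfun u `^ (- p^-1)) Xu; rewrite /Phi_sublevel/= /Phi J_scale e.
by rewrite mulr1 subr_le0.
Qed.

Lemma I_sublevel_Phi (u : W) : Il u -> X u.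
Proof. by move=> [u1 u2]; rewrite /Phi_sublevel/= /Phi u1 mulr1 subr_le0. Qed.

Lemma Phi_sublevel_zero (u : W) : ~ (Il !=set0) -> X u -> u = 0.
Proof.
move=> ne Xu; apply: contrapT => u0; apply: ne; eexists.
exact: I_sublevel_normalize Xu u0.
Qed.

Lemma critical_group_empty l : ~ (Il !=set0) ->
  isomorphic (critical_group hp Omega C rho lambda l) 'rV['F_2]_(l == 0%N).
Proof.
move=> ne; apply: (one_point_cohomology (x0 := Xzero)).
- by move=> u; apply/val_inj => /=; exact: Phi_sublevel_zero (set_valP u).
- by move=> u /=; apply; exact: Phi_sublevel_zero (set_valP u).
- exact: Phi_sublevel_acyclic.
Qed.

Section Nonempty.
Variables (u0 : W) (Iu0 : Il u0).

Let i0 : Il := SigSub (mem_set Iu0).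

Let r (u : X) : Il := if pselect (A u) is left h
  then SigSub (mem_set (I_sublevel_normalize (set_valP u) h)) else i0.

Let f (u : Il) : X := SigSub (mem_set (I_sublevel_Phi (set_valP u))).

Let rE (u : X) : A u -> \val (r u) = scale (Jfun (\val u) `^ (- p^-1)) (\val u).
Proof. by rewrite /r; case: pselect. Qed.

(** The exponent runs from 0, the identity, to -1/p, the normalization to J = 1; positive factors
    keep the point in the cone and away from 0. *)
Let H_sub (a : A) (t : R) : X :=
  Xscale (Jfun (\val (\val a : X)) `^ (- (t / p))) (\val a).

Let H_subP a t : A (H_sub a t).
Proof.
have a0 : A (\val a) := set_valP a.
by apply: scale_neq0 => //; rewrite gt_eqF// powR_gt0// J_gt0.
Qed.

Let H (a : A) (t : R) : A := SigSub (mem_set (@H_subP a t)).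

Let scalar_cvg (a : A) (t : R) :
  (fun z : A * R => Jfun (\val (\val z.1 : X)) `^ (- (z.2 / p))) @ (a, t) -->
  Jfun (\val (\val a : X)) `^ (- (t / p)).
Proof.
have J0 (b : A) : 0 < Jfun (\val (\val b : X)) := J_gt0 (set_valP b).
have c1 : (fun z : A * R => \val z.1) @ (a, t) --> \val a by exact: cvg_val_fst.
have c2 := cvg_comp _ _ c1 (@val_continuous _ _ (\val a)).
have c3 := cvg_comp _ _ c2 (@cJ (\val (\val a : X))).
apply: (cvg_powR (nbhs_filter (a, t))) => //.
by apply: cvgN; apply: cvgMl; exact: cvg_snd.
Qed.

Let cH (a : A) (t : R) : (fun z : A * R => H z.1 z.2) @ (a, t) --> H a t.
Proof.
apply: (cvg_set_type (nbhs_filter (a, t))); apply: (cvg_set_type (nbhs_filter (a, t))).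
move=> U hU; have [[P Q] /= [Pu Qt] PQ] := cscale hU.
have c1 : (fun z : A * R => \val z.1) @ (a, t) --> \val a by exact: cvg_val_fst.
have c2 := cvg_comp _ _ c1 (@val_continuous _ _ (\val a)).
have F1 : nbhs (a, t) [set z : A * R | P (\val (\val z.1 : X))] := c2 _ Pu.
have F2 : nbhs (a, t) [set z : A * R |
  Q (Jfun (\val (\val z.1 : X)) `^ (- (z.2 / p)))] := scalar_cvg Qt.
apply: (@filterS2 _ _ (nbhs_filter (a, t)) _ _ _ _ F1 F2) => -[b s] /= Pb Qs.
exact: (PQ (_, _)).
Qed.

Let cr : continuous (fun a : A => r (\val a)).
Proof.
move=> a; apply: (cvg_set_type (nbhs_filter a)).
rewrite rE; last exact: (set_valP a).
rewrite (_ : (fun b => _) = fun b : A => scale (Jfun (\val (\val b : X)) `^ (- p^-1)) (\val (\val b : X))).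
  move=> U hU; have [[P Q] /= [Pu Qt] PQ] := cscale hU.
  have c2 := cvg_comp _ _ (@val_continuous _ _ a) (@val_continuous _ _ (\val a)).
  have Qt' : nbhs (Jfun (\val (\val a : X)) `^ (- (1 / p))) Q by rewrite div1r.
  have [[P' Q'] /= [Pa' Q1] PQ'] := scalar_cvg Qt'.
  have F1 : nbhs a [set b : A | P (\val (\val b : X))] := c2 _ Pu.
  apply: (@filterS2 _ _ (nbhs_filter a) _ _ _ _ F1 Pa') => b /= Pb Pb'.
  apply: (PQ (_, _)); split=> //=.
  have := PQ' (b, 1) (conj Pb' (nbhs_singleton Q1)).
  by rewrite /= div1r.
by apply/funext => b; rewrite rE//; exact: (set_valP b).
Qed.

Let cf : continuous f.
Proof. by move=> u; apply: (cvg_set_type (nbhs_filter u)); exact: (@val_continuous _ _ u). Qed.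

Let fA u : A (f u).
Proof. by have [u1 _] := set_valP u; exact: sphere_neq0 u1. Qed.

Let fK u : r (f u) = u.
Proof.
apply/val_inj; rewrite rE; last exact: fA.
have [u1 _] := set_valP u; rewrite [Jfun _](_ : _ = 1)//.
by rewrite powR1 scale1.
Qed.

Let H0 a : H a 0 = a.
Proof. by apply/val_inj/val_inj; rewrite /= mul0r oppr0 powRr0 scale1. Qed.

Let H1 a : \val (H a 1) = f (r (\val a)).
Proof. by apply/val_inj; rewrite /= rE ?div1r//; exact: (set_valP a). Qed.

Lemma critical_groupS q : isomorphic (critical_group hp Omega C rho lambda q.+1)
  (reduced_cohomology Il (Posz q)).
Proof.
exact: (relative_cohomology Phi_sublevel_acyclic cr cf fA fK (fun a t _ => @cH a t) H0 H1 i0).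
Qed.

Lemma critical_group0 (c : critical_group hp Omega C rho lambda 0) : c = 0.
Proof. exact: (relative_cohomology0 Phi_sublevel_acyclic fA i0). Qed.

Lemma critical_groupE l : isomorphic (critical_group hp Omega C rho lambda l)
  (reduced_cohomology Il (l%:Z - 1)).
Proof.
case: l => [|q]; last first.
  by rewrite (_ : q.+1%:Z - 1 = Posz q); [exact: critical_groupS|rewrite intS addrAC subrr add0r].
rewrite (_ : 0%:Z - 1 = Negz 0)//; apply: isomorphic_trivial; first exact: critical_group0.
exact: (reduced_cohomologyN1 i0).
Qed.

(** By [gysin_injective] applied to the n-th power, the vanishing of the next power gives a closed
    cochain of degree n on the sublevel set that cannot be a reduced coboundary. The connecting
    isomorphism moves its class to degree n+1. *)
Lemma critical_group_neq0 (F : Il -> Sinfty R) (cF : continuous F) (oF : odd_map F) n :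
  let theta := dc_cocycle (odd_map_cover copp (@I_sublevel_opp lambda) cF oF) in
  ~ is_coboundary set0 n (cup1_power theta n) ->
  is_coboundary set0 n.+1 (cup1_power theta n.+1) ->
  exists c : critical_group hp Omega C rho lambda n.+1, c <> 0.
Proof.
move=> theta nn nS.
have th : is_cocycle set0 1 theta by exact: is_cocycle_dc.
have [x dx xP] := gysin_injective (is_cocycle_power n th) nS.
have xc : of_list n x \in cocycle set0 n by apply/cocycle_of_list/is_cocycle_set0.
have [g [g' gK g'K]] := critical_groupS n.
exists (g' (subquotient_class _ xc)) => /(congr1 g); rewrite g'K raddf0.
by move=> /subquotient_class0/reduced_coboundary_of_list/xP.
Qed.

(** The 0-th power is nonzero and, by [dc_nilpotent], some power vanishes, so there is a last
    nonzero power. *)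
Lemma nontrivial_critical_group :
  exists l (c : critical_group hp Omega C rho lambda l), c <> 0.
Proof.
have [F [cF oF]] := odd_map_exists lambda.
pose D := odd_map_cover copp (@I_sublevel_opp lambda) cF oF.
have [m [G [cG oG G0]]] := finite_rank lambda.
have nil : is_coboundary set0 m (cup1_power (dc_cocycle D) m).
  apply: (@dc_nilpotent _ _ D R m (fun i u => G i (\val u))).
  - move=> i u; exact: (continuous_comp (@val_continuous _ _ u) (@cG i _)).
  - by move=> i u /=; rewrite oG.
  - by move=> u; exact: G0 (set_valP u).
have n0 : ~ is_coboundary set0 0 (cup1_power (dc_cocycle D) 0).
  move=> /is_coboundary_set0[eta /(_ erefl) e0 h].
  pose b := antipodal_pi i0.
  have [U bU hU] := h b I.
  have : cadd (cup1_power (dc_cocycle D) 0) (cobd eta) [:: b] = false.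
    by apply: hU => // y; rewrite inE => /eqP->; split=> //; exact: nbhs_singleton.
  by rewrite /cadd cobd_cons e0.
have [n nn nS] : exists2 n, ~ is_coboundary set0 n (cup1_power (dc_cocycle D) n) &
    is_coboundary set0 n.+1 (cup1_power (dc_cocycle D) n.+1).
  elim: m nil {G cG oG G0} => [//|m IH] nil.
  have [h|h] := pselect (is_coboundary set0 m (cup1_power (dc_cocycle D) m)).
    exact: IH.
  by exists m.
exists n.+1; exact: critical_group_neq0 nn nS.
Qed.

End Nonempty.

Lemma I_sublevel_index1 : Il !=set0 ->
  (1%:R%:E <= cohomological_index R Il)%E.
Proof.
move=> [u Iu]; have [F [cF oF]] := odd_map_exists lambda.
apply: (@cohomological_index_ge _ _ _ copp (@I_sublevel_opp lambda) F cF oF 0).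
  by exists u.
move=> /is_coboundary_set0[eta /(_ erefl) e0 h].
pose b : antipodal_quotient Il := antipodal_pi (SigSub (mem_set Iu)).
have [U bU hU] := h b I.
have : cadd (fun=> true) (cobd eta) [:: b] = false.
  by apply: hU => // y; rewrite inE => /eqP->; split=> //; exact: nbhs_singleton.
by rewrite /cadd cobd_cons e0.
Qed.

Lemma lt_minimax_eigenvalue1 :
  (lambda%:E < minimax_eigenvalue hp Omega C rho 1)%E -> ~ (Il !=set0).
Proof.
move=> lt ne; move: lt; apply/negP; rewrite -leNgt.
by apply: (@minimax_eigenvalue_le lambda 0 ne); exact: I_sublevel_index1.
Qed.

Lemma minimax_eigenvalue_lt k : (minimax_eigenvalue hp Omega C rho k.+1 < lambda%:E)%E ->
  exists M : set W, [/\ M `<=` Il, forall u, M u -> M (- u) &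
    (k.+1%:R%:E <= cohomological_index R M)%E].
Proof.
move=> /ereal_inf_lt[_ [M [Mc symM iM] <-] Ml]; exists M; split=> // u Mu.
split; first exact: Mc.
rewrite -lee_fin (le_trans _ (ltW Ml))//; apply: ereal_sup_ubound.
by exists u.
Qed.

Theorem critical_groups :
  [/\ (lambda%:E < minimax_eigenvalue hp Omega C rho 1)%E ->
        forall l : nat, isomorphic (critical_group hp Omega C rho lambda l)
          'rV['F_2]_(l == 0%N),
      (minimax_eigenvalue hp Omega C rho 1 < lambda%:E)%E ->
        (forall l : nat, isomorphic (critical_group hp Omega C rho lambda l)
           (reduced_cohomology (I_sublevel hp Omega C rho lambda) (l%:Z - 1))) /\
        (forall c : critical_group hp Omega C rho lambda 0, c = 0),
      (forall k : nat, (1 <= k)%N ->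
        (minimax_eigenvalue hp Omega C rho k < lambda%:E)%E ->
        (lambda%:E < minimax_eigenvalue hp Omega C rho k.+1)%E ->
        exists c : critical_group hp Omega C rho lambda k, c <> 0) &
      (exists l : nat, exists c : critical_group hp Omega C rho lambda l, c <> 0)].
Proof.
split.
- by move=> /lt_minimax_eigenvalue1 ne l; exact: critical_group_empty.
- move=> /minimax_eigenvalue_lt[M [MI symM iM]].
  have [[u Mu] _] := cohomological_index_geP copp symM iM.
  have Iu := MI _ Mu.
  by split=> [l|c]; [exact: (critical_groupE Iu)|exact: (critical_group0 Iu)].
- move=> [//|n] _ /minimax_eigenvalue_lt[M [MI symM iM]] lt.
  have [[u Mu] [FM [cFM [oFM nM]]]] := cohomological_index_geP copp symM iM.
  have [F [cF oF]] := odd_map_exists lambda.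
  pose D := odd_map_cover copp (@I_sublevel_opp lambda) cF oF.
  apply: (critical_group_neq0 (MI _ Mu) (cF := cF) (oF := oF)).
    (* The inclusion of [M] pulls the class of the big cover back to that of the small one, so the
       power that is nonzero over [M] is nonzero over the whole sublevel set. *)
    pose j (v : M) : Il := SigSub (mem_set (MI _ (set_valP v))).
    have cj : continuous j.
      by move=> v; apply: (cvg_set_type (nbhs_filter v)); exact: (@val_continuous _ _ v).
    pose jq (x : antipodal_quotient M) : antipodal_quotient Il :=
      antipodal_pi (j (antipodal_section x)).
    have jqE v : jq (antipodal_pi v) = antipodal_pi (j v).
      apply/antipodal_piP => /=.
      by have /antipodal_piP := antipodal_sectionK (antipodal_pi v).
    have cjq : continuous jq.
      apply/quotient_continuous => v.
      rewrite (_ : _ \o _ = @antipodal_pi _ _ \o j); last by apply/funext => w; exact: jqE.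
      exact: (continuous_comp (@cj v) (@antipodal_pi_continuous _ _ (j v))).
    have nat := @dc_cocycle_natural _ _ _ _ (odd_map_cover copp symM cFM oFM) D j jq cj jqE.
    have {}nat := nat _.
    move=> /(is_coboundary_pull cjq)[eta [e0 ? e]]; apply: nM.
    have cob : is_coboundary set0 n (cup1_power (pull jq (dc_cocycle D)) n).
      by exists eta; split=> //; apply: lzero_ext e => l _; rewrite /cadd pull_power.
    have c1 : is_cocycle set0 1 (pull jq (dc_cocycle D)).
      by apply: is_cocycle_pull => //; exact: is_cocycle_dc.
    apply: (proj1 (is_coboundary_cadd (is_coboundary_power n c1 (is_cocycle_dc _) _)) cob).
    by apply: nat => v; apply/val_inj.
  (* Here k is [n.+1]. If the power [n.+1] were nonzero, the sublevel set would have index at least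
     [n.+2] and the next minimax value would be at most lambda. *)
  apply: contrapT => nS; move: lt; apply/negP; rewrite -leNgt.
  apply: minimax_eigenvalue_le; first by exists u; exact: MI.
  apply: (cohomological_index_ge (copp := copp) (symA := @I_sublevel_opp lambda)
    (cF := cF) (oF := oF)) => //.
  by exists u; exact: MI.
(* When the sublevel set is empty, C^0 is Z_2. *)
- have [[u Iu]|ne] := pselect (Il !=set0); first exact: nontrivial_critical_group Iu.
  have [g [g' gK g'K]] := critical_group_empty 0 ne.
  exists 0%N, (g' (const_mx 1)) => /(congr1 g); rewrite g'K raddf0.
  by move=> /rowP/(_ 0); rewrite !mxE => /eqP; rewrite oner_eq0.
Qed.

End Level.
End CriticalGroups.

(** * Integrals over cubes *)

Section Tonelli.
Context d1 d2 (T1 : measurableType d1) (T2 : measurableType d2) (R : realType).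
Variables (m1 : {sigma_finite_measure set T1 -> \bar R})
  (m2 : {sigma_finite_measure set T2 -> \bar R}).

Lemma integral_prod (F : T1 -> R) (G : T2 -> R) :
  measurable_fun setT F -> measurable_fun setT G ->
  (forall x, 0 <= F x) -> (forall y, 0 <= G y) ->
  (\int[m1 \x m2]_z (F z.1 * G z.2)%:E =
   (\int[m1]_x (F x)%:E) * (\int[m2]_y (G y)%:E))%E.
Proof.
move=> mF mG F0 G0; rewrite fubini_tonelli1; last 2 first.
- apply/measurable_EFinP; apply: measurable_funM.
    exact: (measurableT_comp mF measurable_fst).
  exact: (measurableT_comp mG measurable_snd).
- by move=> z; rewrite lee_fin mulr_ge0.
have e x : fubini_F m2 (fun z : T1 * T2 => (F z.1 * G z.2)%:E) x =
    ((F x)%:E * \int[m2]_y (G y)%:E)%E.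
  rewrite /fubini_F/=; under eq_integral do rewrite EFinM.
  rewrite ge0_integralZl//; first exact/measurable_EFinP.
    by move=> y _; rewrite lee_fin.
  by rewrite lee_fin.
under eq_integral do rewrite e.
rewrite ge0_integralZr//; first exact/measurable_EFinP.
- by move=> x _; rewrite lee_fin.
- by apply: integral_ge0 => y _; rewrite lee_fin.
Qed.

End Tonelli.

Section Cubes.
Variable R : realType.
Local Notation E := (euclidean R).

Definition cube n (a : 'I_n -> R) (h : R) : set (E n) :=
  [set x | forall i, a i <= tnth x i < a i + h].

Lemma measurable_cube n (a : 'I_n -> R) h : measurable (cube a h).
Proof.
rewrite (_ : cube a h = \bigcap_(i in [set: 'I_n]) ((fun x : E n => tnth x i) @^-1` `[a i, a i + h[)).
  apply: fin_bigcap_measurable => // i _.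
  rewrite -[X in measurable X]setTI; apply: measurable_tnth => //.
apply/seteqP; split=> x /= h0 i; first by move=> _; rewrite /= in_itv/=; exact: h0.
by have := h0 i I; rewrite /= in_itv/=.
Qed.

Lemma lebesgueN_cube n (a : 'I_n -> R) h : 0 <= h ->
  lebesgueN R n (cube a h) = (h ^+ n)%:E.
Proof.
move=> h0; elim: n a => [|n IH] a.
  rewrite /= diracE mem_set ?expr0// => -[].
  by case.
change (pushforward (lebesgue_measure \x lebesgueN R n)%E (@cons_point R n) (cube a h) = (h ^+ n.+1)%:E).
rewrite /pushforward.
rewrite (_ : _ @^-1` _ = `[a ord0, a ord0 + h[ `*` cube (a \o lift ord0) h).
  rewrite product_measure1E//; last exact: measurable_cube.
  have := lebesgue_measure_itv `[a ord0, a ord0 + h[; rewrite /= lte_fin.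
  rewrite IH => ->; case: ltP => [_|]; last first.
    rewrite gerDl => hle; have -> : h = 0 by apply/eqP; rewrite eq_le hle h0.
    by rewrite mul0e expr0n.
  by rewrite -EFinD addrAC subrr add0r -EFinM exprS.
apply/seteqP; split=> -[x t] /=.
  move=> hx; split=> /=; first by rewrite in_itv/=; have := hx ord0; rewrite (tnth_nth 0).
  by move=> i; have := hx (lift ord0 i); rewrite /= !(tnth_nth 0).
move=> [/= x0 tc] i; case: (unliftP ord0 i) => [j ->|->].
  by have := tc j; rewrite /= !(tnth_nth 0).
by move: x0; rewrite in_itv/= (tnth_nth 0).
Qed.

End Cubes.

(** A geometric sum of ratio 2^N >= 2 is at most twice its last term, and the last admissible term
    is at most r^N. *)
Lemma sum_pow2_le (R : realType) (N n : nat) (r : R) : (0 < N)%N -> 0 <= r ->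
  \sum_(j < n | 2 ^+ j <= r) (2 ^+ j) ^+ N <= 2 * r ^+ N.
Proof.
move=> N0 r0; elim: n => [|n IH]; first by rewrite big_ord0 mulr_ge0// exprn_ge0.
have [le|lt] := leP (2 ^+ n) r; last first.
  rewrite big_mkcond big_ord_recr /= (lt_geF lt) addr0 -big_mkcond.
  exact: IH.
rewrite -[leRHS](mulr1); apply: (@le_trans _ _ (2 * (2 ^+ n) ^+ N)); last first.
  by rewrite mulr1 ler_pM2l// ler_pXn2r// nnegrE.
rewrite big_mkcond; apply: (@le_trans _ _ (\sum_(j < n.+1) (2 ^+ j) ^+ N)).
  by apply: ler_sum => j _; case: ifP => // _; rewrite exprn_ge0.
elim: n {IH le} => [|n IH]; first by rewrite big_ord1 expr0 expr1n; lra.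
rewrite big_ord_recr /= (le_trans (lerD IH (lexx _)))// exprS exprMn.
have : 2 <= 2 ^+ N :> R.
  by case: N N0 {IH} => // N _; rewrite exprS ler_peMr// exprn_ege1//; lra.
have : 0 <= (2 ^+ n) ^+ N :> R by rewrite !exprn_ge0.
move: ((2 ^+ n) ^+ N) (2 ^+ N) => b c b0 c2.
have : 2 * b <= c * b by rewrite ler_wpM2r.
lra.
Qed.

Section Estimates.
Variables (R : realType) (N : nat) (p : R).
Hypothesis hN : (0 < N)%N.
Hypothesis hp : 1 < p.
Local Notation E := (euclidean R N).
Local Notation mu := (lebesgueN R N).
Local Notation d := (fun z : E * E => euclidean_dist z.1 z.2).

Let p0 : 0 < p. Proof. exact: lt_trans hp. Qed.

Definition lp_energy (V : E -> R) : \bar R := (\int[mu]_x (`|V x| `^ p)%:E)%E.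

Definition lp_energy_on (Q : set E) (V : E -> R) : \bar R :=
  (\int[mu]_x (\1_Q x * `|V x| `^ p)%:E)%E.

Definition difference (V : E -> R) (z : E * E) : R := `|V z.1 - V z.2| `^ p.

Definition near_energy (V : E -> R) : \bar R :=
  (\int[(mu \x mu)%E]_z (\1_near_pairs z * (difference V z / d z ^+ N))%:E)%E.

Lemma dist_ge0 z : 0 <= d z. Proof. exact: sqrtr_ge0. Qed.

Lemma dist_eq0 z : d z = 0 -> z.1 = z.2.
Proof.
move=> /eqP; rewrite /euclidean_dist sqrtr_eq0 => h.
have S0 : 0 <= \sum_(i < N) (tnth z.1 i - tnth z.2 i) ^+ 2.
  by apply: sumr_ge0 => i _; rewrite sqr_ge0.
have /eqP : \sum_(i < N) (tnth z.1 i - tnth z.2 i) ^+ 2 == 0 by rewrite eq_le h.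
move=> /psumr_eq0P => H; apply: eq_from_tnth => i; apply/eqP.
by rewrite -subr_eq0 -sqrf_eq0 H// => j _; rewrite sqr_ge0.
Qed.

Lemma dist_le z b : 0 <= b -> (forall i, `|tnth z.1 i - tnth z.2 i| <= b) ->
  d z <= N%:R * b.
Proof.
move=> b0 h; rewrite /euclidean_dist -[leRHS]ger0_norm ?mulr_ge0// -sqrtr_sqr.
apply: ler_wsqrtr; apply: (@le_trans _ _ (\sum_(i < N) b ^+ 2)).
  by apply: ler_sum => i _; rewrite -real_normK ?num_real// ler_pXn2r ?nnegrE.
rewrite sumr_const card_ord -[leLHS]mulr_natl exprMn ler_wpM2r ?sqr_ge0//.
by rewrite -natrX ler_nat; case: N hN => // n _; rewrite leq_pmulr.
Qed.

Lemma difference_ge0 V z : 0 <= difference V z. Proof. exact: powR_ge0. Qed.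

(** The kernel is at least 1 on near pairs; at distance 0 both sides are 0. *)
Lemma difference_near V z : d z < 1 -> difference V z <= difference V z / d z ^+ N.
Proof.
move=> d1; have [d0|dn0] := eqVneq (d z) 0.
  by rewrite /difference (dist_eq0 d0) subrr normr0 powR0 ?gt_eqF// mul0r.
have dp : 0 < d z by rewrite lt_neqAle eq_sym dn0 dist_ge0.
rewrite ler_pdivlMr ?exprn_gt0// ler_piMr ?difference_ge0//.
by rewrite exprn_ile1 ?ltW.
Qed.

Lemma powR_sub_le (a b : R) : `|a| `^ p <= 2 `^ p * (`|a - b| `^ p + `|b| `^ p).
Proof.
have H (x y : R) : 0 <= x -> x <= y -> (x + y) `^ p <= 2 `^ p * y `^ p.
  move=> x0 xy; have y0 := le_trans x0 xy; rewrite -powRM//.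
  by apply: ge0_ler_powR; rewrite ?nnegrE ?addr_ge0 ?mulr_ge0 ?(ltW p0)//; lra.
have tri : `|a| <= `|a - b| + `|b| by rewrite -{1}(subrK b a) ler_normD.
apply: (@le_trans _ _ ((`|a - b| + `|b|) `^ p)).
  by apply: ge0_ler_powR; rewrite ?nnegrE ?addr_ge0 ?(ltW p0).
rewrite mulrDr; have [le|lt] := leP `|a - b| `|b|.
  by rewrite (le_trans (H _ _ _ le))// lerDr mulr_ge0 ?powR_ge0.
by rewrite addrC (le_trans (H _ _ _ (ltW lt)))// lerDl mulr_ge0 ?powR_ge0.
Qed.

Lemma measurable_dist : measurable_fun setT d.
Proof. exact: measurable_euclidean_dist. Qed.

Section Fixed.
Variable V : E -> R.
Hypothesis mV : measurable_fun setT V.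

Lemma measurable_powR_norm dT (T : measurableType dT) (f : T -> R) :
  measurable_fun setT f -> measurable_fun setT (fun x => `|f x| `^ p).
Proof.
move=> mf; apply: (@measurableT_comp _ _ _ _ _ _ (@powR R ^~ p)) => //.
exact: measurableT_comp.
Qed.

Lemma measurable_difference : measurable_fun setT (difference V).
Proof.
apply: (measurable_powR_norm (f := fun z : E * E => V z.1 - V z.2)).
apply: measurable_funB; first exact: (measurableT_comp mV measurable_fst).
exact: (measurableT_comp mV measurable_snd).
Qed.

Lemma measurable_inv_dist : measurable_fun setT (fun z : E * E => (d z ^+ N)^-1).
Proof.
rewrite (_ : (fun _ => _) = (fun z => (d z ^+ N) `^ (- 1))).
  apply: (measurableT_comp (measurable_powR (- 1))).
  by apply: measurable_funX; exact: measurable_dist.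
by apply/funext => z; rewrite powR_inv1// exprn_ge0// dist_ge0.
Qed.

Lemma measurable_near_integrand : measurable_fun setT
  (fun z => \1_near_pairs z * (difference V z / d z ^+ N)).
Proof.
apply: measurable_funM; first by apply: measurable_indic; exact: measurable_near_pairs.
by apply: measurable_funM; [exact: measurable_difference|exact: measurable_inv_dist].
Qed.

Lemma near_integrand_ge0 z : 0 <= \1_near_pairs z * (difference V z / d z ^+ N).
Proof.
by rewrite mulr_ge0// divr_ge0 ?difference_ge0// exprn_ge0// dist_ge0.
Qed.

Lemma near_energy_ge0 : (0 <= near_energy V)%E.
Proof. by apply: integral_ge0 => z _; rewrite lee_fin near_integrand_ge0. Qed.

Lemma lp_energy_on_ge0 Q : (0 <= lp_energy_on Q V)%E.
Proof. by apply: integral_ge0 => z _; rewrite lee_fin mulr_ge0// powR_ge0. Qed.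

Lemma measurable_energy_on Q : measurable Q ->
  measurable_fun setT (fun x => \1_Q x * `|V x| `^ p).
Proof.
move=> mQ; apply: measurable_funM; first exact: measurable_indic.
exact: measurable_powR_norm.
Qed.

Lemma integral_indicN (Q : set E) : measurable Q -> (\int[mu]_x (\1_Q x)%:E = mu Q)%E.
Proof. by move=> mQ; rewrite integral_indic// setIT. Qed.

(** Integrate |V(x)|^p <= 2^p (|V(x)-V(y)|^p + |V(y)|^p) over x in [Q] and y in [Q'], then divide by
    [m]. All these pairs are near, so the differences are paid for by the near energy. *)
Lemma poincare_step (Q Q' : set E) (m : R) : measurable Q -> measurable Q' ->
  0 < m -> mu Q = m%:E -> mu Q' = m%:E -> Q `*` Q' `<=` near_pairs ->
  (lp_energy_on Q V <= (2 `^ p / m)%:E * near_energy V + (2 `^ p)%:E * lp_energy_on Q' V)%E.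
Proof.
move=> mQ mQ' m0 QE Q'E near.
have mI A : measurable A -> measurable_fun setT (\1_A : E -> R) by exact: measurable_indic.
have key : (lp_energy_on Q V * m%:E <= (2 `^ p)%:E * near_energy V +
    (2 `^ p)%:E * (m%:E * lp_energy_on Q' V))%E.
  have e1 : (lp_energy_on Q V * m%:E = \int[(mu \x mu)%E]_z
      ((\1_Q z.1 * `|V z.1| `^ p) * \1_Q' z.2)%:E)%E.
    rewrite (integral_prod mu mu (measurable_energy_on mQ) (mI _ mQ')).
    - by rewrite integral_indicN// Q'E.
    - by move=> x; rewrite mulr_ge0// powR_ge0.
    - by [].
  have e2 : (m%:E * lp_energy_on Q' V = \int[(mu \x mu)%E]_z
      (\1_Q z.1 * (\1_Q' z.2 * `|V z.2| `^ p))%:E)%E.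
    rewrite (integral_prod mu mu (mI _ mQ) (measurable_energy_on mQ')).
    - by rewrite integral_indicN// QE.
    - by [].
    - by move=> x; rewrite mulr_ge0// powR_ge0.
  have m1 : measurable_fun setT (fun z : E * E => \1_Q z.1 * (\1_Q' z.2 * `|V z.2| `^ p)).
    apply: measurable_funM; first exact: (measurableT_comp (mI _ mQ) measurable_fst).
    exact: (measurableT_comp (measurable_energy_on mQ') measurable_snd).
  have pos1 (z : E * E) : 0 <= \1_Q z.1 * (\1_Q' z.2 * `|V z.2| `^ p).
    by rewrite !mulr_ge0// powR_ge0.
  have mn : measurable_fun setT (fun z => (\1_near_pairs z * (difference V z / d z ^+ N))%:E).
    by apply/measurable_EFinP; exact: measurable_near_integrand.
  have mq : measurable_fun setT (fun z : E * E => (\1_Q z.1 * (\1_Q' z.2 * `|V z.2| `^ p))%:E).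
    exact/measurable_EFinP.
  have p20 : (0 <= (2 `^ p)%:E :> \bar R)%E by rewrite lee_fin powR_ge0.
  have e3 : ((2 `^ p)%:E * near_energy V = \int[(mu \x mu)%E]_z
      ((2 `^ p)%:E * (\1_near_pairs z * (difference V z / d z ^+ N))%:E))%E.
    by rewrite ge0_integralZl// => z _; rewrite lee_fin near_integrand_ge0.
  have e4 : ((2 `^ p)%:E * (\int[(mu \x mu)%E]_z
      (\1_Q z.1 * (\1_Q' z.2 * `|V z.2| `^ p))%:E) = \int[(mu \x mu)%E]_z
      ((2 `^ p)%:E * (\1_Q z.1 * (\1_Q' z.2 * `|V z.2| `^ p))%:E))%E.
    by rewrite ge0_integralZl// => z _; rewrite lee_fin.
  rewrite e1 e2 e3 e4.
  rewrite -ge0_integralD//; [|by move=> z _; rewrite mule_ge0// lee_fin near_integrand_ge0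
    |exact: measurable_funeM|exact: measurable_funeM].
  apply: ge0_le_integral => //.
  - apply/measurable_EFinP; apply: measurable_funM; last first.
      exact: (measurableT_comp (mI _ mQ') measurable_snd).
    exact: (measurableT_comp (measurable_energy_on mQ) measurable_fst).
  - apply: emeasurable_funD; apply: measurable_funeM; apply/measurable_EFinP => //.
    exact: measurable_near_integrand.
  move=> z _; rewrite -!EFinM -EFinD lee_fin.
  have g0 := near_integrand_ge0 z.
  rewrite !indicE; case: (boolP (z.1 \in Q)) => [zQ|_]; last first.
    by rewrite !mul0r mulr0 addr0 mulr_ge0 ?powR_ge0// -indicE.
  case: (boolP (z.2 \in Q')) => [zQ'|_]; last first.
    by rewrite mulr0 !(mul0r, mulr0) addr0 mulr_ge0 ?powR_ge0// -indicE.
  have nz : near_pairs z by case: (z) zQ zQ' => x y /= /set_mem xQ /set_mem yQ; exact: near.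
  rewrite !mul1r mulr1 mem_set// mul1r -mulrDr (le_trans (powR_sub_le _ (V z.2)))//.
  rewrite ler_wpM2l ?powR_ge0// lerD2r.
  exact: difference_near.
have m_neq0 : m != 0 by rewrite gt_eqF.
have : ((m^-1)%:E * (lp_energy_on Q V * m%:E) <= (m^-1)%:E * ((2 `^ p)%:E * near_energy V +
    (2 `^ p)%:E * (m%:E * lp_energy_on Q' V)))%E.
  by apply: lee_wpmul2l => //; rewrite lee_fin invr_ge0 ltW.
rewrite (muleC _ m%:E) muleA -EFinM mulVf// mul1e => /le_trans; apply.
rewrite ge0_muleDr; last 2 first.
- by rewrite mule_ge0 ?near_energy_ge0// lee_fin powR_ge0.
- by rewrite !mule_ge0 ?lp_energy_on_ge0// lee_fin ?powR_ge0 ?ltW.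
rewrite !muleA -!EFinM (_ : m^-1 * 2 `^ p * m = 2 `^ p); last by field.
by rewrite (mulrC m^-1).
Qed.

End Fixed.
End Estimates.

(** * Poincaré inequality and functions with zero averages *)

Lemma sume_cst (R : realType) (I : finType) (x : \bar R) : (0 <= x)%E ->
  (\sum_(i : I) x = #|I|%:R%:E * x)%E.
Proof.
move=> x0; rewrite big_const; elim: #|_| => [|n IH]; first by rewrite /= mul0e.
by rewrite iterS IH -natr1 EFinD ge0_muleDl ?lee_fin// mul1e addeC.
Qed.

Section Grid.
Variables (R : realType) (N : nat) (c s : R) (M : nat).
Hypothesis s0 : 0 < s.
Local Notation E := (euclidean R N).

Definition grid_cube (k : {ffun 'I_N -> 'I_M}) : set E :=
  cube (fun i => c + (k i)%:R * s) s.

Lemma grid_cover (x : E) : cube (fun=> c) (M%:R * s) x -> exists k, grid_cube k x.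
Proof.
move=> h; pose t i := (tnth x i - c) / s.
have t0 i : 0 <= t i by have /andP[l _] := h i; rewrite /t divr_ge0 ?subr_ge0//; exact: ltW.
have tM i : (Num.truncn (t i) < M)%N.
  have /andP[_ lt] := h i.
  rewrite -(ltr_nat R) (le_lt_trans (_ : _ <= t i))//.
    by have /andP[] := truncn_itv (t0 i).
  by rewrite /t ltr_pdivrMr// ltrBlDl.
exists [ffun i => Ordinal (tM i)] => i; rewrite ffunE /=.
have /andP[l r] := truncn_itv (t0 i).
have e : tnth x i = c + t i * s by rewrite /t divfK ?gt_eqF// addrC subrK.
rewrite e lerD2l ler_pM2r// l/= -addrA ltrD2l -[X in _ + X]mul1r -mulrDl ltr_pM2r//.
by rewrite natr1.
Qed.

Lemma grid_disjoint k k' x : grid_cube k x -> grid_cube k' x -> k = k'.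
Proof.
move=> h h'; apply/ffunP => i; apply/val_inj => /=.
have /andP[l r] := h i; have /andP[l' r'] := h' i.
have lt (a b : nat) : c + a%:R * s <= tnth x i -> tnth x i < c + b%:R * s + s -> (a <= b)%N.
  move=> l1 r1; rewrite -ltnS -(ltr_nat R) -(ltr_pM2r s0) -natr1 mulrDl mul1r.
  by move: l1 r1; lra.
by apply/eqP; rewrite eqn_leq !lt.
Qed.

End Grid.

Section Poincare.
Variables (R : realType) (N : nat) (p : R).
Hypothesis hN : (0 < N)%N.
Hypothesis hp : 1 < p.
Local Notation E := (euclidean R N).
Local Notation mu := (lebesgueN R N).
Local Notation d := (fun z : E * E => euclidean_dist z.1 z.2).
Local Notation lpe := (lp_energy p).
Local Notation lpeon := (lp_energy_on p).
Local Notation nre := (near_energy p).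

Let p0 : 0 < p. Proof. exact: lt_trans hp. Qed.

(** Iterates [poincare_step] along the diagonal: two successive cubes are made of near pairs because
    coordinates differ by at most 2s and N * 2s < 1. *)
Lemma energy_chain (s : R) K : 0 < s -> N%:R * (2 * s) < 1 ->
  exists2 D : R, 0 <= D & forall (V : E -> R) (a : 'I_N -> R), measurable_fun setT V ->
  (lpeon (cube a s) V <= D%:E * nre V +
     ((2 `^ p) ^+ K)%:E * lpeon (cube (fun i => a i + K%:R * s)%R s) V)%E.
Proof.
move=> s0 sN; elim: K => [|K [D D0 IH]].
  exists 0 => // V a mV; rewrite mul0e add0e expr0 mul1e.
  by rewrite (_ : (fun i => a i + 0%:R * s)%R = a)//; apply/funext => i; rewrite mul0r addr0.
pose m := s ^+ N; have m0 : 0 < m by rewrite exprn_gt0.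
exists (D + (2 `^ p) ^+ K * (2 `^ p / m)).
  by rewrite addr_ge0// !mulr_ge0// ?exprn_ge0 ?powR_ge0// invr_ge0 ltW.
move=> V a mV; apply: (le_trans (IH V a mV)).
have st := @poincare_step R N p hp V mV (cube (fun i => a i + K%:R * s) s)
  (cube (fun i => a i + K.+1%:R * s) s) m (measurable_cube _ _) (measurable_cube _ _) m0
  (lebesgueN_cube _ (ltW s0)) (lebesgueN_cube _ (ltW s0)).
have {}st := st _.
apply: (@le_trans _ _ (D%:E * nre V + ((2 `^ p) ^+ K)%:E *
   ((2 `^ p / m)%:E * nre V + (2 `^ p)%:E * lpeon (cube (fun i => a i + K.+1%:R * s)%R s) V))%E).
  apply: leeD2l; apply: lee_wpmul2l; first by rewrite lee_fin exprn_ge0 ?powR_ge0.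
  apply: st => -[x y] [/= hx hy]; rewrite /near_pairs/=.
  apply: le_lt_trans sN; apply: (@dist_le R N hN (x, y)) => /=.
    by rewrite mulr_ge0// ltW.
  move=> i; have /andP[l1 r1] := hx i; have /andP[l2 r2] := hy i.
  rewrite ler_norml; move: l1 r1 l2 r2; rewrite -natr1 mulrDl mul1r.
  by move: (K%:R * s) => k l1 r1 l2 r2; apply/andP; split; lra.
have := near_energy_ge0 p V; have := lp_energy_on_ge0 p V (cube (fun i => a i + K.+1%:R * s)%R s).
move: (nre V) (lpeon _ V) => g q q0 g0.
rewrite ge0_muleDr; last 2 first.
- by rewrite mule_ge0// lee_fin divr_ge0 ?powR_ge0// ltW.
- by rewrite mule_ge0// lee_fin powR_ge0.
rewrite !muleA -!EFinM addeA EFinD ge0_muleDl; last 2 first.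
- by rewrite lee_fin.
- by rewrite lee_fin !mulr_ge0// ?exprn_ge0 ?powR_ge0// invr_ge0 ltW.
by rewrite -exprSr.
Qed.

Lemma energy_le_sum_grid (c s : R) M (V : E -> R) : 0 < s -> measurable_fun setT V ->
  (forall x, ~ cube (fun=> c) (M%:R * s) x -> V x = 0) ->
  (lpe V <= \sum_(k : {ffun 'I_N -> 'I_M}) lpeon (grid_cube c s k) V)%E.
Proof.
move=> s0 mV V0; rewrite /lp_energy /lp_energy_on.
rewrite -ge0_integral_sum//; last first.
  move=> k; apply/measurable_EFinP; apply: measurable_energy_on => //.
  exact: measurable_cube.
apply: ge0_le_integral => //.
- by apply/measurable_EFinP; exact: measurable_powR_norm.
- apply: emeasurable_sum => k; apply/measurable_EFinP; apply: measurable_energy_on => //.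
  exact: measurable_cube.
move=> x _; rewrite sumEFin lee_fin.
have [/grid_cover[//|k kx]|/V0->] := pselect (cube (fun=> c) (M%:R * s) x); last first.
  by rewrite normr0 powR0 ?gt_eqF// sumr_ge0// => k _; rewrite mulr_ge0// powR_ge0.
rewrite (bigD1 k)//= indicE mem_set// mul1r lerDl.
by apply: sumr_ge0 => j _; rewrite mulr_ge0// powR_ge0.
Qed.

(** Starting from any cube of the grid, M hops along the diagonal lead out of the box, where [V] is
    0, and the remainder of the chain disappears. *)
Lemma poincare (c s : R) M : 0 < s -> N%:R * (2 * s) < 1 ->
  exists2 D : R, 0 <= D & forall V : E -> R, measurable_fun setT V ->
  (forall x, ~ cube (fun=> c) (M%:R * s) x -> V x = 0) ->
  (lpe V <= D%:E * nre V)%E.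
Proof.
move=> s0 sN; have [D D0 chain] := energy_chain M s0 sN.
exists (#|{ffun 'I_N -> 'I_M}|%:R * D); first by rewrite mulr_ge0.
move=> V mV V0; apply: (le_trans (energy_le_sum_grid s0 mV V0)).
apply: (@le_trans _ _ (\sum_(k : {ffun 'I_N -> 'I_M}) (D%:E * nre V))%E); last first.
  by rewrite sume_cst ?muleA// mule_ge0 ?near_energy_ge0.
apply: lee_sum => k _; apply: (le_trans (chain V _ mV)).
rewrite (_ : lpeon _ V = 0%E) ?mule0 ?adde0//.
apply: integral0_eq => x _; rewrite indicE; case: (boolP (x \in _)) => [/set_mem h|_]; last first.
  by rewrite mul0r.
rewrite V0 ?normr0 ?powR0 ?mulr0 ?gt_eqF// => B.
have := h (Ordinal hN); have := B (Ordinal hN).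
have : 0 <= (k (Ordinal hN))%:R * s by rewrite mulr_ge0// ltW.
move: (tnth x _) (_ * s) (M%:R * s) => t u v u0 /andP[_ h1] /andP[h2 _].
by move: h1 h2 u0; lra.
Qed.

End Poincare.

Section ZeroAverage.
Variables (R : realType) (N : nat) (p : R).
Hypothesis hN : (0 < N)%N.
Hypothesis hp : 1 < p.
Local Notation E := (euclidean R N).
Local Notation mu := (lebesgueN R N).
Local Notation d := (fun z : E * E => euclidean_dist z.1 z.2).
Local Notation lpe := (lp_energy p).
Local Notation lpeon := (lp_energy_on p).
Local Notation nre := (near_energy p).

Let p0 : 0 < p. Proof. exact: lt_trans hp. Qed.

(** Serves in place of Holder's inequality to bound a first moment by a p-th moment: when t > b the
    last term alone exceeds t, as (t/b)^(p-1) >= 1. *)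
Lemma young_split (b t : R) : 0 < b -> 0 <= t -> t <= b + b `^ (1 - p) * t `^ p.
Proof.
move=> b0 t0; have [le|lt] := leP t b.
  by rewrite (le_trans le)// lerDl mulr_ge0 ?powR_ge0.
have t1 : 0 < t := lt_trans b0 lt.
apply: (@le_trans _ _ (b `^ (1 - p) * t `^ p)); last by rewrite lerDr ltW.
have -> : t `^ p = t * t `^ (p - 1).
  by rewrite -{2}(powRr1 t0) -powRD ?gt_eqF ?implybT// addrC subrK.
rewrite mulrCA ler_peMr// -opprB powRN mulrC ler_pdivlMr ?powR_gt0// mul1r.
by apply: ge0_ler_powR; rewrite ?nnegrE ?subr_ge0; apply: ltW.
Qed.

Section Fixed.
Variables (V : E -> R) (Q : set E) (m : R).
Hypothesis mV : measurable_fun setT V.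
Hypothesis mQ : measurable Q.
Hypothesis m0 : 0 < m.
Hypothesis QE : mu Q = m%:E.
Hypothesis iV : mu.-integrable setT (fun x => (\1_Q x * V x)%:E).
Hypothesis V0 : (\int[mu]_x (\1_Q x * V x)%:E = 0)%E.

Let mI : measurable_fun setT (\1_Q : E -> R). Proof. exact: measurable_indic. Qed.

Let mD a : measurable_fun setT (fun y => \1_Q y * `|a - V y| `^ p).
Proof.
apply: measurable_funM => //; apply: measurable_powR_norm.
exact: measurable_funB.
Qed.

(** Mean zero gives m |a| = |integral of a - V over Q|. Applying [young_split] with b = |a|/2 makes
    the first term half of the left side, which is absorbed. *)
Lemma mean_zero_le (a : R) :
  ((m * `|a| `^ p)%:E <= (2 `^ p)%:E * \int[mu]_y (\1_Q y * `|a - V y| `^ p)%:E)%E.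
Proof.
have I0 : (0 <= \int[mu]_y (\1_Q y * `|a - V y| `^ p)%:E)%E.
  by apply: integral_ge0 => y _; rewrite lee_fin mulr_ge0// powR_ge0.
have [a0|a0] := eqVneq a 0.
  rewrite {1}a0 normr0 powR0 ?gt_eqF// mulr0.
  by apply: mule_ge0; [rewrite lee_fin powR_ge0|exact: I0].
pose b := `|a| / 2; have b0 : 0 < b by rewrite divr_gt0// normr_gt0.
have iI : mu.-integrable setT (fun x => (\1_Q x)%:E).
  apply/integrableP; split; first exact/measurable_EFinP.
  under eq_integral do rewrite abse_EFin ger0_norm//.
  by rewrite integral_indicN// QE ltry.
have iaI : mu.-integrable setT (fun x => (a * \1_Q x)%:E).
  apply: (eq_integrable measurableT (fun x => (a%:E * (\1_Q x)%:E)%E)) => [x _|].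
    by rewrite EFinM.
  exact: integrableZl.
have mean : (\int[mu]_x (\1_Q x * (a - V x))%:E = (a * m)%:E)%E.
  transitivity (\int[mu]_x ((a * \1_Q x)%:E - (\1_Q x * V x)%:E))%E.
    by apply: eq_integral => x _; rewrite -EFinB; congr EFin; ring.
  rewrite integralB// V0 sube0; under eq_integral do rewrite EFinM.
  by rewrite integralZl// integral_indicN// QE -EFinM.
have le1 : ((`|a| * m)%:E <= (b * m)%:E + (b `^ (1 - p))%:E *
    \int[mu]_y (\1_Q y * `|a - V y| `^ p)%:E)%E.
  have -> : ((`|a| * m)%:E = `|\int[mu]_x (\1_Q x * (a - V x))%:E|)%E.
    by rewrite mean abse_EFin normrM (gtr0_norm m0).
  have mf : measurable_fun setT (fun x => (\1_Q x * (a - V x))%:E).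
    apply/measurable_EFinP; apply: measurable_funM => //.
    exact: measurable_funB.
  apply: le_trans (le_abse_integral mu measurableT mf) _.
  have -> : ((b * m)%:E = \int[mu]_x (b * \1_Q x)%:E)%E.
    under eq_integral do rewrite EFinM.
    by rewrite integralZl// integral_indicN// QE -EFinM.
  have mG : measurable_fun setT (fun x => (\1_Q x * `|a - V x| `^ p)%:E).
    by apply/measurable_EFinP; exact: mD.
  have G0 x : setT x -> (0 <= (\1_Q x * `|a - V x| `^ p)%:E)%E.
    by move=> _; rewrite lee_fin mulr_ge0// powR_ge0.
  have bp0 : (0 <= (b `^ (1 - p))%:E :> \bar R)%E by rewrite lee_fin powR_ge0.
  have mB : measurable_fun setT (fun x => (b * \1_Q x)%:E).
    by apply/measurable_EFinP; exact: measurable_funM.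
  rewrite -(ge0_integralZl mu measurableT mG G0 bp0) -ge0_integralD//; last 3 first.
  - by move=> x _; rewrite lee_fin mulr_ge0// ltW.
  - by move=> x _; apply: mule_ge0 => //; exact: G0.
  - exact: measurable_funeM.
  apply: ge0_le_integral => //.
  - by apply: measurableT_comp.
  - apply: emeasurable_funD; first by apply/measurable_EFinP; exact: measurable_funM.
    by apply: measurable_funeM; exact/measurable_EFinP.
  move=> x _; rewrite abse_EFin -EFinM -EFinD lee_fin normrM.
  rewrite indicE; case: (x \in Q); last by rewrite normr0 !(mul0r, mulr0) addr0.
  by rewrite normr1 mulr1 !mul1r young_split.
case: (\int[mu]_y _)%E I0 le1 => [r| |]//; rewrite ?lee_fin; last first.
  by move=> _ _; rewrite gt0_muley ?leey// lte_fin powR_gt0.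
move=> r0 h.
have aE : `|a| = 2 * b by rewrite /b mulrCA divff ?mulr1.
have h2 : m * b <= b `^ (1 - p) * r by move: h; rewrite aE; lra.
have b1 : 0 < b `^ (p - 1) by rewrite powR_gt0.
have h3 : b `^ (p - 1) * (m * b) <= r.
  rewrite (le_trans (ler_wpM2l (ltW b1) h2))// mulrA -powRD; last first.
    by rewrite (gt_eqF b0) implybT.
  by rewrite addrA subrK subrr powRr0 mul1r.
have bE : b `^ p = b `^ (p - 1) * b.
  by rewrite -{3}(powRr1 (ltW b0)) -powRD ?subrK// (gt_eqF b0) implybT.
have -> : `|a| `^ p = 2 `^ p * (b `^ (p - 1) * b) by rewrite aE powRM ?(ltW b0)// bE.
by rewrite mulrCA ler_wpM2l ?powR_ge0// mulrCA.
Qed.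

(** Take a = V(x) in [mean_zero_le] and integrate over x in [Q]. *)
Lemma mean_zero_energy :
  (m%:E * lpeon Q V <= (2 `^ p)%:E *
    \int[(mu \x mu)%E]_z (\1_Q z.1 * \1_Q z.2 * difference p V z)%:E)%E.
Proof.
have mdz : measurable_fun setT (fun z : E * E => \1_Q z.1 * \1_Q z.2 * difference p V z).
  apply: measurable_funM; last exact: measurable_difference.
  apply: measurable_funM; first exact: (measurableT_comp mI measurable_fst).
  exact: (measurableT_comp mI measurable_snd).
have pos (z : E * E) : 0 <= \1_Q z.1 * \1_Q z.2 * difference p V z.
  by rewrite !mulr_ge0// difference_ge0.
rewrite fubini_tonelli1; last 2 first.
- exact/measurable_EFinP.
- by move=> z; rewrite lee_fin.
have mF : measurable_fun setT
    (fubini_F mu (fun z : E * E => (\1_Q z.1 * \1_Q z.2 * difference p V z)%:E)).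
  apply: measurable_fun_fubini_tonelli_F; first exact/measurable_EFinP.
  by move=> z; rewrite lee_fin.
have F0 x : (0 <= fubini_F mu (fun z : E * E => (\1_Q z.1 * \1_Q z.2 * difference p V z)%:E) x)%E.
  by apply: integral_ge0 => y _; rewrite lee_fin.
have p20 : (0 <= (2 `^ p)%:E :> \bar R)%E by rewrite lee_fin powR_ge0.
rewrite -(ge0_integralZl mu measurableT mF (fun x _ => F0 x) p20).
have mE : measurable_fun setT (fun x => (\1_Q x * `|V x| `^ p)%:E).
  by apply/measurable_EFinP; exact: measurable_energy_on.
have E0 x : setT x -> (0 <= (\1_Q x * `|V x| `^ p)%:E)%E.
  by rewrite lee_fin mulr_ge0// powR_ge0.
have mE0 : (0 <= m%:E)%E by rewrite lee_fin ltW.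
rewrite /lp_energy_on -(ge0_integralZl mu measurableT mE E0 mE0).
apply: ge0_le_integral => //.
- by move=> x _; apply: mule_ge0 => //; exact: E0.
- exact: measurable_funeM.
- exact: measurable_funeM.
move=> x _; rewrite /fubini_F /= /difference /=.
rewrite indicE; case: (x \in Q); last first.
  by rewrite mul0r mule0 mule_ge0 ?lee_fin ?powR_ge0// integral_ge0.
rewrite mul1r -EFinM; under eq_integral do rewrite mul1r.
exact: mean_zero_le.
Qed.

End Fixed.
End ZeroAverage.

(** * Vanishing dyadic averages at many scales force a large energy *)

Section MultiScale.
Variables (R : realType) (N : nat) (p : R).
Hypothesis hN : (0 < N)%N.
Hypothesis hp : 1 < p.
Local Notation E := (euclidean R N).
Local Notation mu := (lebesgueN R N).
Local Notation d := (fun z : E * E => euclidean_dist z.1 z.2).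
Local Notation lpe := (lp_energy p).
Local Notation lpeon := (lp_energy_on p).
Local Notation nre := (near_energy p).

Let p0 : 0 < p. Proof. exact: lt_trans hp. Qed.

Variables (c s : R) (M : nat).
Hypothesis s0 : 0 < s.
Hypothesis sN : N%:R * s < 1.

Definition dyadic_cube j (k : {ffun 'I_N -> 'I_(M * 2 ^ j)}) : set E :=
  grid_cube c (s / 2 ^+ j) k.

Let side j : 0 < s / 2 ^+ j. Proof. by rewrite divr_gt0// exprn_gt0. Qed.

Lemma measurable_dyadic_cube j k : measurable (@dyadic_cube j k).
Proof. exact: measurable_cube. Qed.

Lemma integrable_indicM (V : E -> R) (Q : set E) : measurable Q ->
  mu.-integrable setT (EFin \o V) -> mu.-integrable setT (fun x => (\1_Q x * V x)%:E).
Proof.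
move=> mQ iV; have mV := measurable_int _ iV.
apply: (le_integrable measurableT _ _ iV).
  apply/measurable_EFinP; apply: measurable_funM; first exact: measurable_indic.
  exact/measurable_EFinP.
move=> x _ /=; rewrite lee_fin normrM ler_piMl// indicE.
by case: (x \in Q); rewrite ?normr1 ?normr0.
Qed.

(** The prefactor is the one from [mean_zero_energy]: 2^p divided by the volume of the cube. *)
Let term (V : E -> R) j (k : {ffun 'I_N -> 'I_(M * 2 ^ j)}) (z : E * E) : R :=
  (2 `^ p / (s / 2 ^+ j) ^+ N) *
  (\1_(dyadic_cube k) z.1 * \1_(dyadic_cube k) z.2 * difference p V z).

Let term_ge0 V j k z : 0 <= @term V j k z.
Proof.
rewrite !mulr_ge0 ?powR_ge0 ?difference_ge0// invr_ge0 exprn_ge0//.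
exact: ltW.
Qed.

(** At each scale at most one cube contains both points, and only if 2^j <= N s / d. The weights
    (2^j / s)^N then form a geometric sum, at most 2 (N / d)^N, which is the kernel up to a constant
    that does not depend on the number of scales. *)
Let sum_term_le V n z : \sum_(j < n) \sum_k @term V j k z <=
  2 `^ p * (2 * N%:R ^+ N) * (\1_near_pairs z * (difference p V z / d z ^+ N)).
Proof.
have [d0|dn0] := eqVneq (d z) 0.
  have D0 : difference p V z = 0.
    by rewrite /difference (dist_eq0 d0) subrr normr0 powR0 ?gt_eqF.
  rewrite big1 => [|j _].
    apply: mulr_ge0; first by rewrite mulr_ge0 ?powR_ge0// mulr_ge0// exprn_ge0.
    exact: near_integrand_ge0.
  by rewrite big1// => k _; rewrite /term D0 !mulr0.
have dp : 0 < d z by rewrite lt_neqAle eq_sym dn0 dist_ge0.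
pose r := N%:R * s / d z.
have r0 : 0 <= r by rewrite divr_ge0 ?mulr_ge0// ltW.
have step (j : 'I_n) : \sum_k @term V j k z <=
    if 2 ^+ j <= r then 2 `^ p * difference p V z / s ^+ N * (2 ^+ j) ^+ N else 0.
  have [[k [k1 k2]]|no] := pselect (exists k, @dyadic_cube j k z.1 /\ @dyadic_cube j k z.2).
    have -> : 2 ^+ j <= r.
      rewrite ler_pdivlMr// mulrC -ler_pdivlMr ?exprn_gt0// -mulrA.
      apply: (@dist_le R N hN z); first exact: ltW.
      move=> i; have /andP[l1 r1] := k1 i; have /andP[l2 r2] := k2 i.
      rewrite ler_norml; move: l1 r1 l2 r2; move: (s / _) (c + _) => a b l1 r1 l2 r2.
      by apply/andP; split; lra.
    rewrite (bigD1 k)//= big1 ?addr0 => [|k' kk'].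
      rewrite /term !indicE !mem_set// !mul1r expr_div_n invf_div.
      rewrite le_eqVlt; apply/orP; left; apply/eqP.
      ring.
    rewrite /term (_ : \1_(dyadic_cube k') z.1 = 0) ?mul0r ?mulr0//.
    rewrite indicE memNset// => h; move/eqP: kk'; apply.
    exact: (grid_disjoint (side j) h k1).
  rewrite big1 => [|k _].
    case: ifP => // _; rewrite !mulr_ge0 ?powR_ge0 ?exprn_ge0// invr_ge0 exprn_ge0//.
    exact: ltW.
  rewrite /term; have [h1|h1] := pselect (dyadic_cube k z.1); last first.
    by rewrite (_ : \1_(dyadic_cube k) z.1 = 0) ?mul0r ?mulr0// indicE memNset.
  rewrite (_ : \1_(dyadic_cube k) z.2 = 0) ?mulr0 ?mul0r ?mulr0//.
  rewrite indicE memNset// => h2.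
  by apply: no; exists k.
apply: (le_trans (ler_sum _ (fun j _ => step j))).
rewrite -big_mkcond -mulr_sumr.
(* At distance 1 or more, [r] is below 1 and no scale contributes. *)
have [d1|d1] := ltP (d z) 1; last first.
  rewrite big_pred0 => [|j].
    rewrite mulr0; apply: mulr_ge0; last exact: near_integrand_ge0.
    by rewrite mulr_ge0 ?powR_ge0// mulr_ge0// exprn_ge0.
  apply/negbTE; rewrite -ltNge; apply: (@lt_le_trans _ _ 1); last exact: exprn_ege1 (ler1n _ 2).
  by rewrite ltr_pdivrMr// mul1r (lt_le_trans sN).
apply: (@le_trans _ _ (2 `^ p * difference p V z / s ^+ N * (2 * r ^+ N))).
  apply: ler_wpM2l; last exact: sum_pow2_le.
  rewrite !mulr_ge0 ?powR_ge0// invr_ge0 exprn_ge0//; exact: ltW.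
rewrite indicE mem_set// mul1r /r expr_div_n exprMn.
rewrite le_eqVlt; apply/orP; left; apply/eqP; field.
by rewrite !expf_neq0 ?gt_eqF.
Qed.

(** Each scale by itself bounds the whole L^p energy, by [mean_zero_energy] on each of its cubes,
    while all n scales together cost the near energy only once up to a constant. The factor n is a
    quantitative form of the compactness of the embedding in L^p. *)
Lemma zero_average_energy n (V : E -> R) : mu.-integrable setT (EFin \o V) ->
  (forall x, ~ cube (fun=> c) (M%:R * s) x -> V x = 0) ->
  (forall (j : 'I_n) k, (\int[mu]_x (\1_(@dyadic_cube j k) x * V x)%:E = 0)%E) ->
  (n%:R%:E * lpe V <= (2 `^ p * (2 * N%:R ^+ N))%:E * nre V)%E.
Proof.
move=> iV V0 avg; have mV : measurable_fun setT V.
  by apply/measurable_EFinP; exact: measurable_int iV.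
have mpair (j : 'I_n) k : measurable_fun setT
    (fun z : E * E => \1_(@dyadic_cube j k) z.1 * \1_(dyadic_cube k) z.2 * difference p V z).
  have mI : measurable_fun setT (\1_(dyadic_cube k) : E -> R).
    by apply: measurable_indic; exact: measurable_dyadic_cube.
  apply: measurable_funM; last exact: measurable_difference.
  apply: measurable_funM; first exact: (measurableT_comp mI measurable_fst).
  exact: (measurableT_comp mI measurable_snd).
have mterm' (j : 'I_n) k : measurable_fun setT (fun z => (@term V j k z)%:E).
  by apply/measurable_EFinP; apply: measurable_funM => //; exact: mpair.
have scale (j : 'I_n) : (lpe V <= \sum_k \int[(mu \x mu)%E]_z (@term V j k z)%:E)%E.
  have V0' x : ~ cube (fun=> c) ((M * 2 ^ j)%:R * (s / 2 ^+ j)) x -> V x = 0.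
    by rewrite natrM natrX mulrCA -mulrA divff ?mulr1 1?mulrC ?expf_neq0//; exact: V0.
  apply: (le_trans (energy_le_sum_grid hp (side j) mV V0')).
  apply: lee_sum => k _; have m0 : 0 < (s / 2 ^+ j) ^+ N by rewrite exprn_gt0.
  have h := mean_zero_energy hp mV (measurable_dyadic_cube k) m0
    (lebesgueN_cube _ (ltW (side j))) (integrable_indicM (measurable_dyadic_cube k) iV)
    (avg j k).
  have mi0 : (0 <= (((s / 2 ^+ j) ^+ N)^-1)%:E :> \bar R)%E by rewrite lee_fin invr_ge0 ltW.
  have := lee_wpmul2l mi0 h.
  rewrite muleA -EFinM mulVf ?gt_eqF// mul1e muleA -EFinM => /le_trans; apply.
  have K0 : 0 < ((s / 2 ^+ j) ^+ N)^-1 * 2 `^ p by rewrite mulr_gt0 ?powR_gt0// invr_gt0.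
  have mf : measurable_fun setT
      (fun z : E * E => (\1_(dyadic_cube k) z.1 * \1_(dyadic_cube k) z.2 * difference p V z)%:E).
    by apply/measurable_EFinP; exact: mpair.
  have f0 (z : E * E) : setT z -> (0 <= (\1_(dyadic_cube k) z.1 * \1_(dyadic_cube k) z.2 *
      difference p V z)%:E)%E by move=> _; rewrite lee_fin !mulr_ge0// difference_ge0.
  have K1 : (0 <= (((s / 2 ^+ j) ^+ N)^-1 * 2 `^ p)%:E :> \bar R)%E by rewrite lee_fin ltW.
  rewrite -(ge0_integralZl _ measurableT mf f0 K1).
  rewrite le_eqVlt; apply/orP; left; apply/eqP; apply: eq_integral => z _.
  by rewrite -EFinM /term [2 `^ p / _]mulrC.
apply: (@le_trans _ _ (\sum_(j < n) \sum_k \int[(mu \x mu)%E]_z (@term V j k z)%:E)%E).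
  rewrite -[X in X%:R%:E]card_ord -sume_cst; last first.
    by apply: integral_ge0 => x _; rewrite lee_fin powR_ge0.
  by apply: lee_sum => j _; exact: scale.
have t0 j k z : setT z -> (0 <= (@term V j k z)%:E)%E by rewrite lee_fin.
under eq_bigr => j _ do rewrite -(ge0_integral_sum _ measurableT (mterm' j) (@t0 j)).
rewrite -ge0_integral_sum//; last 2 first.
- by move=> j; exact: emeasurable_sum.
- by move=> j z _; apply: sume_ge0 => k _; exact: t0.
have mn : measurable_fun setT (fun z => (\1_near_pairs z * (difference p V z / d z ^+ N))%:E).
  by apply/measurable_EFinP; exact: measurable_near_integrand.
have n0 (z : E * E) : setT z -> (0 <= (\1_near_pairs z * (difference p V z / d z ^+ N))%:E)%E.
  by move=> _; rewrite lee_fin near_integrand_ge0.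
have K0 : (0 <= (2 `^ p * (2 * N%:R ^+ N))%:E :> \bar R)%E.
  by rewrite lee_fin mulr_ge0 ?powR_ge0// mulr_ge0// exprn_ge0.
rewrite /near_energy -(ge0_integralZl _ measurableT mn n0 K0).
apply: ge0_le_integral => //.
- by move=> z _; apply: sume_ge0 => j _; apply: sume_ge0 => k _; exact: t0.
- by apply: emeasurable_sum => j; exact: emeasurable_sum.
- exact: measurable_funeM.
move=> z _; under eq_bigr do rewrite sumEFin.
by rewrite sumEFin -EFinM lee_fin.
Qed.

End MultiScale.

(** * The space [X0] *)

Section PNorm.
Context d (T : measurableType d) (R : realType) (m : {measure set T -> \bar R}) (p : R).
Hypothesis p1 : 1 <= p.

Definition pnorm (f : T -> R) : R := fine (\int[m]_x (`|f x| `^ p)%:E)%E `^ p^-1.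

Lemma pnormE f : pnorm f = fine 'N[m]_p%:E[EFin \o f].
Proof. by rewrite unlock fine_poweR. Qed.

Lemma pnorm_triangle (f g : T -> R) : measurable_fun setT f -> measurable_fun setT g ->
  (\int[m]_x (`|f x| `^ p)%:E < +oo)%E -> (\int[m]_x (`|g x| `^ p)%:E < +oo)%E ->
  pnorm (f \+ g) <= pnorm f + pnorm g.
Proof.
move=> mf mg fo go; rewrite !pnormE.
have fin (h : T -> R) : (\int[m]_x (`|h x| `^ p)%:E < +oo)%E ->
    ('N[m]_p%:E[EFin \o h])%E \is a fin_num.
  by move=> ho; rewrite ge0_fin_numE ?Lnorm_ge0// unlock poweR_lty.
have := minkowski_EFin m mf mg p1.
have := fin f fo; have := fin g go; have := Lnorm_ge0 m p%:E (EFin \o (f \+ g)%R).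
move: ('N[m]_p%:E[EFin \o f])%E ('N[m]_p%:E[EFin \o g])%E => a b.
move: ('N[m]_p%:E[EFin \o (f \+ g)%R])%E => c.
by case: a => // a; case: b => // b; case: c.
Qed.
End PNorm.

Section AE.
Context (R : realType) (N : nat).
Local Notation E := (euclidean R N).
Local Notation mu := (lebesgueN R N).

Lemma ae_prod (P : E -> Prop) : {ae mu, forall x, P x} ->
  {ae (mu \x mu)%E, forall z, P z.1 /\ P z.2}.
Proof.
move=> [A [mA A0 PA]]; exists ((A `*` setT) `|` (setT `*` A)); split.
- by apply: measurableU; exact: measurableX.
- have m1 : measurable (A `*` [set: E]) by exact: measurableX.
  have m2 : measurable ([set: E] `*` A) by exact: measurableX.
  have z2 : ((mu \x mu) ([set: E] `*` A) = 0)%E by rewrite product_measure1E// [X in (_ * X)%E](_ : _ = 0%E) ?mule0.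
  have z1 : ((mu \x mu) (A `*` [set: E]) = 0)%E by rewrite product_measure1E// [X in (X * _)%E](_ : _ = 0%E) ?mul0e.
  exact: (etrans (measureU0 m1 m2 z2) z1).
- move=> z /= h; apply: contrapT => nz; apply: h; split; apply: contrapT => nP;
    apply: nz; [left|right]; split=> //; exact: PA.
Qed.

End AE.

Section Space.
Variables (R : realType) (N : nat) (p : R) (hp : 1 < p) (Omega : set 'rV[R]_N) (C rho : R).
Hypothesis hN : (0 < N)%N.
Hypothesis hOmega : bounded_domain Omega.
Hypothesis hC : 0 < C.
Local Notation E := (euclidean R N).
Local Notation mu := (lebesgueN R N).
Local Notation W := (X0 hp Omega C).
Local Notation d := (fun z : E * E => euclidean_dist z.1 z.2).

Let p0 : 0 < p. Proof. exact: lt_trans hp. Qed.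

Definition grid_side : R := (2 * N%:R + 1)^-1.

Lemma grid_side_gt0 : 0 < grid_side.
Proof. by rewrite invr_gt0 ltr_wpDl// mulr_ge0. Qed.

Lemma grid_side_lt : N%:R * (2 * grid_side) < 1.
Proof. by rewrite mulrCA mulrA ltr_pdivrMr ?mul1r ?ltrDl// ltr_wpDl// mulr_ge0. Qed.

Lemma box_exists : exists (c : R) (M : nat),
  Omega_points Omega `<=` cube (fun=> c) (M%:R * grid_side).
Proof.
have [_ _ _ [K [_ bO]]] := hOmega.
pose L := `|K| + 1; have KL : K < L by rewrite ltr_pwDr// ler_norm.
exists (- L), (Num.truncn (2 * L / grid_side)).+1 => x Ox i.
have : `|tnth x i| <= L.
  have := bO L KL _ Ox; apply: le_trans.
  rewrite [leRHS]/Num.norm /= mx_normrE; apply/bigmax_geP; right => /=.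
  by exists (ord0, i) => //=; rewrite mxE.
rewrite ler_norml => /andP[l1 l2]; rewrite l1/=.
have g0 : 0 < grid_side by exact: grid_side_gt0.
have t0 : 0 <= 2 * L / grid_side by rewrite divr_ge0 ?mulr_ge0 ?addr_ge0 ?(ltW g0).
have /andP[_] := truncn_itv t0; rewrite ltr_pdivrMr//; move: ((Num.truncn _).+1%:R * _) => t; lra.
Qed.

End Space.

Section EnergyAE.
Variables (R : realType) (N : nat) (p : R) (hp : 1 < p).
Local Notation E := (euclidean R N).
Local Notation mu := (lebesgueN R N).
Local Notation d := (fun z : E * E => euclidean_dist z.1 z.2).

Let p0 : 0 < p. Proof. exact: lt_trans hp. Qed.

Lemma near_energy_ae (f g : E -> R) : measurable_fun setT f -> measurable_fun setT g ->
  {ae mu, forall x, f x = g x} -> near_energy p f = near_energy p g.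
Proof.
move=> mf mg fg; apply: ge0_ae_eq_integral => //.
- by apply/measurable_EFinP; exact: measurable_near_integrand.
- by apply/measurable_EFinP; exact: measurable_near_integrand.
- by move=> z _; rewrite lee_fin near_integrand_ge0.
- by move=> z _; rewrite lee_fin near_integrand_ge0.
by apply: filterS (ae_prod fg) => z [f1 f2] _; rewrite /difference f1 f2.
Qed.

Lemma lp_energy_ae (f g : E -> R) : measurable_fun setT f -> measurable_fun setT g ->
  {ae mu, forall x, f x = g x} -> lp_energy p f = lp_energy p g.
Proof.
move=> mf mg fg; apply: ge0_ae_eq_integral => //.
- by apply/measurable_EFinP; exact: measurable_powR_norm.
- by apply/measurable_EFinP; exact: measurable_powR_norm.
by apply: filterS fg => x fgx _; rewrite fgx.
Qed.

Lemma near_energyZ t (f : E -> R) : measurable_fun setT f ->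
  near_energy p (fun x => t * f x) = ((`|t| `^ p)%:E * near_energy p f)%E.
Proof.
move=> mf; rewrite /near_energy.
have mn : measurable_fun setT (fun z => (\1_near_pairs z * (difference p f z / d z ^+ N))%:E).
  by apply/measurable_EFinP; exact: measurable_near_integrand.
have n0 (z : E * E) : setT z -> (0 <= (\1_near_pairs z * (difference p f z / d z ^+ N))%:E)%E.
  by move=> _; rewrite lee_fin near_integrand_ge0.
have K0 : (0 <= (`|t| `^ p)%:E :> \bar R)%E by rewrite lee_fin powR_ge0.
rewrite -(ge0_integralZl _ measurableT mn n0 K0); apply: eq_integral => z _.
rewrite -EFinM /difference -mulrBr normrM powRM//; congr EFin; ring.
Qed.

Lemma lp_energyZ t (f : E -> R) : measurable_fun setT f ->
  lp_energy p (fun x => t * f x) = ((`|t| `^ p)%:E * lp_energy p f)%E.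
Proof.
move=> mf; rewrite /lp_energy.
have mn : measurable_fun setT (fun x => (`|f x| `^ p)%:E).
  by apply/measurable_EFinP; exact: measurable_powR_norm.
have n0 (x : E) : setT x -> (0 <= (`|f x| `^ p)%:E)%E by rewrite lee_fin powR_ge0.
have K0 : (0 <= (`|t| `^ p)%:E :> \bar R)%E by rewrite lee_fin powR_ge0.
rewrite -(ge0_integralZl _ measurableT mn n0 K0); apply: eq_integral => z _.
by rewrite -EFinM normrM powRM.
Qed.

Lemma gagliardoE C (f : E -> R) : gagliardo p C f = (C%:E * near_energy p f)%E.
Proof.
rewrite /gagliardo integral_mkcond; congr (_ * _)%E; apply: eq_integral => z _.
by rewrite patchE indicE; case: (z \in _); rewrite ?mul1r ?mul0r.
Qed.

Section Norm.
Variables (C : R) (hC : 0 < C).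

(** The p-th root of the kernel: with it [X0_norm] becomes the L^p norm of [weighted_difference] on
    the product space, and the triangle inequality is Minkowski's. *)
Definition gagliardo_weight (z : E * E) : R := (C * (\1_near_pairs z * (d z ^+ N)^-1)) `^ p^-1.

Lemma measurable_gagliardo_weight : measurable_fun setT gagliardo_weight.
Proof.
apply: (measurableT_comp (measurable_powR p^-1)).
apply: measurable_funM => //; apply: measurable_funM; last exact: measurable_inv_dist.
by apply: measurable_indic; exact: measurable_near_pairs.
Qed.

Definition weighted_difference (f : E -> R) (z : E * E) : R :=
  (f z.1 - f z.2) * gagliardo_weight z.

Lemma measurable_weighted_difference f : measurable_fun setT f ->
  measurable_fun setT (weighted_difference f).
Proof.
move=> mf; apply: measurable_funM; last exact: measurable_gagliardo_weight.
apply: measurable_funB; first exact: (measurableT_comp mf measurable_fst).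
exact: (measurableT_comp mf measurable_snd).
Qed.

Lemma integral_weighted_difference f : measurable_fun setT f ->
  (\int[(mu \x mu)%E]_z (`|weighted_difference f z| `^ p)%:E = C%:E * near_energy p f)%E.
Proof.
move=> mf; rewrite /near_energy.
have mn : measurable_fun setT (fun z => (\1_near_pairs z * (difference p f z / d z ^+ N))%:E).
  by apply/measurable_EFinP; exact: measurable_near_integrand.
have n0 (z : E * E) : setT z -> (0 <= (\1_near_pairs z * (difference p f z / d z ^+ N))%:E)%E.
  by move=> _; rewrite lee_fin near_integrand_ge0.
have K0 : (0 <= C%:E :> \bar R)%E by rewrite lee_fin ltW.
rewrite -(ge0_integralZl _ measurableT mn n0 K0); apply: eq_integral => z _.
have w0 : 0 <= C * (\1_near_pairs z * (d z ^+ N)^-1).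
  by rewrite mulr_ge0 ?(ltW hC)// mulr_ge0// invr_ge0 exprn_ge0 ?dist_ge0.
rewrite -EFinM /weighted_difference normrM powRM// (ger0_norm (powR_ge0 _ _)).
rewrite /gagliardo_weight -powRrM mulVf ?gt_eqF// powRr1//.
by rewrite /difference; congr EFin; ring.
Qed.

End Norm.
End EnergyAE.

Section Representatives.
Variables (R : realType) (N : nat) (p : R) (hp : 1 < p) (Omega : set 'rV[R]_N) (C : R).
Hypothesis hC : 0 < C.
Local Notation E := (euclidean R N).
Local Notation mu := (lebesgueN R N).
Local Notation W := (X0 hp Omega C).
Local Notation F := (LfunType mu (exponent_ge1 hp)).
Local Notation nullf := (@Pilot.Defs.null_fun R N p hp).

Let p0 : 0 < p. Proof. exact: lt_trans hp. Qed.

Lemma X0_val_measurable (u : W) : measurable_fun setT (X0_val u).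
Proof. by rewrite /X0_val; case: (subquotient_repr _) => f [[]]. Qed.

Lemma X0_val_zero (u : W) : {ae mu, forall x, ~ Omega_points Omega x -> X0_val u x = 0}.
Proof. by have /set_mem[] := subquotient_reprP (u : subquotient _ _). Qed.

Lemma near_energy_lty (u : W) : (near_energy p (X0_val u) < +oo)%E.
Proof.
have /set_mem[_] := subquotient_reprP (u : subquotient _ _).
rewrite -/(X0_val u) gagliardoE; rewrite !ltey; apply: contra_neq => ->.
by rewrite gt0_muley// lte_fin.
Qed.

Lemma X0_funP (f : F) : {ae mu, forall x, ~ Omega_points Omega x -> f x = 0} ->
  (near_energy p f < +oo)%E -> f \in X0_fun Omega C.
Proof.
move=> f0 fo; rewrite inE; split=> //; rewrite gagliardoE.
by apply: (lte_mul_pinfty _ _ fo) => //; rewrite lee_fin ltW.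
Qed.

Definition X0_class (f : F) (fX : f \in X0_fun Omega C) : W := subquotient_class _ fX.

Lemma X0_val_class f (fX : f \in X0_fun Omega C) :
  {ae mu, forall x, X0_val (X0_class fX) x = f x}.
Proof.
have /set_mem := subquotient_repr_class nullf fX; apply: filterS => x h.
by apply/eqP; rewrite -subr_eq0; apply/eqP; exact: h.
Qed.

Lemma X0_valB (u v : W) : {ae mu, forall x, X0_val (u - v) x = X0_val u x - X0_val v x}.
Proof.
pose uX := subquotient_reprP (u : subquotient _ _).
pose vX := subquotient_reprP (v : subquotient _ _).
have uvX := rpredB uX vX.
have -> : u - v = X0_class uvX.
  have eu : subquotient_class nullf uX = u := subquotient_reprK u.
  have ev : subquotient_class nullf vX = v := subquotient_reprK v.
  have := subquotient_classB nullf uX vX uvX; rewrite eu ev; exact.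
exact: X0_val_class.
Qed.

Lemma X0_eq (u v : W) : u = v <-> {ae mu, forall x, X0_val u x = X0_val v x}.
Proof.
split=> [->|uv]; first exact: aeW.
pose uX := subquotient_reprP (u : subquotient _ _).
pose vX := subquotient_reprP (v : subquotient _ _).
have <- : subquotient_class nullf uX = u := subquotient_reprK u.
have <- : subquotient_class nullf vX = v := subquotient_reprK v.
apply/subquotient_class_eq; rewrite inE; apply: filterS uv => x h.
by apply/eqP; rewrite subr_eq0; apply/eqP.
Qed.

Lemma X0_scale_subproof t (u : W) :
  t *: (subquotient_repr (u : subquotient _ _) : F) \in X0_fun Omega C.
Proof.
apply: X0_funP.
  by apply: filterS (X0_val_zero u) => x h nx; rewrite /= [LHS](_ : _ = t * X0_val u x)// h// mulr0.
rewrite [X in near_energy p X](_ : _ = fun x => t * X0_val u x)//.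
rewrite (near_energyZ p t (X0_val_measurable u)).
have K0 : (0 <= (`|t| `^ p)%:E :> \bar R)%E by rewrite lee_fin powR_ge0.
exact: lte_mul_pinfty K0 (erefl _) (near_energy_lty u).
Qed.

Definition X0_scale t (u : W) : W := X0_class (X0_scale_subproof t u).

Lemma X0_val_scale t u : {ae mu, forall x, X0_val (X0_scale t u) x = t * X0_val u x}.
Proof. by apply: filterS (X0_val_class (X0_scale_subproof t u)) => x ->. Qed.

Lemma X0_val0 : {ae mu, forall x, X0_val (0 : W) x = 0}.
Proof. by rewrite -(subrr 0); apply: filterS (X0_valB 0 0) => x ->; rewrite subrr. Qed.

Lemma X0_valN (u : W) : {ae mu, forall x, X0_val (- u) x = - X0_val u x}.
Proof.
by rewrite -(sub0r u); apply: filterS2 (X0_valB 0 u) X0_val0 => x -> ->; rewrite sub0r.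
Qed.

Lemma X0_scale1 u : X0_scale 1 u = u.
Proof. by apply/X0_eq; apply: filterS (X0_val_scale 1 u) => x ->; rewrite mul1r. Qed.

Lemma X0_scale0 u : X0_scale 0 u = 0.
Proof.
by apply/X0_eq; apply: filterS2 (X0_val_scale 0 u) X0_val0 => x -> ->; rewrite mul0r.
Qed.

Lemma X0_scaleN1 u : X0_scale (-1) u = - u.
Proof.
by apply/X0_eq; apply: filterS2 (X0_val_scale (-1) u) (X0_valN u) => x -> ->; rewrite mulN1r.
Qed.

Lemma X0_scaleA a b u : X0_scale a (X0_scale b u) = X0_scale (a * b) u.
Proof.
apply/X0_eq; apply: filterS3 (X0_val_scale a (X0_scale b u)) (X0_val_scale b u)
  (X0_val_scale (a * b) u) => x -> -> ->; exact: mulrA.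
Qed.

Lemma X0_scaleB t (u v : W) : X0_scale t (u - v) = X0_scale t u - X0_scale t v.
Proof.
apply/X0_eq; apply: filterS2 (filterI (X0_val_scale t (u - v)) (X0_valB u v))
  (filterI (X0_valB (X0_scale t u) (X0_scale t v)) (filterI (X0_val_scale t u) (X0_val_scale t v))).
by move=> x [-> ->] [-> [-> ->]]; rewrite mulrBr.
Qed.

Lemma X0_scaleBl a b (u : W) : X0_scale (a - b) u = X0_scale a u - X0_scale b u.
Proof.
apply/X0_eq; apply: filterS2 (X0_val_scale (a - b) u)
  (filterI (X0_valB (X0_scale a u) (X0_scale b u)) (filterI (X0_val_scale a u) (X0_val_scale b u))).
by move=> x -> [-> [-> ->]]; rewrite mulrBl.
Qed.

Lemma X0_normE (u : W) : X0_norm u = pnorm (mu \x mu)%E p (weighted_difference p C (X0_val u)).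
Proof.
rewrite /X0_norm /pnorm (integral_weighted_difference hp hC (X0_val_measurable u)).
by rewrite gagliardoE.
Qed.

Lemma X0_norm_scale t (u : W) : X0_norm (X0_scale t u) = `|t| * X0_norm u.
Proof.
rewrite /X0_norm !gagliardoE (@near_energy_ae _ _ p _ (fun x => t * X0_val u x)).
- rewrite (near_energyZ p t (X0_val_measurable u)).
  have := near_energy_lty u; have := near_energy_ge0 p (X0_val u).
  case: (near_energy _ _) => // a; rewrite lee_fin => a0 _ /=.
  rewrite mulrCA powRM ?powR_ge0 ?mulr_ge0 ?(ltW hC)// -powRrM mulfV ?gt_eqF//.
  by rewrite powRr1.
- exact: (X0_val_measurable (X0_scale t u)).
- by apply: measurable_funM => //; exact: (X0_val_measurable u).
- exact: X0_val_scale.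
Qed.

Lemma X0_norm_triangle (u v : W) : X0_norm (u - v) <= X0_norm u + X0_norm v.
Proof.
have mU := X0_val_measurable u; have mV := X0_val_measurable v.
have fin (f : W) : (\int[(mu \x mu)%E]_z (`|weighted_difference p C (X0_val f) z| `^ p)%:E < +oo)%E.
  rewrite (integral_weighted_difference hp hC (X0_val_measurable f)).
  exact: lte_mul_pinfty (ltW hC : 0 <= C%:E)%E (erefl _) (near_energy_lty f).
rewrite -[X0_norm v]mul1r -(normrN1 R) -X0_norm_scale.
set v' := X0_scale (-1) v; rewrite !X0_normE.
have mW (w : W) : measurable_fun setT (weighted_difference p C (X0_val w)).
  exact: measurable_weighted_difference (X0_val_measurable w).
apply: le_trans (pnorm_triangle (ltW hp) (mW u) (mW v') (fin u) (fin v')).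
suff e : (\int[(mu \x mu)%E]_z (`|weighted_difference p C (X0_val (u - v)) z| `^ p)%:E =
    \int[(mu \x mu)%E]_z (`|(weighted_difference p C (X0_val u) \+
      weighted_difference p C (X0_val v')) z| `^ p)%:E)%E by rewrite /pnorm e.
apply: ge0_ae_eq_integral => //.
- by apply/measurable_EFinP; exact: measurable_powR_norm.
- by apply/measurable_EFinP; apply: measurable_powR_norm; exact: measurable_funD.
apply: filterS (ae_prod (filterI (X0_valB u v) (X0_val_scale (-1) v))) => z [[a1 a2] [b1 b2]] _.
congr EFin; congr (`|_| `^ _).
rewrite /weighted_difference /= a1 b1 a2 b2; ring.
Qed.

End Representatives.

Lemma finite_ball_meet (R : realType) (T : choiceType) (dist : T -> T -> R) (u : T)
    (s : seq (T * R)) :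
  (forall a b c, dist a c <= dist a b + dist b c) ->
  (forall i, i \in s -> dist u i.1 < i.2) ->
  exists2 e, 0 < e & forall v, dist v u < e -> forall i, i \in s -> dist v i.1 < i.2.
Proof.
move=> tri; elim: s => [|i s IH] h; first by exists 1.
have [|e e0 eh] := IH; first by move=> j js; apply: h; rewrite inE js orbT.
have iu : dist u i.1 < i.2 by apply: h; rewrite inE eqxx.
exists (Num.min e (i.2 - dist u i.1)); first by rewrite lt_min e0 subr_gt0.
move=> v; rewrite lt_min => /andP[v1 v2] j; rewrite inE => /predU1P[->|]; last exact: eh.
by apply: (le_lt_trans (tri v u i.1)); rewrite -ltrBrDr.
Qed.

(** * The norm topology and the vector operations *)

Section Topology.
Variables (R : realType) (N : nat) (p : R) (hp : 1 < p) (Omega : set 'rV[R]_N) (C : R).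
Hypothesis hC : 0 < C.
Local Notation W := (X0 hp Omega C).
Local Notation scale := (X0_scale hC).

Let p0 : 0 < p. Proof. exact: lt_trans hp. Qed.

Lemma X0_norm_ge0 (u : W) : 0 <= X0_norm u.
Proof. exact: powR_ge0. Qed.

Lemma X0_norm0 : X0_norm (0 : W) = 0.
Proof. by rewrite -(X0_scale0 hC 0) X0_norm_scale// normr0 mul0r. Qed.

Lemma X0_normN (u : W) : X0_norm (- u) = X0_norm u.
Proof. by rewrite -(X0_scaleN1 hC) X0_norm_scale// normrN1 mul1r. Qed.

Lemma X0_normB (u v : W) : X0_norm (u - v) = X0_norm (v - u).
Proof. by rewrite -X0_normN opprB. Qed.

Lemma X0_norm_split (v u w : W) : X0_norm (u - w) <= X0_norm (u - v) + X0_norm (v - w).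
Proof.
rewrite (X0_normB v w) (_ : u - w = (u - v) - (w - v)) ?X0_norm_triangle//.
by rewrite opprB addrA subrK.
Qed.

(** Balls were given only as a subbase; by the triangle inequality a finite intersection of balls
    contains a ball around each of its points. *)
Lemma nbhs_X0P (u : W) (A : set W) : nbhs u A <->
  exists2 e, 0 < e & [set v | X0_norm (v - u) < e] `<=` A.
Proof.
split=> [|[e e0 eA]].
  rewrite nbhsE => -[B [oB Bu] BA].
  have [D' D'D DB] := oB.
  have [S D'S Su] : (\bigcup_(i in D') i) u by rewrite DB.
  have [Z ZD ZS] := D'D S D'S.
  have [e e0 eS] : exists2 e, 0 < e & [set v | X0_norm (v - u) < e] `<=` S.
    have H := @finite_ball_meet R W (fun a b => X0_norm (a - b)) u (finmap.enum_fset Z)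
      (fun a b c => X0_norm_split b a c).
    rewrite -ZS in Su *; have [|e e0 eh] := H; first exact: Su.
    exists e; [exact: e0|move=> v ve i iZ; exact: (eh v ve i iZ)].
  exists e => // v /eS Sv; apply: BA; rewrite -DB; by exists S.
have : open [set v : W | X0_norm (v - u) < e].
  exists [set [set v : W | X0_norm (v - u) < e]]; last by rewrite bigcup_set1.
  by move=> S ->; exact: (finI_from1 _ (i := (u, e) : W * R)).
move=> o; apply: (@filterS _ _ (nbhs_filter u) _ _ eA); apply: open_nbhs_nbhs; split=> //=.
by rewrite subrr X0_norm0.
Qed.

Lemma X0_opp_continuous : continuous (-%R : W -> W).
Proof.
move=> u A /(nbhs_X0P (- u) A)[e e0 eA].
apply/(nbhs_X0P u (-%R @^-1` A)); exists e; first exact: e0.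
move=> v ve; apply: (eA (- v)); have : X0_norm (v - u) < e := ve.
by rewrite X0_normB /= opprK [- v + u]addrC.
Qed.

Lemma X0_scale_cvg (t : R) (u : W) :
  (fun z : W * R => scale z.2 z.1) @ (u, t) --> scale t u.
Proof.
move=> A /(nbhs_X0P (scale t u) A)[e e0 eA].
have [y yE] : exists y, y = X0_norm u by exists (X0_norm u).
have y0 : 0 <= y by rewrite yE; exact: X0_norm_ge0.
have t0 := normr_ge0 t.
(* From sv - tu = s(v - u) + (s - t)u: [a] controls the first term, as |s| <= |t| + 1, and [b] the
   second. *)
pose a := e / 2 / (`|t| + 1); pose b := Num.min 1 (e / 2 / (y + 1)).
have a0 : 0 < a by rewrite !divr_gt0// ltr_wpDl.
have b0 : 0 < b by rewrite lt_min ltr01 !divr_gt0// ltr_wpDl.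
exists ([set v : W | X0_norm (v - u) < a], ball t b).
  split; last exact: nbhsx_ballx.
  by apply/(nbhs_X0P u); exists a; [exact: a0|move=> v; apply].
move=> [v s] [va sb]; apply: (eA (scale s v)).
have {}va : X0_norm (v - u) < a := va.
have /andP[s1 s2] : (`|t - s| < 1) && (`|t - s| < e / 2 / (y + 1)).
  by rewrite -lt_min; exact: sb.
have := X0_norm_split (scale s u) (scale s v) (scale t u).
rewrite -X0_scaleB -X0_scaleBl !X0_norm_scale// -yE => /le_lt_trans; apply.
have := X0_norm_ge0 (v - u); move: (X0_norm (v - u)) va => x xa x0.
have st : `|s| <= `|t| + 1.
  rewrite -[s](subrK t) addrC (le_trans (ler_normD _ _))// lerD2l distrC; exact: ltW.
have h1 : `|s| * x < e / 2.
  apply: (@le_lt_trans _ _ ((`|t| + 1) * x)); first exact: ler_wpM2r.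
  by rewrite mulrC -ltr_pdivlMr// ltr_wpDl.
have h2 : `|s - t| * y <= e / 2.
  rewrite distrC; apply: (@le_trans _ _ (`|t - s| * (y + 1))).
    by apply: ler_wpM2l => //; rewrite lerDl.
  by rewrite -ler_pdivlMr ?ltr_wpDl// ltW.
by move: h1 h2; move: (`|s| * x) (`|s - t| * y) => h h' h1 h2; lra.
Qed.

Lemma X0_lipschitz_continuous (f : W -> R) (K : R) :
  (forall u v, `|f v - f u| <= K * X0_norm (v - u)) -> continuous f.
Proof.
move=> fK u; apply/(cvgrPdist_lt (FF := nbhs_filter u)) => e e0.
apply/(nbhs_X0P u [set v | `|f u - f v| < e]).
have K0 : 0 < `|K| + 1 by rewrite ltr_wpDl.
exists (e / (`|K| + 1)); first exact: divr_gt0.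
move=> v; have := fK u v; have := X0_norm_ge0 (v - u); rewrite distrC /=.
move: (X0_norm (v - u)) => x x0 h; rewrite ltr_pdivlMr// => xe; apply: (le_lt_trans h).
apply: le_lt_trans xe; rewrite mulrC; apply: ler_wpM2l => //.
by rewrite (le_trans (ler_norm K))// lerDl.
Qed.

End Topology.

(** The integral of a nonnegative function is a supremum over simple functions below it, so a
    pointwise comparison of the functions extended by 0 compares integrals over different
    domains. *)
Lemma ge0_le_integral_patch d (T : measurableType d) (R : realType) (m : {measure set T -> \bar R})
    (D D' : set T) (f g : T -> \bar R) :
  (forall x, D x -> 0 <= f x)%E -> (forall x, D' x -> 0 <= g x)%E ->
  (forall x, (f \_ D) x <= (g \_ D') x)%E ->
  (\int[m]_(x in D) f x <= \int[m]_(x in D') g x)%E.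
Proof.
move=> f0 g0 fg; rewrite (ge0_integralE m f0) (ge0_integralE m g0) /=.
apply: le_ereal_sup => _ [h /= hf <-]; exists h => //= x.
exact: le_trans (hf x) (fg x).
Qed.

Lemma cvg_powR_ge0 (R : realType) (I : Type) (F : set_system I) (FF : Filter F)
    (f : I -> R) (a p : R) : 0 < p -> (forall i, 0 <= f i) -> 0 <= a ->
  f @ F --> a -> (fun i => f i `^ p) @ F --> a `^ p.
Proof.
move=> p0 f0; rewrite le_eqVlt => /predU1P[<-|a0] fa; last first.
  pose g i := Num.max (f i) (a / 2).
  have a2 : 0 < a / 2 by rewrite divr_gt0.
  have fg : \forall i \near F, g i = f i.
    move/cvgrPdist_lt: fa => /(_ _ a2); apply: filterS => i; rewrite ltr_norml => /andP[_ h].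
    by apply/max_idPl; move: h; lra.
  have ga : g @ F --> a.
    by apply: cvg_trans fa; apply: near_eq_cvg; apply: filterS fg => i ->.
  have gp : (fun i => g i `^ p) @ F --> a `^ p.
    apply: (cvg_powR FF _ a0 ga); last exact: cvg_cst.
    by move=> i; rewrite lt_max a2 orbT.
  by apply: cvg_trans gp; apply: near_eq_cvg; apply: filterS fg => i /= ->.
rewrite powR0 ?gt_eqF//; apply/cvgrPdist_lt => e e0.
have e1 : 0 < e `^ p^-1 by rewrite powR_gt0.
move/cvgrPdist_lt: fa => /(_ _ e1); apply: filterS => i; rewrite !sub0r !normrN.
rewrite !ger0_norm ?powR_ge0// => /(gt0_ltr_powR p0); rewrite !nnegrE -powRrM mulVf ?gt_eqF//.
by rewrite powRr1 ?(ltW e0)//; apply; rewrite ?powR_ge0.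
Qed.

(** * The constraint functional *)

Section JFunctional.
Variables (R : realType) (N : nat) (p : R) (hp : 1 < p) (Omega : set 'rV[R]_N) (C : R).
Hypothesis hN : (0 < N)%N.
Hypothesis hOmega : bounded_domain Omega.
Hypothesis hC : 0 < C.
Local Notation E := (euclidean R N).
Local Notation mu := (lebesgueN R N).
Local Notation W := (X0 hp Omega C).
Local Notation scale := (X0_scale hC).

Let p0 : 0 < p. Proof. exact: lt_trans hp. Qed.

Lemma X0_val_box c h (u : W) : Omega_points Omega `<=` cube (fun=> c) h ->
  {ae mu, forall x, X0_val u x = \1_(cube (fun=> c) h) x * X0_val u x}.
Proof.
move=> box; apply: filterS (X0_val_zero u) => x u0; rewrite indicE.
case: (boolP (x \in _)) => [_|/negP xB]; first by rewrite mul1r.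
by rewrite mul0r u0// => Ox; apply: xB; apply: mem_set; exact: box.
Qed.

Lemma measurable_box c h (u : W) :
  measurable_fun setT (fun x => \1_(cube (fun=> c) h) x * X0_val u x).
Proof.
apply: measurable_funM; last exact: (X0_val_measurable u).
by apply: measurable_indic; exact: measurable_cube.
Qed.

Lemma X0_poincare : exists2 D : R, 0 <= D & forall u : W,
  (lp_energy p (X0_val u) <= D%:E * near_energy p (X0_val u))%E.
Proof.
have [c [M box]] := box_exists hOmega.
have [D D0 HD] := poincare hN hp c M (grid_side_gt0 R N) (grid_side_lt R N).
exists D => // u.
have mU := X0_val_measurable u; have mV := measurable_box c (M%:R * grid_side R N) u.
rewrite (lp_energy_ae p mU mV (X0_val_box u box)) (near_energy_ae p mU mV (X0_val_box u box)).
by apply: HD => // x xB; rewrite indicE memNset// mul0r.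
Qed.

Lemma lp_energy_lty (u : W) : (lp_energy p (X0_val u) < +oo)%E.
Proof.
have [D D0 HD] := X0_poincare; apply: le_lt_trans (HD u) _.
exact: lte_mul_pinfty (D0 : 0 <= D%:E)%E (erefl _) (near_energy_lty hC u).
Qed.

Lemma lp_energy_ge0 (V : E -> R) : (0 <= lp_energy p V)%E.
Proof. by apply: integral_ge0 => x _; rewrite lee_fin powR_ge0. Qed.

Lemma J_lp_energy (u : W) : J_functional u = p^-1 * fine (lp_energy p (X0_val u)).
Proof.
rewrite /J_functional /Rintegral /lp_energy; congr (_ * fine _).
have mU := X0_val_measurable u.
have mE : measurable_fun setT (fun x => (`|X0_val u x| `^ p)%:E).
  by apply/measurable_EFinP; exact: measurable_powR_norm.
have E0 x : (0 <= (`|X0_val u x| `^ p)%:E)%E by rewrite lee_fin powR_ge0.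
apply/eqP; rewrite eq_le; apply/andP; split.
  by apply: ge0_le_integral_patch => // x; rewrite !patchE in_setT; case: ifP.
(* A representative vanishes outside Omega only almost everywhere, so the exceptional null set is
   removed before comparing. *)
have [A [mA A0 zA]] := X0_val_zero u.
rewrite (ge0_negligible_integral mA measurableT mE _ A0)//.
apply: ge0_le_integral_patch => // x; rewrite !patchE.
case: ifPn => [/set_mem[_ xA]|_]; last by case: ifP.
case: ifPn => // /negP xO; rewrite (_ : X0_val u x = 0).
  by rewrite normr0 powR0// gt_eqF.
apply: contrapT => u0; apply: xA; apply: zA => /= h; apply: u0; apply: h => Ox.
by apply: xO; exact: mem_set.
Qed.

Lemma lp_energy_gt0 (u : W) : u <> 0 -> (0 < lp_energy p (X0_val u))%E.
Proof.
move=> u0; rewrite lt_neqAle lp_energy_ge0 andbT; apply/eqP => e; apply: u0.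
have mU := X0_val_measurable u.
have mE : measurable_fun setT (fun x => (`|X0_val u x| `^ p)%:E).
  by apply/measurable_EFinP; exact: measurable_powR_norm.
apply/(X0_eq u 0); have : (\int[mu]_x `|(`|X0_val u x| `^ p)%:E| = 0)%E.
  by rewrite [RHS]e; apply: eq_integral => x _; rewrite gee0_abs// lee_fin powR_ge0.
move=> /(ae_eq_integral_abs _ measurableT mE) h.
apply: filterS2 h (X0_val0 hp Omega C) => x h ->; have := h I => -[] /powR_eq0_eq0 /eqP.
by rewrite normr_eq0 => /eqP.
Qed.

Lemma J_gt0 (u : W) : u <> 0 -> 0 < J_functional u.
Proof.
move=> /lp_energy_gt0 e0; rewrite J_lp_energy mulr_gt0 ?invr_gt0//.
by have := lp_energy_lty u; move: e0; case: (lp_energy _ _) => // r; rewrite lte_fin.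
Qed.

Lemma J_scale t (u : W) : J_functional (scale t u) = `|t| `^ p * J_functional u.
Proof.
rewrite !J_lp_energy (lp_energy_ae p (X0_val_measurable _)
  (measurable_funM (measurable_cst t) (X0_val_measurable u)) (X0_val_scale hC t u)).
rewrite lp_energyZ; last exact: (X0_val_measurable u).
have := lp_energy_lty u; have := lp_energy_ge0 (X0_val u).
by case: (lp_energy _ _) => // r _ _ /=; exact: mulrCA.
Qed.

(** Minkowski's inequality, then the Poincare inequality. *)
Lemma lp_norm_lipschitz : exists2 K : R, 0 <= K & forall u v : W,
  `|pnorm mu p (X0_val v) - pnorm mu p (X0_val u)| <= K * X0_norm (v - u).
Proof.
have [D D0 HD] := X0_poincare; exists ((D / C) `^ p^-1); first exact: powR_ge0.
have bound (w : W) : pnorm mu p (X0_val w) <= (D / C) `^ p^-1 * X0_norm w.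
  rewrite /pnorm -/(lp_energy p (X0_val w)) /X0_norm gagliardoE.
  have := HD w; have := near_energy_lty hC w; have := near_energy_ge0 p (X0_val w).
  have := lp_energy_ge0 (X0_val w).
  case: (lp_energy _ _) => // l; case: (near_energy _ _) => // g; rewrite !lee_fin => l0 g0 _ lg /=.
  have DC0 : 0 <= D / C by rewrite divr_ge0// ltW.
  have Cg0 : 0 <= C * g by rewrite mulr_ge0// ltW.
  rewrite -powRM//; apply: ge0_ler_powR; rewrite ?nnegrE ?invr_ge0 ?(ltW p0)//.
    exact: mulr_ge0.
  by rewrite mulrA divfK ?gt_eqF.
have tri (u v : W) : pnorm mu p (X0_val v) - pnorm mu p (X0_val u) <= pnorm mu p (X0_val (v - u)).
  rewrite lerBlDr.
  apply: le_trans (pnorm_triangle (ltW hp) (X0_val_measurable (v - u)) (X0_val_measurable u)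
    (lp_energy_lty (v - u)) (lp_energy_lty u)).
  rewrite /pnorm -!/(lp_energy p _) (lp_energy_ae p (X0_val_measurable v)
    (measurable_funD (X0_val_measurable (v - u)) (X0_val_measurable u)))//.
  by apply: filterS (X0_valB v u) => x /= ->; rewrite subrK.
move=> u v; rewrite ler_norml; apply/andP; split; last exact: le_trans (tri u v) (bound _).
rewrite lerNl opprB (X0_normB hC); exact: le_trans (tri v u) (bound _).
Qed.

Lemma J_continuous : continuous (@J_functional R N p hp Omega C).
Proof.
have [K K0 HK] := lp_norm_lipschitz.
have -> : @J_functional R N p hp Omega C = fun u => p^-1 * pnorm mu p (X0_val u) `^ p.
  apply/funext => u; rewrite J_lp_energy /pnorm -powRrM mulVf ?gt_eqF// powRr1//.
  by have := lp_energy_ge0 (X0_val u); rewrite /lp_energy; case: (integral _ _ _).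
have cn := X0_lipschitz_continuous hC HK.
move=> u; have nf := nbhs_filter u; apply: cvgM; first exact: cvg_cst.
apply: (cvg_powR_ge0 nf p0); last exact: (cn u).
  by move=> v; exact: powR_ge0.
exact: powR_ge0.
Qed.

End JFunctional.

(** * The energy *)

Section Energy.
Variables (R : realType) (N : nat) (p : R) (hp : 1 < p).
Local Notation E := (euclidean R N).
Local Notation mu := (lebesgueN R N).
Local Notation d := (fun z : E * E => euclidean_dist z.1 z.2).

Let p0 : 0 < p. Proof. exact: lt_trans hp. Qed.

Lemma signed_powerM (a : R) : @signed_power R p a * a = `|a| `^ p.
Proof.
rewrite /signed_power; have [->|a0] := eqVneq a 0.
  by rewrite mulr0 normr0 powR0// gt_eqF.
rewrite -mulrA -expr2 -real_normK ?num_real// -powR_mulrn// -powRD ?subrK//.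
by rewrite normr_eq0 a0 implybT.
Qed.

Definition far_integrand (V : E -> R) (z : E * E) : R :=
  \1_far_pairs z * ((d z ^+ N)^-1 *
    (difference p V z - `|V z.1| `^ p - `|V z.2| `^ p)).

Definition far_energy (V : E -> R) : \bar R := (\int[(mu \x mu)%E]_z (far_integrand V z)%:E)%E.

Lemma measurable_far_pairs : measurable (far_pairs : set (E * E)).
Proof.
have -> : (far_pairs : set (E * E)) = ~` near_pairs.
  by apply/seteqP; split=> z; rewrite /far_pairs /near_pairs/= leNgt => /negP.
by apply: measurableC; exact: measurable_near_pairs.
Qed.

Lemma measurable_far_integrand V : measurable_fun setT V ->
  measurable_fun setT (far_integrand V).
Proof.
move=> mV; apply: measurable_funM; first by apply: measurable_indic; exact: measurable_far_pairs.
apply: measurable_funM; first exact: measurable_inv_dist.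
have mP : measurable_fun setT (fun x => `|V x| `^ p) by exact: measurable_powR_norm.
apply: measurable_funB; last exact: (measurableT_comp mP measurable_snd).
apply: measurable_funB; first exact: measurable_difference.
exact: (measurableT_comp mP measurable_fst).
Qed.

Lemma far_energy_ae V V' : measurable_fun setT V -> measurable_fun setT V' ->
  {ae mu, forall x, V x = V' x} -> far_energy V = far_energy V'.
Proof.
move=> mV mV' VV'; apply: ae_eq_integral => //.
- by apply/measurable_EFinP; exact: measurable_far_integrand.
- by apply/measurable_EFinP; exact: measurable_far_integrand.
apply: filterS (ae_prod VV') => z [f1 f2] _.
by rewrite /far_integrand /difference f1 f2.
Qed.

Section Bounded.
Variables (B : set E) (b : R) (V : E -> R).
Hypothesis mB : measurable B.
Hypothesis muB : mu B = b%:E.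
Hypothesis mV : measurable_fun setT V.
Hypothesis V0 : forall x, ~ B x -> V x = 0.
Hypothesis Vfin : (lp_energy p V < +oo)%E.

(** If one point is outside [B], the function vanishes there and the three terms cancel. So only
    pairs in [B] times [B] count, and on far pairs the kernel is at most 1. This cancellation makes
    the far integral converge. *)
Lemma far_integrand_le z : `|far_integrand V z| <=
  (2 `^ p + 1) * (`|V z.1| `^ p * \1_B z.2 + \1_B z.1 * `|V z.2| `^ p).
Proof.
have P x : 0 <= `|V x| `^ p by exact: powR_ge0.
have c1 : 0 <= 2 `^ p + 1 :> R by rewrite addr_ge0 ?powR_ge0.
have rhs0 : 0 <= (2 `^ p + 1) * (`|V z.1| `^ p * \1_B z.2 + \1_B z.1 * `|V z.2| `^ p).
  by rewrite mulr_ge0// addr_ge0// mulr_ge0.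
rewrite /far_integrand indicE; case: (boolP (z \in far_pairs)) => [/set_mem far|_]; last first.
  by rewrite mul0r normr0.
have d1 : `|(d z ^+ N)^-1| <= 1.
  rewrite ger0_norm ?invr_ge0 ?exprn_ge0 ?dist_ge0// invf_le1 ?exprn_gt0 ?exprn_ege1//.
  exact: lt_le_trans far.
rewrite mul1r normrM; apply: (@le_trans _ _ `|difference p V z - `|V z.1| `^ p - `|V z.2| `^ p|).
  by rewrite ler_piMl.
have z0 : `|0 : R| `^ p = 0 by rewrite normr0 powR0// gt_eqF.
have [B1|B1] := pselect (B z.1); last first.
  by rewrite /difference (V0 B1) z0 sub0r normrN subr0 subrr normr0 in rhs0 *.
have [B2|B2] := pselect (B z.2); last first.
  by rewrite /difference (V0 B2) z0 !subr0 subrr normr0 in rhs0 *.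
rewrite !indicE !mem_set// mulr1 mul1r.
have := powR_sub_le hp (V z.1 - V z.2) (- V z.2).
rewrite opprK subrK normrN -/(difference p V z) => h.
have := difference_ge0 p V z; have := P z.1; have := P z.2; move: h.
move: (difference _ _ _) (`|V z.1| `^ p) (`|V z.2| `^ p) => x y t h t0 y0 x0.
by rewrite ler_norml mulrDl mul1r; apply/andP; split; lra.
Qed.

Lemma integral_far_integrand_le :
  (\int[(mu \x mu)%E]_z `|(far_integrand V z)%:E| <=
    ((2 `^ p + 1) * (2 * b))%:E * lp_energy p V)%E.
Proof.
have mI : measurable_fun setT (\1_B : E -> R) by exact: measurable_indic.
have mP : measurable_fun setT (fun x => `|V x| `^ p) by exact: measurable_powR_norm.
have P x : 0 <= `|V x| `^ p by exact: powR_ge0.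
have I x : 0 <= \1_B x :> R by [].
have m1 : measurable_fun setT (fun z : E * E => `|V z.1| `^ p * \1_B z.2).
  apply: measurable_funM; first exact: (measurableT_comp mP measurable_fst).
  exact: (measurableT_comp mI measurable_snd).
have m2 : measurable_fun setT (fun z : E * E => \1_B z.1 * `|V z.2| `^ p).
  apply: measurable_funM; first exact: (measurableT_comp mI measurable_fst).
  exact: (measurableT_comp mP measurable_snd).
have c1 : 0 <= 2 `^ p + 1 :> R by rewrite addr_ge0 ?powR_ge0.
apply: (@le_trans _ _ (\int[(mu \x mu)%E]_z ((2 `^ p + 1)%:E *
    (`|V z.1| `^ p * \1_B z.2 + \1_B z.1 * `|V z.2| `^ p)%:E))%E).
  apply: ge0_le_integral => //.
  - apply: measurableT_comp => //; apply/measurable_EFinP.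
    exact: measurable_far_integrand.
  - by apply: measurable_funeM; apply/measurable_EFinP; exact: measurable_funD.
  by move=> z _; rewrite -EFinM abse_EFin lee_fin far_integrand_le.
have mS : measurable_fun setT (fun z : E * E =>
    (`|V z.1| `^ p * \1_B z.2 + \1_B z.1 * `|V z.2| `^ p)%:E).
  by apply/measurable_EFinP; exact: measurable_funD.
have S0 (z : E * E) : setT z -> (0 <= (`|V z.1| `^ p * \1_B z.2 + \1_B z.1 * `|V z.2| `^ p)%:E)%E.
  by move=> _; rewrite lee_fin addr_ge0// mulr_ge0.
have c1' : (0 <= (2 `^ p + 1)%:E :> \bar R)%E by rewrite lee_fin.
rewrite (ge0_integralZl _ measurableT mS S0 c1').
have -> : (\int[(mu \x mu)%E]_z (`|V z.1| `^ p * \1_B z.2 + \1_B z.1 * `|V z.2| `^ p)%:E =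
    \int[(mu \x mu)%E]_z (`|V z.1| `^ p * \1_B z.2)%:E +
    \int[(mu \x mu)%E]_z (\1_B z.1 * `|V z.2| `^ p)%:E)%E.
  under eq_integral do rewrite EFinD.
  by apply: ge0_integralD => //; try (by move=> z _; rewrite lee_fin mulr_ge0);
    exact/measurable_EFinP.
rewrite (integral_prod mu mu mP mI P I) (integral_prod mu mu mI mP I P).
rewrite integral_indicN// muB -/(lp_energy p V).
have := @lp_energy_ge0 R N p V; move: Vfin; case: (lp_energy p V) => // r _ _.
by rewrite -!EFinM lee_fin; lra.
Qed.

Lemma far_energy_integrable : (mu \x mu)%E.-integrable setT (EFin \o far_integrand V).
Proof.
apply/integrableP; split; first by apply/measurable_EFinP; exact: measurable_far_integrand.
apply: le_lt_trans integral_far_integrand_le _.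
have b0 : 0 <= b by rewrite -lee_fin -muB measure_ge0.
have k0 : (0 <= ((2 `^ p + 1) * (2 * b))%:E)%E.
  by rewrite lee_fin mulr_ge0 ?addr_ge0 ?powR_ge0// mulr_ge0.
exact: lte_mul_pinfty k0 (erefl _) Vfin.
Qed.

Lemma far_energy_fin_num : far_energy V \is a fin_num.
Proof. exact: integrable_fin_num far_energy_integrable. Qed.

Lemma far_energy_bound :
  `|fine (far_energy V)| <= (2 `^ p + 1) * (2 * b) * fine (lp_energy p V).
Proof.
have mF : measurable_fun setT (fun z => (far_integrand V z)%:E).
  by apply/measurable_EFinP; exact: measurable_far_integrand.
have := le_trans (le_abse_integral _ measurableT mF) integral_far_integrand_le.
have := far_energy_fin_num; rewrite /far_energy; case: (integral _ _ _) => // x _.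
by have := @lp_energy_ge0 R N p V; move: Vfin; case: (lp_energy p V) => // r _ _.
Qed.

Lemma far_energyZ t : far_energy (fun x => t * V x) = ((`|t| `^ p)%:E * far_energy V)%E.
Proof.
rewrite /far_energy -(integralZl measurableT far_energy_integrable).
apply: eq_integral => z _; rewrite /far_integrand /difference -mulrBr !normrM !powRM//.
by rewrite -EFinM; congr EFin; ring.
Qed.

End Bounded.
End Energy.

Section IFunctional.
Variables (R : realType) (N : nat) (p : R) (hp : 1 < p) (Omega : set 'rV[R]_N) (C rho : R).
Hypothesis hN : (0 < N)%N.
Hypothesis hOmega : bounded_domain Omega.
Hypothesis hC : 0 < C.
Local Notation E := (euclidean R N).
Local Notation mu := (lebesgueN R N).
Local Notation W := (X0 hp Omega C).
Local Notation scale := (X0_scale hC).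
Local Notation Ifun := (@I_functional R N p hp Omega C rho).
Local Notation d := (fun z : E * E => euclidean_dist z.1 z.2).

Let p0 : 0 < p. Proof. exact: lt_trans hp. Qed.

Lemma I_functionalE (u : W) : Ifun u = p^-1 * (C / 2 * fine (near_energy p (X0_val u)) +
  C / 2 * fine (far_energy p (X0_val u)) + rho * fine (lp_energy p (X0_val u))).
Proof.
rewrite /I_functional /energy /Rintegral; congr (_ * (_ * fine _ + _ * fine _ + _ * fine _)).
- rewrite integral_mkcond; apply: eq_integral => z _; rewrite patchE indicE /difference.
  by case: (z \in _); rewrite ?mul0r// mul1r signed_powerM.
- rewrite integral_mkcond; apply: eq_integral => z _; rewrite patchE /far_integrand indicE.
  by case: (z \in _); rewrite ?mul0r// mul1r !signed_powerM.
- by apply: eq_integral => x _; rewrite signed_powerM.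
Qed.

Variables (c : R) (M : nat).
Hypothesis box : Omega_points Omega `<=` cube (fun=> c) (M%:R * grid_side R N).
Local Notation B := (cube (fun=> c) (M%:R * grid_side R N)).
Local Notation b := ((M%:R * grid_side R N) ^+ N).
Local Notation restr u := (fun x => \1_B x * X0_val u x).

Let side0 : 0 <= M%:R * grid_side R N.
Proof. by rewrite mulr_ge0// ltW// grid_side_gt0. Qed.

Lemma box_measure : mu B = b%:E.
Proof. exact: lebesgueN_cube. Qed.

Lemma restr_out (u : W) x : ~ B x -> restr u x = 0.
Proof. by move=> xB /=; rewrite indicE memNset// mul0r. Qed.

Lemma restr_lp_energy (u : W) : lp_energy p (restr u) = lp_energy p (X0_val u).
Proof.
apply/esym/lp_energy_ae; [exact: (X0_val_measurable u)|exact: (measurable_box _ _ u)|].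
exact: X0_val_box box.
Qed.

Lemma restr_near_energy (u : W) : near_energy p (restr u) = near_energy p (X0_val u).
Proof.
apply/esym/near_energy_ae; [exact: (X0_val_measurable u)|exact: (measurable_box _ _ u)|].
exact: X0_val_box box.
Qed.

Lemma restr_far_energy (u : W) : far_energy p (restr u) = far_energy p (X0_val u).
Proof.
apply/esym/far_energy_ae; [exact: (X0_val_measurable u)|exact: (measurable_box _ _ u)|].
exact: X0_val_box box.
Qed.

Let restr_lty (u : W) : (lp_energy p (restr u) < +oo)%E.
Proof. by rewrite restr_lp_energy; exact: (lp_energy_lty hN hOmega hC u). Qed.

Lemma X0_far_bound (u : W) : `|fine (far_energy p (X0_val u))| <=
  (2 `^ p + 1) * (2 * b) * fine (lp_energy p (X0_val u)).
Proof.
rewrite -restr_far_energy -restr_lp_energy.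
exact: (far_energy_bound hp (measurable_cube _ _) box_measure (measurable_box c _ u)
  (@restr_out u) (restr_lty u)).
Qed.

(** A factor leaves the signed far integral once that integral is known to be finite; for this the
    representative is cut off to the box, an almost everywhere equal function. *)
Lemma I_scale_box t (u : W) : Ifun (scale t u) = `|t| `^ p * Ifun u.
Proof.
have mU := X0_val_measurable u.
have mtU : measurable_fun setT (fun x => t * X0_val u x) by exact: measurable_funM.
have mS := X0_val_measurable (scale t u).
have aeS := X0_val_scale hC t u.
have mR := measurable_box c (M%:R * grid_side R N) u.
have mtR : measurable_fun setT (fun x => t * restr u x) by exact: measurable_funM.
have aeR : {ae mu, forall x, X0_val (scale t u) x = t * restr u x}.
  by apply: filterS2 aeS (X0_val_box u box) => x -> <-.
rewrite !I_functionalE (near_energy_ae p mS mtU aeS) (lp_energy_ae p mS mtU aeS).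
rewrite (far_energy_ae p mS mtR aeR).
rewrite near_energyZ// lp_energyZ//.
rewrite (far_energyZ hp (measurable_cube _ _) box_measure mR (@restr_out u) (restr_lty u)).
rewrite restr_far_energy.
have := far_energy_fin_num hp (measurable_cube _ _) box_measure mR (@restr_out u) (restr_lty u).
rewrite restr_far_energy.
have := near_energy_lty hC u; have := near_energy_ge0 p (X0_val u).
have := lp_energy_lty hN hOmega hC u; have := @lp_energy_ge0 R N p (X0_val u).
move: (lp_energy p (X0_val u)) (near_energy p (X0_val u)) (far_energy p (X0_val u)) => l n f.
case: l => // l _ _; case: n => // n _ _; case: f => // f _.
move: (`|t| `^ p) => a; rewrite /=; ring.
Qed.

(** J = 1 means that the integral of |u|^p is p. The far and zero-order terms are then bounded by
    multiples of p, and I <= a leaves a bound on the near energy; [K] is what this inequality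
    gives. *)
Lemma near_energy_sublevel (a : R) : exists K : R, forall u : W,
  I_sublevel hp Omega C rho a u ->
  fine (lp_energy p (X0_val u)) = p /\ fine (near_energy p (X0_val u)) <= K.
Proof.
exists (2 / C * (p * a + C / 2 * ((2 `^ p + 1) * (2 * b) * p) + `|rho| * p)) => u [/= Ju Iu].
have lE : fine (lp_energy p (X0_val u)) = p.
  move: Ju; rewrite /constraint_manifold/= (J_lp_energy u) => h.
  by apply: (mulfI (_ : p^-1 != 0)); rewrite ?invr_eq0 ?gt_eqF// h mulVf ?gt_eqF.
split=> //; have := X0_far_bound u; move: Iu; rewrite I_functionalE lE.
move: (fine (near_energy _ _)) (fine (far_energy _ _)) ((2 `^ p + 1) * (2 * b) * p) => n f K Iu fK.
have {}Iu : C / 2 * n + C / 2 * f + rho * p <= p * a by rewrite -ler_pdivrMl.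
have r1 : - (`|rho| * p) <= rho * p by rewrite -mulNr ler_wpM2r ?(ltW p0)// lerNl ler_normr lexx orbT.
have f1 : - (C / 2 * K) <= C / 2 * f.
  by rewrite -mulrN ler_wpM2l ?divr_ge0 ?(ltW hC)//; move: fK; rewrite ler_norml => /andP[].
rewrite -(ler_pM2l (_ : 0 < C / 2)) ?divr_gt0//.
rewrite mulrA (_ : C / 2 * (2 / C) = 1) ?mul1r; last by field; rewrite gt_eqF.
by move: Iu r1 f1; lra.
Qed.

End IFunctional.

(** * Finitely many dyadic averages without common zero on a sublevel set *)

Section FiniteRank.
Variables (R : realType) (N : nat) (p : R) (hp : 1 < p) (Omega : set 'rV[R]_N) (C rho : R).
Hypothesis hN : (0 < N)%N.
Hypothesis hOmega : bounded_domain Omega.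
Hypothesis hC : 0 < C.
Local Notation E := (euclidean R N).
Local Notation mu := (lebesgueN R N).
Local Notation W := (X0 hp Omega C).

Let p0 : 0 < p. Proof. exact: lt_trans hp. Qed.

Variables (c : R) (M : nat).
Hypothesis box : Omega_points Omega `<=` cube (fun=> c) (M%:R * grid_side R N).
Local Notation B := (cube (fun=> c) (M%:R * grid_side R N)).
Local Notation b := ((M%:R * grid_side R N) ^+ N).
Local Notation restr u := (fun x => \1_B x * X0_val u x).

Let b0 : 0 <= b.
Proof. by rewrite exprn_ge0// mulr_ge0// ltW// grid_side_gt0. Qed.

(** Integrate [young_split] with b = e over the box, of volume [b]: the two terms contribute at most
    e b and e. *)
Lemma abs_integral_le (u : W) (e : R) : 0 < e -> (lp_energy p (X0_val u) <= (e `^ p)%:E)%E ->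
  (\int[mu]_x `|(X0_val u x)%:E| <= (e * (b + 1))%:E)%E.
Proof.
move=> e0 ue; have mU := X0_val_measurable u.
have mI : measurable_fun setT (\1_B : E -> R).
  by apply: measurable_indic; exact: measurable_cube.
have mR := measurable_box c (M%:R * grid_side R N) u.
have -> : (\int[mu]_x `|(X0_val u x)%:E| = \int[mu]_x `|(restr u x)%:E|)%E.
  apply: ge0_ae_eq_integral => //.
  - by apply: measurableT_comp => //; exact/measurable_EFinP.
  - by apply: measurableT_comp => //; exact/measurable_EFinP.
  by apply: filterS (X0_val_box u box) => x h _; rewrite -h.
have mE : measurable_fun setT (fun x => (`|X0_val u x| `^ p)%:E).
  by apply/measurable_EFinP; exact: measurable_powR_norm.
have E0 x : setT x -> (0 <= (`|X0_val u x| `^ p)%:E)%E by rewrite lee_fin powR_ge0.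
have I0 (x : E) : setT x -> (0 <= (\1_B x : R)%:E)%E by rewrite lee_fin.
have mI' : measurable_fun setT (fun x : E => (\1_B x)%:E : \bar R) by exact/measurable_EFinP.
have e0' : (0 <= e%:E)%E by rewrite lee_fin ltW.
have c0 : (0 <= (e `^ (1 - p))%:E :> \bar R)%E by rewrite lee_fin powR_ge0.
apply: (@le_trans _ _ (e%:E * \int[mu]_x (\1_B x)%:E +
    (e `^ (1 - p))%:E * lp_energy p (X0_val u))%E); last first.
  rewrite integral_indicN; last exact: measurable_cube.
  rewrite box_measure mulrDr EFinD mulr1 -EFinM; apply: leeD => //.
  apply: le_trans (lee_wpmul2l c0 ue) _; rewrite -EFinM lee_fin -powRD.
    by rewrite subrK powRr1// ltW.
  by rewrite (gt_eqF e0) implybT.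
rewrite /lp_energy -(ge0_integralZl _ measurableT mI' I0 e0').
rewrite -(ge0_integralZl _ measurableT mE E0 c0) -ge0_integralD//; last 4 first.
- by move=> x _; apply: mule_ge0 => //; exact: I0.
- exact: measurable_funeM.
- by move=> x _; apply: mule_ge0 => //; exact: E0.
- exact: measurable_funeM.
apply: ge0_le_integral => //.
- by apply: measurableT_comp => //; exact/measurable_EFinP.
- by apply: emeasurable_funD; exact: measurable_funeM.
move=> x _; rewrite abse_EFin -!EFinM -EFinD lee_fin /= normrM indicE.
case: (x \in B); rewrite ?normr0 ?mul0r; last first.
  by rewrite mulr0 add0r mulr_ge0// powR_ge0.
by rewrite normr1 mul1r mulr1; exact: young_split.
Qed.

Lemma X0_val_integrable (u : W) : mu.-integrable setT (EFin \o X0_val u).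
Proof.
apply/integrableP; split; first by apply/measurable_EFinP; exact: (X0_val_measurable u).
have := lp_energy_lty hN hOmega hC u; have := @lp_energy_ge0 R N p (X0_val u).
case lE : (lp_energy p (X0_val u)) => [l| |]//; rewrite lee_fin => l0 _.
pose e := (l + 1) `^ p^-1; have l1 : 0 < l + 1 by rewrite ltr_wpDl.
have e0 : 0 < e by rewrite powR_gt0.
have := abs_integral_le (u := u) e0; rewrite lE /e -powRrM mulVf ?gt_eqF// powRr1 ?(ltW l1)//.
by rewrite lee_fin lerDl => /(_ ler01)/le_lt_trans; apply; rewrite ltry.
Qed.

Definition cell_integral (Q : set E) (u : W) : R := \int[mu]_x (\1_Q x * X0_val u x).

Lemma cell_integralB (Q : set E) (u v : W) : measurable Q ->
  cell_integral Q (u - v) = cell_integral Q u - cell_integral Q v.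
Proof.
move=> mQ; have iQ (w : W) := integrable_indicM mQ (X0_val_integrable w).
rewrite /cell_integral -(RintegralB measurableT (iQ u) (iQ v)).
have mI : measurable_fun setT (\1_Q : E -> R) by exact: measurable_indic.
apply: (congr1 fine); apply: ae_eq_integral => //.
- exact: measurable_int (iQ (u - v)).
- apply/measurable_EFinP; apply: measurable_funB.
    exact: measurable_funM mI (X0_val_measurable u).
  exact: measurable_funM mI (X0_val_measurable v).
by apply: filterS (X0_valB u v) => x h _; rewrite h mulrBr.
Qed.

Lemma cell_integral_bound (Q : set E) (u : W) : measurable Q ->
  `|cell_integral Q u| <= (b + 1) * pnorm mu p (X0_val u).
Proof.
move=> mQ; have iQ := integrable_indicM mQ (X0_val_integrable u).
have n0 : 0 <= pnorm mu p (X0_val u) by exact: powR_ge0.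
(* The norm may be 0 while [abs_integral_le] asks for a positive [e]; hence the slack [t]. *)
apply/ler_addgt0Pr => t t0; pose e := pnorm mu p (X0_val u) + t / (b + 1).
have b1 : 0 < b + 1 by rewrite ltr_wpDl.
have e0 : 0 < e by rewrite ltr_wpDl// divr_gt0.
have ue : (lp_energy p (X0_val u) <= (e `^ p)%:E)%E.
  have := lp_energy_lty hN hOmega hC u; have := @lp_energy_ge0 R N p (X0_val u).
  have : pnorm mu p (X0_val u) <= e by rewrite lerDl divr_ge0// ltW.
  rewrite {1}/pnorm -/(lp_energy p (X0_val u)).
  case: (lp_energy p (X0_val u)) => [l| |]//=; rewrite !lee_fin => le l0 _.
  have := ge0_ler_powR (ltW p0) _ _ le; rewrite !nnegrE -powRrM mulVf ?gt_eqF// powRr1//.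
  by apply; [exact: powR_ge0|exact: ltW].
have -> : (b + 1) * pnorm mu p (X0_val u) + t = e * (b + 1).
  by rewrite /e [RHS]mulrDl divfK ?(gt_eqF b1)// mulrC.
have mF : measurable_fun setT (fun x => (\1_Q x * X0_val u x)%:E) by exact: measurable_int iQ.
have h1 : (`|\int[mu]_x (\1_Q x * X0_val u x)%:E| <= (e * (b + 1))%:E)%E.
  apply: le_trans (le_abse_integral _ measurableT mF) _.
  apply: le_trans (abs_integral_le e0 ue); apply: ge0_le_integral => //.
  - exact: measurableT_comp.
  - apply: measurableT_comp => //; apply/measurable_EFinP; exact: (X0_val_measurable u).
  move=> x _; rewrite lee_fin normrM indicE.
  by case: (x \in Q); rewrite ?normr1 ?mul1r// normr0 mul0r.
have := integrable_fin_num measurableT iQ; move: h1; rewrite /cell_integral /Rintegral.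
by case: (integral _ _ _) => // r; rewrite abse_EFin lee_fin.
Qed.

Lemma cell_integral_continuous (Q : set E) : measurable Q -> continuous (cell_integral Q).
Proof.
move=> mQ; have [K K0 HK] := lp_norm_lipschitz hp hN hOmega hC.
apply: (@X0_lipschitz_continuous _ _ _ _ _ _ hC _ ((b + 1) * K)) => u v.
rewrite -cell_integralB// (le_trans (cell_integral_bound _ mQ))// -mulrA.
apply: ler_wpM2l; first by rewrite addr_ge0.
have := HK 0 (v - u); rewrite subr0 [X in _ - X](_ : _ = 0) ?subr0.
  by apply: le_trans; exact: ler_norm.
rewrite /pnorm -/(lp_energy p (X0_val 0)).
have mc : measurable_fun setT (fun _ : E => 0 : R) by exact: measurable_cst.
rewrite (lp_energy_ae p (X0_val_measurable 0) mc (X0_val0 hp Omega C)).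
rewrite /lp_energy integral0_eq => [|x _]; last by rewrite normr0 powR0// gt_eqF.
by rewrite powR0// invr_neq0// gt_eqF.
Qed.

(** The functionals are the integrals over all dyadic cubes of the first n scales in the box. If
    they all vanished at some u of the sublevel set, [zero_average_energy] would give n p <= L p,
    whereas n was chosen larger than [L]. *)
Lemma finite_rank_box (a : R) : exists m (G : 'I_m -> W -> R),
  [/\ forall i, continuous (G i), forall i u, G i (- u) = - G i u &
      forall u, I_sublevel hp Omega C rho a u -> exists i, G i u != 0].
Proof.
have [K HK] := near_energy_sublevel hp rho hN hOmega hC box a.
pose L := 2 `^ p * (2 * N%:R ^+ N) * `|K| / p.
pose n := (Num.truncn L).+1.
have L0 : 0 <= L by rewrite divr_ge0 ?(ltW p0)// !mulr_ge0 ?powR_ge0// exprn_ge0.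
have nL : L < n%:R by have /andP[] := truncn_itv L0.
pose T : finType := {j : 'I_n & {ffun 'I_N -> 'I_(M * 2 ^ j)}}.
pose Q (t : T) : set E := dyadic_cube c (grid_side R N) (tagged t).
have mQ t : measurable (Q t) by exact: measurable_dyadic_cube.
exists #|T|, (fun i => cell_integral (Q (enum_val i))); split.
- by move=> i; exact: cell_integral_continuous.
- move=> i u; rewrite -[- u]sub0r cell_integralB// -[X in X - _ = _](_ : 0 = _) ?sub0r//.
  have := cell_integralB 0 0 (mQ (enum_val i)); rewrite subrr.
  by move=> ->; rewrite subrr.
move=> u /HK[lE nE]; apply: contrapT => no.
have cell0 t : cell_integral (Q t) u = 0.
  apply: contrapT => /eqP h; apply: no; exists (enum_rank t).
  by rewrite enum_rankK.
have iR : mu.-integrable setT (EFin \o restr u).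
  exact: (integrable_indicM (measurable_cube _ _) (X0_val_integrable u)).
have avg (j : 'I_n) k :
    (\int[mu]_x (\1_(@dyadic_cube R N c (grid_side R N) M j k) x * restr u x)%:E = 0)%E.
  have iQ := integrable_indicM (mQ (Tagged _ k : T)) (X0_val_integrable u).
  have := cell0 (Tagged _ k); rewrite /cell_integral /Rintegral.
  have := integrable_fin_num measurableT iQ.
  have -> : (\int[mu]_x (\1_(dyadic_cube c (grid_side R N) k) x * restr u x)%:E =
      \int[mu]_x (\1_(Q (Tagged _ k)) x * X0_val u x)%:E)%E.
    apply: ae_eq_integral => //.
    - exact: measurable_int (integrable_indicM (mQ (Tagged _ k : T)) iR).
    - exact: measurable_int iQ.
    by apply: filterS (X0_val_box u box) => x h _; rewrite /= -h.
  by case: (integral _ _ _) => // r _ /= ->.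
have sN : N%:R * grid_side R N < 1.
  apply: le_lt_trans (grid_side_lt R N); apply: ler_wpM2l => //.
  by have := grid_side_gt0 R N; lra.
have := zero_average_energy hN hp (grid_side_gt0 R N) sN iR (@restr_out R N p hp Omega C c M u) avg.
rewrite (restr_lp_energy box) (restr_near_energy box).
move: lE nE; have := near_energy_lty hC u; have := lp_energy_lty hN hOmega hC u.
have := @lp_energy_ge0 R N p (X0_val u); have := near_energy_ge0 p (X0_val u).
case: (lp_energy p (X0_val u)) => // l; case: (near_energy p (X0_val u)) => // g.
move=> g0 _ _ _ /= -> gK; rewrite -!EFinM lee_fin => h.
have : n%:R * p <= L * p.
  rewrite (le_trans h)// /L divfK ?gt_eqF//; apply: ler_wpM2l.
    by rewrite !mulr_ge0 ?powR_ge0// exprn_ge0.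
  by rewrite (le_trans gK)// ler_norm.
by rewrite ler_pM2r// leNgt nL.
Qed.

End FiniteRank.

Theorem theorem4p8 (R : realType) (N : nat) (hN : (1 <= N)%N)
    (p : R) (hp : 1 < p) (Omega : set 'rV[R]_N) (hOmega : bounded_domain Omega)
    (C rho : R) (hC : 0 < C) (lambda : R)
    (hlambda : ~ eigenvalue_of_problem hp Omega C rho lambda) :
  [/\ (lambda%:E < minimax_eigenvalue hp Omega C rho 1)%E ->
        forall l : nat, isomorphic (critical_group hp Omega C rho lambda l)
          'rV['F_2]_(l == 0%N),
      (minimax_eigenvalue hp Omega C rho 1 < lambda%:E)%E ->
        (forall l : nat, isomorphic (critical_group hp Omega C rho lambda l)
           (reduced_cohomology (I_sublevel hp Omega C rho lambda) (l%:Z - 1))) /\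
        (forall c : critical_group hp Omega C rho lambda 0, c = 0),
      (forall k : nat, (1 <= k)%N ->
        (minimax_eigenvalue hp Omega C rho k < lambda%:E)%E ->
        (lambda%:E < minimax_eigenvalue hp Omega C rho k.+1)%E ->
        exists c : critical_group hp Omega C rho lambda k, c <> 0) &
      (exists l : nat, exists c : critical_group hp Omega C rho lambda l, c <> 0)].
Proof.
have [c [M box]] := box_exists hOmega.
have H := @critical_groups R N p hp Omega C rho (X0_opp_continuous hC) (X0_scale hC)
  (@X0_scale_cvg _ _ _ _ _ _ hC) (X0_scale1 hC) (X0_scale0 hC) (X0_scaleA hC) (X0_scaleN1 hC)
  (J_continuous hN hOmega hC) (J_scale hN hOmega hC) (I_scale_box rho hN hOmega hC box)
  (J_gt0 hN hOmega hC) (finite_rank_box hp rho hN hOmega hC box) lambda.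
exact: H.
Qed.
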